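(* Let $k>0$, let $\alpha,\mu,\omega,\gamma\in\mathbb{C}$ with $\operatorname{Re}(\alpha)>0$, $\operatorname{Re}(\mu)>0$, and let $m=[\operatorname{Re}(\mu)/k]+1$. Let $f$ be a function on $[0,\infty)$ for which the $k$-Prabhakar derivative ${}_{k}D_{\alpha,\mu,\omega}^{\gamma}f$ and the Sumudu transforms and limits at $0^+$ occurring below exist, and let $F(u)=\mathcal{S}[f](u)$. Then, for $u>0$ with $\left|\omega k\left(\frac uk\right)^{\alpha/k}\right|<1$, $$\mathcal{S}\big({}_{k}D_{\alpha,\mu,\omega}^{\gamma}f(t)\big)(u)=\Big(\frac{u}{k}\Big)^{-\frac{\mu}{k}}\Big(1-\omega k\Big(\frac{u}{k}\Big)^{\frac{\alpha}{k}}\Big)^{\frac{\gamma}{k}}F(u)-\sum_{n=0}^{m-1}\Big(\frac{k}{u}\Big)^{n+1}\Big[{}_{k}D_{\alpha,\mu-(n+1)k,\omega}^{\gamma}f(0^{+})\Big].$$ In particular, when $m=1$, $$\mathcal{S}\big({}_{k}D_{\alpha,\mu,\omega}^{\gamma}f(t)\big)(u)=\Big(\frac{u}{k}\Big)^{-\frac{\mu}{k}}\Big(1-\omega k\Big(\frac{u}{k}\Big)^{\frac{\alpha}{k}}\Big)^{\frac{\gamma}{k}}F(u)-\frac{k}{u}\Big[{}_{k}P_{\alpha,k-\mu,\omega}^{-\gamma}f(t)\Big]_{t=0^{+}}.$$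
   Context: The Sumudu transform is $\mathcal{S}[f](u)=\int_0^\infty\frac1u e^{-t/u}f(t)\,dt$, considered for functions $f$ in the set $A$ of functions for which there are $M,\tau_1,\tau_2>0$ with $|f(t)|\le Me^{|t|/\tau_j}$ for $t\in(-1)^j\times[0,\infty)$, and $u\in(-\tau_1,\tau_2)$; here $u>0$. Complex powers are principal branches; $[\cdot]$ in the definition of $m$ is the integer part. The $k$-gamma function is $\Gamma_k(z)=\int_0^\infty e^{-t^k/k}t^{z-1}\,dt$ for $\operatorname{Re}z>0$, and the $k$-Pochhammer symbol is $(\gamma)_{n,k}=\gamma(\gamma+k)\cdots(\gamma+(n-1)k)$, $(\gamma)_{0,k}=1$. The $k$-Mittag-Leffler function is $E_{k,\alpha,\mu}^{\gamma}(z)=\sum_{n=0}^\infty \frac{(\gamma)_{n,k}}{\Gamma_k(\alpha n+\mu)}\frac{z^n}{n!}$. The $k$-Prabhakar integral (for $\operatorname{Re}\alpha,\operatorname{Re}\mu>0$) is $$\big({}_{k}P_{\alpha,\mu,\omega}^{\gamma}f\big)(x)=\int_0^x\frac{(x-t)^{\frac{\mu}{k}-1}}{k}E_{k,\alpha,\mu}^{\gamma}\big[\omega(x-t)^{\frac{\alpha}{k}}\big]f(t)\,dt .$$ The $k$-Prabhakar derivative of order $\mu$, with $m=[\operatorname{Re}(\mu)/k]+1$, is $${}_{k}D_{\alpha,\mu,\omega}^{\gamma}f(t)=\Big(\frac{d}{dt}\Big)^{m}k^{m}\,{}_{k}P_{\alpha,mk-\mu,\omega}^{-\gamma}f(t).$$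 For $0\le n\le m-1$, the same formula with $\mu-(n+1)k$ and $m-n-1$ in place of $\mu$ and $m$ is used: ${}_{k}D_{\alpha,\mu-(n+1)k,\omega}^{\gamma}f=k^{m-n-1}\big(\frac{d}{dt}\big)^{m-n-1}{}_{k}P_{\alpha,mk-\mu,\omega}^{-\gamma}f$ (so for $n=m-1$ it is ${}_{k}P_{\alpha,mk-\mu,\omega}^{-\gamma}f$). A value at $0^+$ is the limit as $t\to0^+$. *)

(* Defs.v *)
(* MathComp-Analysis, with the complex numbers R[i] of real-closed. *)
From HB Require Import structures.
From mathcomp Require Import all_boot all_order all_algebra.
From mathcomp Require Import complex.
From mathcomp Require Import all_classical all_reals all_analysis.

Set Implicit Arguments.
Unset Strict Implicit.
Unset Printing Implicit Defensive.

Import Order.TTheory GRing.Theory Num.Theory.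
Import numFieldNormedType.Exports.

Local Open Scope classical_set_scope.
Local Open Scope complex_scope.
Local Open Scope ring_scope.

(* [Rcomplex R] is real-closed's alias of [R[i]] viewed as a normed space over
   the reals; the norm topology declared here lets the library's limits and
   derivatives apply to complex-valued functions of a real variable. *)
Section RcomplexNormedModule.
Variable R : realType.

Lemma Rcomplex_normrZ (l : R) (x : Rcomplex R) : `|l *: x| = `|l| * `|x|.
Proof.
case: x => a b; rewrite /Num.norm /= /ComplexField.Normc.normc /=.
by rewrite !exprMn -mulrDr sqrtrM ?sqr_ge0// sqrtr_sqr.
Qed.

HB.instance Definition _ :=
  PseudoMetric.copy (Rcomplex R) (pseudoMetric_normed (Rcomplex R)).
HB.instance Definition _ :=
  isPointed.Build (Rcomplex R) 0.
HB.instance Definition _ :=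
  NormedZmod_PseudoMetric_eq.Build R (Rcomplex R) erefl.
HB.instance Definition _ :=
  PseudoMetricNormedZmod_Lmodule_isNormedModule.Build R (Rcomplex R)
    Rcomplex_normrZ.

End RcomplexNormedModule.

Section ComplexFunctions.
Variable R : realType.
Implicit Types (z a : R[i]).

Definition cexp z : R[i] :=
  (expR (complex.Re z) * cos (complex.Im z)) +i*
  (expR (complex.Re z) * sin (complex.Im z)).

(* Principal argument, in ]-pi, pi] for z != 0. *)
Definition carg z : R :=
  let theta := acos (complex.Re z / Normc.normc z) in
  if 0 <= complex.Im z then theta else - theta.

Definition clog z : R[i] := ln (Normc.normc z) +i* carg z.

(* Principal branch of z ^ a; the value at z = 0 follows [powR]. *)
Definition cpow z a : R[i] :=
  if z == 0 then (a == 0)%:R else cexp (a * clog z).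

End ComplexFunctions.

Section ComplexIntegral.
Variable R : realType.
Implicit Types (D : set R) (g : R -> R[i]).

Definition cintegrable D g : Prop :=
  (@lebesgue_measure R).-integrable D (fun t => (complex.Re (g t))%:E) /\
  (@lebesgue_measure R).-integrable D (fun t => (complex.Im (g t))%:E).

Definition cintegral D g : R[i] :=
  (\int[@lebesgue_measure R]_(t in D) complex.Re (g t)) +i*
  (\int[@lebesgue_measure R]_(t in D) complex.Im (g t)).

End ComplexIntegral.

Section RightLimitAtZero.
Variable R : realType.
Implicit Types (g : R -> R[i]).

Definition has_at0p g : Prop := cvg ((g t : Rcomplex R) @[t --> 0^'+]).

Definition at0p g : R[i] := lim ((g t : Rcomplex R) @[t --> 0^'+]).

End RightLimitAtZero.

Section Sumudu.
Variable R : realType.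
Implicit Types (f : R -> R[i]) (u : R).

Definition sumudu_integrand f u (t : R) : R[i] :=
  (u^-1 * expR (- t / u))%:C * f t.

(* Existence is absolute convergence. It holds in particular when f is
   measurable, |f t| <= M exp (t / tau) on [0, +oo[ and 0 < u < tau. *)
Definition sumudu_exists f u : Prop :=
  cintegrable `]0, +oo[ (sumudu_integrand f u).

Definition sumudu f u : R[i] := cintegral `]0, +oo[ (sumudu_integrand f u).

End Sumudu.

Section KPrabhakar.
Variables (R : realType) (k : R).
Implicit Types (alpha mu omega gamma z : R[i]) (f : R -> R[i]).

Definition k_gamma z : R[i] :=
  cintegral `]0, +oo[
    (fun t => (expR (- (t `^ k / k)))%:C * cpow t%:C (z - 1)).

Definition k_pochhammer gamma (n : nat) : R[i] :=
  \prod_(i < n) (gamma + (i%:R * k)%:C).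

Definition k_mittag_leffler_term alpha mu gamma z (n : nat) : R[i] :=
  k_pochhammer gamma n / k_gamma (alpha * n%:R + mu) * (z ^+ n / n`!%:R).

Definition k_mittag_leffler alpha mu gamma z : R[i] :=
  limn (series (k_mittag_leffler_term alpha mu gamma z : nat -> Rcomplex R)).

Definition k_prabhakar_integrand alpha mu omega gamma f (x t : R) : R[i] :=
  cpow (x - t)%:C (mu / k%:C - 1) / k%:C *
  k_mittag_leffler alpha mu gamma (omega * cpow (x - t)%:C (alpha / k%:C)) *
  f t.

Definition k_prabhakar alpha mu omega gamma f (x : R) : R[i] :=
  cintegral `]0, x[ (k_prabhakar_integrand alpha mu omega gamma f x).

(* [truncn] is the integer part, Re mu being nonnegative in all uses. *)
Definition k_order mu : nat := (Num.truncn (complex.Re mu / k)).+1.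

(* The formula of the k-Prabhakar derivative of order mu, with the number m of
   differentiations as a parameter: m = 0 and m < k_order mu also occur. *)
Definition k_prabhakar_deriv_m (m : nat) alpha mu omega gamma f (t : R)
    : R[i] :=
  (k ^+ m)%:C *
  derive1n m (k_prabhakar alpha ((m%:R * k)%:C - mu) omega (- gamma) f
    : R -> Rcomplex R) t.

Definition k_prabhakar_deriv alpha mu omega gamma f (t : R) : R[i] :=
  k_prabhakar_deriv_m (k_order mu) alpha mu omega gamma f t.

Definition k_prabhakar_deriv_exists alpha mu omega gamma f : Prop :=
  let nu := ((k_order mu)%:R * k)%:C - mu in
  (forall x, 0 < x ->
    cintegrable `]0, x[ (k_prabhakar_integrand alpha nu omega (- gamma) f x)) /\
  (forall j t, (j < k_order mu)%N -> 0 < t ->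
    derivable (derive1n j (k_prabhakar alpha nu omega (- gamma) f
      : R -> Rcomplex R)) t 1).

End KPrabhakar.

(* Main.v *)
Require Import Defs.
From mathcomp Require Import all_boot all_order all_algebra.
From mathcomp Require Import complex.
From mathcomp Require Import all_classical all_reals all_analysis.
From mathcomp Require Import measurable_realfun ring lra zify.

Import Order.TTheory GRing.Theory Num.Theory.
Import numFieldNormedType.Exports.

Local Open Scope classical_set_scope.
Local Open Scope complex_scope.
Local Open Scope ring_scope.

Set Implicit Arguments.
Unset Strict Implicit.
Unset Printing Implicit Defensive.

Local Notation Re := (@complex.Re _).
Local Notation Im := (@complex.Im _).
Local Notation normc := (@Normc.normc _).

(** Put s = 1/u.  A Sumudu transform at u is s times the Laplace transform L
    at s ([sumudu_claplace]), and the k-Prabhakar integral g whose derivatives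
    occur in the theorem is the convolution of f with the kernel
      K(t) = sum_n C_n t^(l_n - 1),   l_n = (alpha n + nu) / k,   nu = m k - mu.
    The substitution y = t^k / (k s) turns the Gamma integral of l_n into the
    k-gamma function ([claplace_cpow_k_gamma]), so that the n-th term of K has
    transform c_n (k s)^(- l_n), where c_n is the coefficient of a binomial
    series.  These transforms add up to the transfer function
      H(s) = (k s)^(- nu / k) (1 - omega k (k s)^(- alpha / k))^(gamma / k)
    ([binomial_series], [transfer_series]).  Hence L[g] = H L[f], and the
    theorem follows from the rule for the transform of the m-th derivative of g
    ([laplace_derive1n]), which produces the limits at 0+ as boundary terms.

    The identity L[g] = H L[f] cannot be obtained by termwise integration for
    all the s that satisfy |omega k (k s)^(- alpha / k)| < 1.  The integral of
    the absolute value of the n-th term carries the factor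
    Gamma(Re l_n) / |Gamma(l_n)|, which grows exponentially with n when alpha is
    not real; the sum of these integrals may then be finite for large s only.
    The proof therefore goes in three stages.
    - For large s.  The exponents l_n lie in a sector, which bounds that factor
      by an exponential in Re l_n ([rgamma_le_cgamma], [kernel_term_bound]);
      termwise integration ([kernel_laplace]) and Fubini's theorem
      ([claplace_convolution]) then apply.
    - For s > 1/u.  L[f], L[g] and H are sums of convergent power series around
      every point of ]1/u, +oo[ ([germ_laplace], [germ_transfer]), hence the
      identity propagates from large s to the whole half-line
      ([germ_identity], [prabhakar_laplace]).
    - At s = 1/u.  The transforms of f and of the m-th derivative of g are
      continuous from the right there, by dominated convergence
      ([claplace_boundary]).

    The transform of g itself exists for s > 1/u because a function whose
    derivative has an absolutely convergent transform at s0 > 0 is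
    O(exp(s0 t)) ([laplace_derive_bound]).  The m-th derivative of g exists
    everywhere on ]0, +oo[ but may be discontinuous, so that all of this rests
    on the fundamental theorem of calculus for everywhere differentiable
    functions with a Lebesgue integrable derivative ([ftc_integrable]). *)

(** * The fundamental theorem of calculus for integrable derivatives *)

Section Ftc.
Variable R : realType.
Notation mu := (@lebesgue_measure R).

(** Outer regularity gives open neighbourhoods of [N] of arbitrarily small
    measure, over which the integral is small by absolute continuity. *)
Lemma abs_cont_open (phi : R -> R) (N : set R) (e : R) :
  mu.-integrable [set: R] (EFin \o phi) ->
  measurable N -> mu N = 0%E -> 0 < e ->
  exists V : set R, [/\ open V, N `<=` V &
    (\int[mu]_(x in V) `|phi x|%:E <= e%:E)%E].
Proof.
move=> iphi mN N0 e0.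
have [d [d0 small]] := @integral_normr_continuous _ (measurableTypeR R) R mu phi iphi e e0.
have [||U [oU NU mU]] := @lebesgue_regularity_outer R N d mN.
- by rewrite [X in (X < _)%E]N0.
- by [].
have mUm : measurable U by exact: open_measurable.
exists U; split => //.
have Ud : (mu U < d%:E)%E.
  apply: le_lt_trans mU; rewrite -[in leLHS](setDUK NU) measureU//; last 2 first.
  - exact: measurableD.
  - by rewrite setDIK.
  by rewrite [X in X + _]N0 add0r.
have := ltW (small U mUm Ud); rewrite -lee_fin /Rintegral fineK//.
by apply: integrable_fin_num => //; apply: integrable_norm; exact: integrableS iphi.
Qed.

Lemma is_derive_dist (p : R -> R) (c L e : R) :
  is_derive c 1 p L -> 0 < e ->
  exists2 d : R, 0 < d & forall y, `|y - c| < d ->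
    `|p y - p c - L * (y - c)| <= e * `|y - c|.
Proof.
move=> [dp Lp] e0.
have := dp; rewrite /derivable => /cvg_ex[l hl].
have lL : l = L by rewrite -Lp; apply/esym/cvg_lim.
rewrite {}lL in hl.
move/cvgrPdist_le : hl => /(_ e e0) [d /= d0 H]; exists d => // y yd.
have [->|yc] := eqVneq y c; first by rewrite !subrr mulr0 subrr normr0 mulr0.
have := H (y - c); rewrite /ball_ /= sub0r normrN => /(_ yd).
rewrite subr_eq0 => /(_ yc).
have yc0 : y - c != 0 by rewrite subr_eq0.
rewrite /shift/= scaler1 subrK => h.
have -> : p y - p c - L * (y - c) =
  - ((L - (y - c)^-1 *: (p y - p c)) * (y - c)).
  rewrite /GRing.scale/= mulrBl mulrAC mulVf// mul1r; ring.
by rewrite normrN normrM ler_wpM2r.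
Qed.

(** Let F be the indefinite integral of [phi], N the null set where F' = phi
    is not known, and d = f - F.  Outside N, d' = 0.  On N, the increments of d
    are bounded by the integral of a function H that is larger than
    n + 1 + |phi| on an open neighbourhood [V n] of N, for every n, and yet has
    integral at most e.  Both cases give a local bound of the increments of d by
    e (y - x) plus the integral of H on ]x, y]; a supremum argument makes it
    global, and e is arbitrary. *)
Lemma ftc_integrable (f phi : R -> R) (a b : R) : a < b ->
  (forall x, a <= x <= b -> is_derive x 1 f (phi x)) ->
  mu.-integrable `[a, b] (EFin \o phi) ->
  \int[mu]_(x in `[a, b]) phi x = f b - f a.
Proof.
move=> ab df iphi.
pose g : R -> R := phi \_ `[a, b].
have ig : mu.-integrable [set: R] (EFin \o g).
  rewrite /g -restrict_EFin; apply: (integrable_mkcond _ _).1 => //.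
have igy D : measurable D -> mu.-integrable D (EFin \o g).
  by move=> mD; apply: (@integrableS _ _ _ mu setT).
have mg : measurable_fun [set: R] g.
  by apply/measurable_EFinP; exact: measurable_int ig.
pose F x := \int[mu]_(t in [set` Interval (BLeft a) (BRight x)]) g t.
have locg : locally_integrable [set: R] g.
  by apply: open_integrable_locally => //; exact: openT.
have := @FTC1 R g (BLeft a) (fun y => igy _ (measurable_itv _)) locg.
move=> /= [N1 [mN1 N10 FN]].
pose N : set R := N1 `|` [set a].
have mN : measurable N by exact: measurableU.
have N0 : mu N = 0%E.
  by rewrite /N measureU0//; exact: lebesgue_measure_set1.
pose d x := f x - F x.
suff dab : d b = d a.
  rewrite (_ : \int[mu]_(x in `[a, b]) phi x = F b); last first.
    by rewrite /F; apply: eq_Rintegral => x; rewrite /g patchE => ->.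
  have : F a = 0 by rewrite /F set_itv1 Rintegral_set1.
  by move=> Fa0; move: dab; rewrite /d Fa0; lra.
suff H (e : R) : 0 < e -> `|d b - d a| <= e * (b - a) + e.
  apply/eqP; rewrite -subr_eq0 -normr_eq0 eq_le normr_ge0 andbT.
  apply/ler_addgt0Pr => e e0; rewrite add0r.
  have ba : 0 < b - a + 1 by lra.
  have := H (e / (b - a + 1)) (divr_gt0 e0 ba).
  rewrite (_ : _ * _ + _ = e)//; by field; lra.
move=> e0.
(* H is the sum over n of w n restricted to V n; the choice of V n makes its
   integral at most the sum of the e / 2^(n+1). *)
pose w (n : nat) : R -> R := (fun x => n%:R + 1 + `|g x|) \_ `[a, b].
have iw n : mu.-integrable [set: R] (EFin \o w n).
  rewrite /w -restrict_EFin; apply: (integrable_mkcond _ _).1 => //.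
  rewrite (_ : _ \o _ = (EFin \o cst (n%:R + 1)) \+ (EFin \o (Num.norm \o g)))//.
  apply: integrableD => //.
    apply: measurable_bounded_integrable => //.
    - by rewrite /= lebesgue_measure_itv/= lte_fin ab -EFinB ltry.
    - by exists (n%:R + 1); split => // M ltM x _ /=; rewrite ger0_norm// ltW.
  apply: integrable_norm; exact: igy.
have w0 n x : 0 <= w n x.
  by rewrite /w patchE; case: ifPn => // _; rewrite addr_ge0.
have en n : 0 < e / (2 ^ n.+1)%:R by rewrite divr_gt0// ltr0n expn_gt0.
have /choice[V oV] : forall n : nat, exists V : set R, [/\ open V, N `<=` V &
    (\int[mu]_(x in V) `|w n x|%:E <= (e / (2 ^ n.+1)%:R)%:E)%E].
  by move=> n; exact: abs_cont_open.
have mV n : measurable (V n) by apply: open_measurable; have [] := oV n.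
pose h n : R -> \bar R := (fun x => (w n x)%:E) \_ (V n).
have mh n : measurable_fun [set: R] (h n).
  apply: (measurable_restrictT _ (mV n)).1; apply: measurable_funTS.
  exact: measurable_int (iw n).
have h0 n x : (0 <= h n x)%E.
  by rewrite /h patchE; case: ifPn => // _; rewrite lee_fin.
pose H x := (\sum_(n <oo) h n x)%E.
have mH : measurable_fun [set: R] H by exact: ge0_emeasurable_sum.
have H0 x : (0 <= H x)%E by exact: nneseries_ge0.
have IH : (\int[mu]_(x in [set: R]) H x <= e%:E)%E.
  rewrite /H integral_nneseries//; apply: le_trans (epsilon_trick0 xpredT (ltW e0)).
  apply: lee_nneseries => [n _ _|n _]; first by apply: integral_ge0 => x _; exact: h0.
  rewrite /h -integral_mkcond; have [_ _] := oV n; apply: le_trans.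
  by under [leRHS]eq_integral do rewrite ger0_norm//.
have mHD D : measurable_fun (D : set R) H by apply: measurable_funTS.
have FB x y : a <= x -> x <= y -> F y - F x = \int[mu]_(t in `]x, y]) g t.
  by move=> ax xy; rewrite /F Rintegral_itvB//; exact: igy.
have loc c : a <= c <= b -> exists2 dl : R, 0 < dl & forall x y, a <= x <= c ->
    c <= y <= b -> y - x < dl ->
    (`|d y - d x|%:E <= (e * (y - x))%:E + \int[mu]_(t in `]x, y]) H t)%E.
  move=> acb; have [Nc|Nc] := pselect (N c).
    (* c in N: near c, |f y - f x| <= (|phi c| + 1) (y - x), and w n dominates
       n + 1 + |g| with n >= |phi c| *)
    pose n := (Num.truncn `|phi c|).+1.
    have nphi : `|phi c| <= n%:R by apply/ltW; exact: truncnS_gt.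
    have [oVn NVn _] := oV n.
    have [d1 d10 Hd1] := is_derive_dist (df c acb) ltr01.
    have [d2 /= d20 Hd2] : \forall x \near c, V n x.
      by apply: open_nbhs_nbhs; split => //; exact: NVn.
    exists (Num.min d1 d2); first by rewrite lt_min d10.
    move=> x y /andP[ax xc] /andP[cy yb]; rewrite lt_min => /andP[yx1 yx2].
    have xy : x <= y by exact: le_trans cy.
    apply: (@le_trans _ _ (\int[mu]_(t in `]x, y]) H t)%E); last first.
      by apply: leeDr; rewrite lee_fin mulr_ge0 ?subr_ge0// ltW.
    have xyV t : x < t <= y -> V n t /\ a <= t <= b.
      move=> /andP[xt ty]; split; last by apply/andP; split; lra.
      by apply: Hd2; rewrite /ball_/= ltr_norml; apply/andP; split; lra.
    apply: (@le_trans _ _ (\int[mu]_(t in `]x, y]) (n%:R + 1 + `|g t|)%:E)%E); last first.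
      apply: ge0_le_integral => //.
      - apply/measurable_EFinP; apply: measurable_funTS.
        by apply: measurable_funD => //; exact: measurableT_comp.
      - exact: mHD.
      - move=> t /=; rewrite in_itv/= => txy; rewrite /H.
        have [Vt abt] := xyV _ txy.
        apply: le_trans (nneseries_lim_ge n.+1 _) => //.
        rewrite big_nat_recr//=; apply: le_trans (leeDr _ _); last exact: sume_ge0.
        by rewrite /h patchE mem_set// /w patchE mem_set//= in_itv.
    have -> : (\int[mu]_(t in `]x, y]) (n%:R + 1 + `|g t|)%:E =
       ((n%:R + 1) * (y - x) + \int[mu]_(t in `]x, y]) `|g t|)%:E)%E.
      under eq_integral do rewrite EFinD.
      rewrite integralD//.
      - rewrite integral_cst//= lebesgue_measure_itv/= lte_fin.
        rewrite [in RHS]EFinD /Rintegral fineK//; last first.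
          by apply: integrable_fin_num => //; apply: integrable_norm; exact: igy.
        congr +%E; case: ltP => [xy'|yx]; first by rewrite -EFinB EFinM.
        by rewrite mule0 (_ : y = x) ?subrr ?mulr0//; apply/eqP; rewrite eq_le xy yx.
      - apply: measurable_bounded_integrable => //.
        + rewrite /= lebesgue_measure_itv/= lte_fin; case: ifP => // _.
          by rewrite -EFinB ltry.
        + by exists (n%:R + 1); split => // M ltM z _ /=; rewrite ger0_norm// ltW.
      - by apply: integrable_norm; exact: igy.
    rewrite lee_fin /d (_ : f y - F y - _ = (f y - f x) - (F y - F x)); last by ring.
    apply: (le_trans (ler_normB _ _)); apply: lerD; last first.
      rewrite FB//; apply: le_normr_Rintegral => //; exact: igy.
    have B z : x <= z <= y -> `|f z - f c| <= (n%:R + 1) * `|z - c|.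
      move=> /andP[xz zy]; have := Hd1 z.
      have -> : `|z - c| < d1 by rewrite ltr_norml; apply/andP; split; lra.
      move=> /(_ isT); rewrite mul1r => h1.
      have -> : f z - f c = (f z - f c - phi c * (z - c)) + phi c * (z - c) by ring.
      apply: (le_trans (ler_normD _ _)); rewrite mulrDl mul1r addrC lerD//.
      by rewrite normrM ler_wpM2r.
    have := B y; have := B x; rewrite !lexx xy => /(_ isT) B1 /(_ isT) B2.
    have -> : f y - f x = (f y - f c) - (f x - f c) by ring.
    apply: (le_trans (ler_normB _ _)).
    apply: (le_trans (lerD B2 B1)).
    by rewrite ger0_norm ?subr_ge0// distrC ger0_norm ?subr_ge0//; lra.
  (* c outside N: d has derivative 0 at c *)
  have {}FN : derivable F c 1 /\ derive1 F c = g c.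
    have [] := pselect (derivable F c 1 /\ derive1 F c = g c) => // nF.
    exfalso; apply: Nc; have [->|ca] := eqVneq c a; first by right.
    left; apply: FN => /=; apply: contra_not nF; apply.
    by rewrite lte_fin lt_neqAle eq_sym ca; case/andP: acb.
  have dd : is_derive c 1 d 0.
    have : is_derive c 1 F (phi c).
      split; first by case: FN.
      rewrite -derive1E; case: FN => _ ->; rewrite /g patchE mem_set//=.
    move=> dF; rewrite -(subrr (phi c)); apply: is_deriveB; exact: df.
  have [dl dl0 Hd] := is_derive_dist dd e0.
  exists dl => // x y /andP[ax xc] /andP[cy yb] yx.
  apply: (@le_trans _ _ (e * (y - x))%:E); last by apply: leeDl; exact: integral_ge0.
  rewrite lee_fin (_ : d y - d x = (d y - d c) - (d x - d c)); last by ring.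
  apply: (le_trans (ler_normB _ _)).
  have := Hd y; have := Hd x; rewrite !mul0r !subr0.
  have -> : `|x - c| < dl by rewrite ltr_norml; apply/andP; split; lra.
  have -> : `|y - c| < dl by rewrite ltr_norml; apply/andP; split; lra.
  move=> /(_ isT) B1 /(_ isT) B2; apply: (le_trans (lerD B2 B1)).
  by rewrite ger0_norm ?subr_ge0// distrC ger0_norm ?subr_ge0//; lra.
pose Q y := (`|d y - d a|%:E <= (e * (y - a))%:E + \int[mu]_(t in `]a, y]) H t)%E.
have Qext x y : a <= x -> x <= y -> Q x ->
    (`|d y - d x|%:E <= (e * (y - x))%:E + \int[mu]_(t in `]x, y]) H t)%E -> Q y.
  move=> ax xy Qx Qxy; rewrite /Q.
  have -> : d y - d a = (d y - d x) + (d x - d a) by ring.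
  apply: (@le_trans _ _ (`|d y - d x| + `|d x - d a|)%:E).
    by rewrite lee_fin ler_normD.
  rewrite EFinD; apply: (le_trans (leeD Qxy Qx)).
  have -> : `]a, y]%classic = `]a, x]%classic `|` `]x, y]%classic.
    by apply: itv_bndbnd_setU; rewrite bnd_simp.
  rewrite ge0_integral_setU//; [|exact: mHD|]; last first.
    apply/disj_setPS => z [] /=; rewrite !in_itv/= => /andP[_ zx] /andP[xz _].
    by move: (lt_le_trans xz zx); rewrite ltxx.
  have -> : (e * (y - a) = e * (y - x) + e * (x - a)) by ring.
  by rewrite EFinD addeACA leeD2l// addeC.
(* the supremum of S belongs to S, and is not less than b by the local bound *)
pose S := [set y | a <= y <= b /\ Q y].
have Sa : S a.
  split; first by rewrite lexx ltW.
  by rewrite /Q !subrr normr0 mulr0 add0e; exact: integral_ge0.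
have hS : has_sup S.
  by split; [exists a|exists b => y [/andP[]]].
have supS : a <= sup S <= b.
  apply/andP; split; first exact: sup_upper_bound.
  by apply: sup_le_ub; [exists a|move=> y [/andP[]]].
have [dl dl0 Hl] := loc _ supS.
have [x Sx xs] := sup_adherent (divr_gt0 dl0 (ltr0n _ 2)) hS.
pose y := Num.min b (sup S + dl / 4).
have xsup : x <= sup S by exact: sup_upper_bound.
have ys : sup S <= y.
  by move: supS => /andP[_ sb]; rewrite /y le_min sb/=; lra.
have Sy : S y.
  have [/andP[ax xb] Qx] := Sx; split.
    by rewrite /y ge_min lexx andbT (le_trans ax)// (le_trans xsup).
  apply: (Qext x) => //; first exact: le_trans ys.
  apply: Hl; rewrite ?ax ?ys//=; first by rewrite /y ge_min lexx.
  have : y <= sup S + dl / 4 by rewrite /y ge_min lexx orbT.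
  by lra.
have yb : y = b.
  have : y <= sup S by exact: sup_upper_bound.
  by rewrite /y; case: (leP b (sup S + dl / 4)) => // ? ; lra.
have [_] := Sy; rewrite yb /Q => Qb.
rewrite -lee_fin; apply: (le_trans Qb); rewrite EFinD leeD2l//.
apply: le_trans IH; exact: ge0_subset_integral.
Unshelve. all: by end_near. Qed.
End Ftc.

(** * Improper integrals and the real Laplace transform *)

Section HalfLine.
Variable R : realType.
Notation mu := (@lebesgue_measure R).
Notation pos := (`]0%R, +oo[%classic : set R).

Lemma posP (t : R) : pos t -> 0 < t.
Proof. by rewrite /= in_itv/= andbT. Qed.

Lemma integrable_scale (D : set R) (c : R) (h : R -> R) :
  measurable (D : set (measurableTypeR R)) ->
  mu.-integrable D (EFin \o h) -> mu.-integrable D (EFin \o (fun t => c * h t)).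
Proof. by move=> mD ih; have := integrableZl mD c ih. Qed.

Lemma integrable_sub (D : set R) (g h : R -> R) :
  measurable (D : set (measurableTypeR R)) ->
  mu.-integrable D (EFin \o g) -> mu.-integrable D (EFin \o h) ->
  mu.-integrable D (EFin \o (fun t => g t - h t)).
Proof. by move=> mD ig ih; have := integrableB mD ig ih. Qed.

Lemma integrable_add (D : set R) (g h : R -> R) :
  measurable (D : set (measurableTypeR R)) ->
  mu.-integrable D (EFin \o g) -> mu.-integrable D (EFin \o h) ->
  mu.-integrable D (EFin \o (fun t => g t + h t)).
Proof. by move=> mD ig ih; have := integrableD mD ig ih. Qed.

Lemma expR_ge1 (x : R) : 0 <= x -> 1 <= expR x.
Proof. by move=> x0; rewrite -expR0 ler_expR. Qed.

(** Compact intervals that exhaust ]0, +oo[: improper integrals are limits of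
    integrals over them. *)
Definition expanding_itv (n : nat) : set R := `[n.+1%:R^-1, n.+2%:R].

Lemma expanding_itv_lt n : n.+1%:R^-1 < n.+2%:R :> R.
Proof.
apply: (@le_lt_trans _ _ 1); last by rewrite ltr1n.
by rewrite invf_le1 ?ltr0n// ler1n.
Qed.

Lemma expanding_itv_pos n : expanding_itv n `<=` pos.
Proof.
move=> t; rewrite /expanding_itv /= !in_itv/= andbT => /andP[h _].
by apply: lt_le_trans h; rewrite invr_gt0.
Qed.

Lemma expanding_itv_nondecreasing : nondecreasing_seq expanding_itv.
Proof.
move=> n m nm; apply/subsetPset => t; rewrite /expanding_itv /= !in_itv/=.
move=> /andP[h1 h2]; apply/andP; split.
  by apply: le_trans h1; rewrite lef_pV2 ?posrE// ler_nat.
by apply: (le_trans h2); rewrite ler_nat.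
Qed.

Lemma expanding_itv_bigcup : \bigcup_n expanding_itv n = pos.
Proof.
rewrite eqEsubset; split => [t [n _] /expanding_itv_pos//|t /posP t0].
exists (Num.truncn (t + t^-1)) => //.
have t1 : t + t^-1 < (Num.truncn (t + t^-1)).+1%:R by exact: truncnS_gt.
have ti : 0 < t^-1 by rewrite invr_gt0.
rewrite /expanding_itv /= in_itv/=; apply/andP; split; last first.
  rewrite (@le_trans _ _ (Num.truncn (t + t^-1)).+1%:R)//; last by rewrite ler_nat.
  by lra.
rewrite invf_ple ?posrE//; lra.
Qed.

Lemma Rintegral_exhaustion (E : nat -> set R) (h : R -> R) :
  (forall n, measurable (E n : set (measurableTypeR R))) -> nondecreasing_seq E ->
  (forall n, E n `<=` pos) -> pos `<=` \bigcup_n E n ->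
  mu.-integrable pos (EFin \o h) ->
  (\int[mu]_(x in E n) h x) @[n --> \oo] --> \int[mu]_(x in pos) h x.
Proof.
move=> mitv End Epos Ecup ih.
have ih1 : mu.-integrable [set: R] ((EFin \o h) \_ pos).
  by apply: (integrable_mkcond _ _).1.
have mh n : measurable_fun [set: R] ((EFin \o h) \_ (E n)).
  apply: (measurable_restrictT _ (mitv n)).1.
  apply: (measurable_funS _ (Epos n)) => //.
  exact: measurable_int ih.
have [|||||_ _] := @dominated_convergence _ (measurableTypeR R) R mu
    setT measurableT (fun n => (EFin \o h) \_ (E n))
    ((EFin \o h) \_ pos) (abse \o ((EFin \o h) \_ pos)) => //.
- exact: measurable_int ih1.
- apply: aeW => x _; have [x0|x0] := pselect (pos x); last first.
    rewrite patchE memNset//.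
    rewrite (_ : (fun _ => _) = fun=> point); first exact: cvg_cst.
    by apply/funext => n; rewrite patchE memNset// => /Epos.
  rewrite patchE mem_set//; apply: cvg_near_cst.
  have [n _ nx] := Ecup x x0.
  exists n => // m /= nm; rewrite patchE mem_set//.
  by move: x nx {x0}; apply/subsetPset; exact: End.
- exact: integrable_abse.
- apply: aeW => x n _ /=; rewrite !patchE.
  case: ifPn => [/set_mem/Epos xn|_]; first by rewrite mem_set.
  change (`|0%E : \bar R| <= `|if x \in pos then (EFin \o h) x else point|)%E.
  by rewrite abse0 abse_ge0.
rewrite -integral_mkcond => cv.
rewrite /Rintegral; apply: fine_cvg; rewrite fineK; last exact: integrable_fin_num.
apply: cvg_trans cv; apply: near_eq_cvg; near=> n.
by rewrite [RHS]integral_mkcond.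
Unshelve. all: by end_near. Qed.

Lemma Rintegral_expanding (h : R -> R) :
  mu.-integrable pos (EFin \o h) ->
  (\int[mu]_(x in expanding_itv n) h x) @[n --> \oo] --> \int[mu]_(x in pos) h x.
Proof.
apply: Rintegral_exhaustion.
- by move=> n; exact: measurable_itv.
- exact: expanding_itv_nondecreasing.
- exact: expanding_itv_pos.
- by rewrite expanding_itv_bigcup.
Qed.

Lemma ge0_integrable_expanding (h : R -> R) (M : R) :
  measurable_fun pos h -> (forall x : R, 0 < x -> 0 <= h x) ->
  (forall n, (\int[mu]_(x in expanding_itv n) (h x)%:E <= M%:E)%E) ->
  mu.-integrable pos (EFin \o h).
Proof.
move=> mh h0 hM; apply/integrableP; split; first exact/measurable_EFinP.
apply: (@le_lt_trans _ _ M%:E); last exact: ltry.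
have -> : (\int[mu]_(x in pos) `|(EFin \o h) x| = \int[mu]_(x in pos) (h x)%:E)%E.
  by apply: eq_integral => x /set_mem/posP x0 /=; rewrite ger0_norm// h0.
rewrite -expanding_itv_bigcup.
have /cvg_lim <- // := @ge0_nondecreasing_set_cvg_integral _ (measurableTypeR R) R expanding_itv
  (EFin \o h) mu expanding_itv_nondecreasing (fun=> measurable_itv _)
  (fun n => measurable_funS (measurable_itv _) (expanding_itv_pos (n := n))
    ((measurable_EFinP _ _).2 mh)) (fun i x xi => h0 x (posP (expanding_itv_pos xi))).
apply: lime_le.
  apply: ereal_nondecreasing_is_cvgn; apply: ge0_nondecreasing_set_nondecreasing_integral.
  - exact: expanding_itv_nondecreasing.
  - by move=> i; exact: measurable_itv.
  - move=> i; apply: (measurable_funS _ (expanding_itv_pos (n := i))) => //.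
    exact/measurable_EFinP.
  - by move=> i x /expanding_itv_pos/posP x0; rewrite lee_fin h0.
by apply: nearW.
Qed.

Lemma pos_continuous_measurable (h : R -> R) :
  (forall x : R, 0 < x -> {for x, continuous h}) -> measurable_fun pos h.
Proof.
move=> ch; apply: open_continuous_measurable_fun; first exact: interval_open.
by move=> x /set_mem/posP; exact: ch.
Qed.

Lemma is_derive_continuous (p : R -> R) (x d : R) : is_derive x 1 p d -> {for x, continuous p}.
Proof. by move=> [dp _]; apply/differentiable_continuous/derivable1_diffP. Qed.

(** The integrals of [h] over compact intervals are increments of [F], so they
    are bounded by 2 M. *)
Lemma integrable_bounded_antiderivative (F h : R -> R) (M : R) :
  (forall x : R, 0 < x -> is_derive x 1 F (h x)) ->
  (forall x : R, 0 < x -> 0 <= h x) ->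
  (forall x : R, 0 < x -> {for x, continuous h}) ->
  (forall x : R, 0 < x -> `|F x| <= M) ->
  mu.-integrable pos (EFin \o h).
Proof.
move=> dF h0 ch FM.
apply: (@ge0_integrable_expanding h (M + M)) => //.
  exact: pos_continuous_measurable.
move=> n; have n0 : 0 < n.+1%:R^-1 :> R by rewrite invr_gt0.
have m0 : 0 < n.+2%:R :> R by [].
have ih : mu.-integrable (expanding_itv n) (EFin \o h).
  apply: continuous_compact_integrable; first exact: segment_compact.
  apply: continuous_in_subspaceT => x /set_mem/expanding_itv_pos/posP x0.
  exact: ch.
rewrite -(fineK (integrable_fin_num _ ih)); last exact: measurable_itv.
rewrite lee_fin -[X in X <= _]/(\int[mu]_(x in expanding_itv n) h x).
have dFn (x : R) : n.+1%:R^-1 <= x <= n.+2%:R -> is_derive x 1 F (h x).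
  by move=> /andP[nx _]; apply: dF; exact: lt_le_trans nx.
rewrite (ftc_integrable (expanding_itv_lt n) dFn ih).
apply: le_trans (ler_norm _) _; apply: (le_trans (ler_normB _ _)).
by rewrite lerD// FM.
Qed.

Lemma improper_ftc (F h : R -> R) (A B : R) :
  (forall x : R, 0 < x -> is_derive x 1 F (h x)) ->
  mu.-integrable pos (EFin \o h) ->
  F x @[x --> 0^'+] --> A -> F x @[x --> +oo] --> B ->
  \int[mu]_(x in pos) h x = B - A.
Proof.
move=> dF ih FA FB; apply: cvg_unique (Rintegral_expanding ih) _ => //.
have -> : (fun n => \int[mu]_(x in expanding_itv n) h x) =
    (fun n => F n.+2%:R - F n.+1%:R^-1).
  apply/funext => n; apply: (ftc_integrable (expanding_itv_lt n)).
    move=> x /andP[nx _]; apply: dF; apply: lt_le_trans nx.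
    by rewrite invr_gt0.
  apply: integrableS ih => //; exact: expanding_itv_pos.
apply: cvgB.
  have : (n.+2%:R : R) @[n --> \oo] --> +oo.
    have := @cvgr_idn R; rewrite -(cvg_shiftn 2) /=; apply: cvg_trans.
    by apply: near_eq_cvg; near=> n; rewrite addn2.
  by move/cvg_comp; apply.
have /cvg_at_rightP := FA; apply; split; first by move=> n; rewrite invr_gt0.
exact: cvg_harmonic.
Unshelve. all: by end_near. Qed.

Lemma is_derive_chain (f g : R -> R) (x df dg : R) :
  is_derive (g x) 1 f df -> is_derive x 1 g dg ->
  is_derive x 1 (fun t => f (g t)) (df * dg).
Proof.
move=> hf hg; rewrite mulrC.
by have := @is_derive1_comp _ f g x df dg hf hg; rewrite mulrC.
Qed.

Lemma is_derive_expR_comp (g : R -> R) (x dg : R) :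
  is_derive x 1 g dg -> is_derive x 1 (fun t => expR (g t)) (expR (g x) * dg).
Proof. by move=> hg; apply: is_derive_chain. Qed.

Lemma is_derive_val (f : R -> R) (x d d' : R) :
  is_derive x 1 f d -> d = d' -> is_derive x 1 f d'.
Proof. by move=> + <-. Qed.

Lemma is_derive_mul (f g : R -> R) (x df dg : R) :
  is_derive x 1 f df -> is_derive x 1 g dg ->
  is_derive x 1 (fun t => f t * g t) (df * g x + f x * dg).
Proof.
move=> hf hg; have := is_deriveM hf hg.
by move/is_derive_val; apply; rewrite /GRing.scale/= addrC mulrC.
Qed.

Lemma is_derive_scale (f : R -> R) (c x df : R) :
  is_derive x 1 f df -> is_derive x 1 (fun t => c * f t) (c * df).
Proof. by move=> hf; have := is_deriveZ c hf. Qed.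

Lemma is_derive_expRN (s x : R) :
  is_derive x 1 (fun t => expR (- (s * t))) (- s * expR (- (s * x))).
Proof.
rewrite mulrC; apply: is_derive_expR_comp.
have -> : (fun t => - (s * t)) = (fun t => (- s) * t).
  by apply/funext => t; rewrite mulNr.
rewrite -[X in is_derive _ _ _ X]mulr1.
by apply: is_derive_scale; exact: is_derive_id.
Qed.

Lemma integrable_expRN (c : R) : 0 < c ->
  mu.-integrable pos (EFin \o (fun t => expR (- (c * t)))).
Proof.
move=> c0; apply: (@integrable_bounded_antiderivative
    (fun t => - c^-1 * expR (- (c * t))) _ c^-1).
- move=> x x0; apply: (is_derive_val (is_derive_scale (- c^-1) (is_derive_expRN c x))).
  by rewrite mulrA mulrNN mulVf ?mul1r// gt_eqF.
- by move=> x _; exact: expR_ge0.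
- by move=> x _; exact: is_derive_continuous (is_derive_expRN c x).
- move=> x x0; have ci : 0 <= c^-1 by rewrite invr_ge0 ltW.
  rewrite normrM normrN (ger0_norm ci) ger0_norm ?expR_ge0// ler_piMr//.
  by rewrite -expR0 ler_expR oppr_le0 mulr_ge0// ltW.
Qed.

Definition laplace (h : R -> R) (s : R) : R :=
  \int[mu]_(t in pos) (expR (- (s * t)) * h t).

Definition laplace_integrable (h : R -> R) (s : R) : Prop :=
  mu.-integrable pos (EFin \o (fun t => expR (- (s * t)) * h t)).

Lemma measurable_expRN (D : set R) (s : R) : measurable_fun D (fun t => expR (- (s * t))).
Proof.
by apply: measurableT_comp => //; apply: measurableT_comp.
Qed.

(** [h] is recovered from the integrand by multiplication with exp(s t). *)
Lemma laplace_integrable_measurable h s : laplace_integrable h s -> measurable_fun pos h.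
Proof.
move=> /measurable_int/measurable_EFinP mh.
rewrite (_ : h = fun t => expR (- (- s * t)) * (expR (- (s * t)) * h t)).
  by apply: measurable_funM => //; exact: measurable_expRN.
apply/funext => t; rewrite mulrA -expRD (_ : _ + _ = 0); last by ring.
by rewrite expR0 mul1r.
Qed.

Lemma laplace_integrable_le h (s s' : R) : s <= s' ->
  laplace_integrable h s -> laplace_integrable h s'.
Proof.
move=> ss' ih; have mh := laplace_integrable_measurable ih.
apply: le_integrable ih => //.
  apply/measurable_EFinP; apply: measurable_funM => //; exact: measurable_expRN.
move=> t /posP t0 /=; rewrite lee_fin !normrM ler_wpM2r//.
by rewrite !ger0_norm ?expR_ge0// ler_expR lerN2 ler_wpM2r// ltW.
Qed.

(** y b - y a is the integral of y' = exp(s t) (exp(- s t) y') over [a, b], at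
    most exp(s b) times the integral of |exp(- s t) y'|.  Comparison with the
    value at 1 gives the bound. *)
Lemma laplace_derive_bound (y y' : R -> R) (s : R) : 0 < s ->
  (forall t : R, 0 < t -> is_derive t 1 y (y' t)) ->
  laplace_integrable y' s ->
  exists C, forall t, 0 < t -> `|y t| <= C * expR (s * t).
Proof.
move=> s0 dy iy.
have my' := laplace_integrable_measurable iy.
have iab (a b : R) : 0 < a -> mu.-integrable `[a, b] (EFin \o y').
  move=> a0; have ab : `[a, b]%classic `<=` pos.
    by move=> t /=; rewrite !in_itv/= andbT => /andP[+ _]; exact: lt_le_trans.
  have : mu.-integrable `[a, b] (EFin \o (fun t => expR (s * b) * (expR (- (s * t)) * y' t))).
    by apply: integrable_scale => //; apply: integrableS iy.
  apply: le_integrable => //; first by apply/measurable_EFinP; exact: (measurable_funS _ ab my').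
  move=> t /=; rewrite in_itv/= => /andP[_ tb]; rewrite lee_fin mulrA normrM.
  rewrite ler_peMl// ger0_norm ?mulr_ge0 ?expR_ge0// -expRD expR_ge1//.
  by rewrite subr_ge0 ler_wpM2l// ltW.
pose I := \int[mu]_(t in pos) `|expR (- (s * t)) * y' t|.
have I0 : 0 <= I by exact: Rintegral_ge0.
have key (a b : R) : 0 < a -> a < b -> `|y b - y a| <= expR (s * b) * I.
  move=> a0 ab; have dyab (t : R) : a <= t <= b -> is_derive t 1 y (y' t).
    by move=> /andP[ta _]; apply: dy; exact: lt_le_trans ta.
  rewrite -(ftc_integrable ab dyab (iab a b a0)).
  have abpos : `[a, b]%classic `<=` pos.
    by move=> t /=; rewrite !in_itv/= andbT => /andP[+ _]; exact: lt_le_trans.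
  apply: (le_trans (le_normr_Rintegral _ _)) => //; first exact: iab.
  have iny : mu.-integrable pos (EFin \o (fun t => `|expR (- (s * t)) * y' t|)).
    exact: (integrable_norm iy).
  apply: (@le_trans _ _ (\int[mu]_(t in `[a, b]) (expR (s * b) * `|expR (- (s * t)) * y' t|))).
    apply: le_Rintegral => //.
    - exact: (integrable_norm (iab _ _ a0)).
    - by apply: integrable_scale => //; apply: integrableS iny.
    move=> t /=; rewrite in_itv/= => /andP[_ tb]; rewrite normrM mulrA.
    rewrite ler_peMl// ger0_norm ?expR_ge0// -expRD expR_ge1//.
    by rewrite subr_ge0 ler_wpM2l// ltW.
  rewrite RintegralZl//; last exact: integrableS iny.
  apply: ler_wpM2l; first exact: expR_ge0.
  rewrite /I /Rintegral fine_le//.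
  - by apply: integrable_fin_num => //; exact: integrableS iny.
  - by apply: integrable_fin_num.
  - apply: ge0_subset_integral => //; exact: measurable_int iny.
exists (`|y 1| + expR s * I + I) => t t0.
have e1 : 1 <= expR (s * t) by rewrite expR_ge1// mulr_ge0// ltW.
have B : `|y t - y 1| <= (expR s * I + I) * expR (s * t).
  rewrite mulrDl; have [t1|t1|->] := ltgtP t 1; last first.
  - by rewrite subrr normr0 addr_ge0// !mulr_ge0// ?expR_ge0.
  - apply: (le_trans (key _ _ ltr01 t1)).
    by rewrite mulrC lerDr !mulr_ge0// expR_ge0.
  - rewrite distrC; apply: (le_trans (key _ _ t0 t1)); rewrite mulr1.
    apply: (@le_trans _ _ (expR s * I * expR (s * t))).
      by rewrite ler_peMr// mulr_ge0// expR_ge0.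
    by rewrite lerDl mulr_ge0// expR_ge0.
rewrite -(subrK (y 1) (y t)); apply: (le_trans (ler_normD _ _)).
rewrite -addrA mulrDl [leLHS]addrC; apply: lerD => //.
by rewrite ler_peMr.
Qed.

Lemma expRN_cvgy (c : R) : 0 < c -> expR (- (c * t)) @[t --> +oo] --> (0 : R).
Proof.
move=> c0.
have -> : (fun t => expR (- (c * t))) = (fun t => expR (- t)) \o (fun t => c * t).
  by [].
apply: (@cvg_comp _ _ _ _ _ _ (pinfty_nbhs R)).
  by apply: gt0_cvgMry => //; exact: cvg_id.
exact: cvgr_expR.
Qed.

(** Integration by parts: the derivative of exp(- s t) y(t) integrates to - l,
    since s > s0 and y = O(exp(s0 t)) make the boundary term at +oo vanish. *)
Lemma laplace_derive (y y' : R -> R) (l s s0 : R) : 0 < s0 -> s0 < s ->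
  (forall t : R, 0 < t -> is_derive t 1 y (y' t)) ->
  y t @[t --> 0^'+] --> l ->
  laplace_integrable y' s0 ->
  laplace_integrable y s /\ laplace y' s = s * laplace y s - l.
Proof.
move=> s00 s0s dy yl iy'.
have [C HC] := laplace_derive_bound s00 dy iy'.
have my : measurable_fun pos y.
  by apply: pos_continuous_measurable => x x0; exact: is_derive_continuous (dy x x0).
have d0 : 0 < s - s0 by rewrite subr_gt0.
have C0 : 0 <= C.
  by have := le_trans (normr_ge0 _) (HC 1 ltr01); rewrite pmulr_lge0 ?expR_gt0.
have bnd t : 0 < t -> `|expR (- (s * t)) * y t| <= C * expR (- ((s - s0) * t)).
  move=> t0; rewrite normrM ger0_norm ?expR_ge0//.
  apply: (@le_trans _ _ (expR (- (s * t)) * (C * expR (s0 * t)))).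
    by rewrite ler_wpM2l ?expR_ge0// HC.
  rewrite mulrCA -expRD (_ : _ + _ = - ((s - s0) * t))//; ring.
have iy : laplace_integrable y s.
  have := integrable_scale C (measurable_itv _) (integrable_expRN d0).
  apply: le_integrable => //.
    by apply/measurable_EFinP; apply: measurable_funM => //; exact: measurable_expRN.
  move=> t /posP t0 /=; rewrite lee_fin; apply: (le_trans (bnd t t0)).
  exact: ler_norm.
split=> //.
have iy's := laplace_integrable_le (ltW s0s) iy'.
suff : laplace y' s - s * laplace y s = - l by lra.
rewrite -RintegralZl//= -RintegralB//=; last exact: integrable_scale.
rewrite -[RHS]sub0r.
apply: (@improper_ftc (fun t => expR (- (s * t)) * y t)).
- move=> x x0; apply: (is_derive_val (is_derive_mul (is_derive_expRN s x) (dy x x0))); ring.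
- by apply: integrable_sub => //; exact: integrable_scale.
- rewrite -[l in X in _ --> X]mul1r; apply: cvgM => //.
  rewrite -[X in _ --> X](_ : expR (- (s * 0)) = 1); last by rewrite mulr0 oppr0 expR0.
  apply: cvg_at_right_filter; exact: is_derive_continuous (is_derive_expRN s 0).
- apply: (@squeeze_cvgr _ _ _ _ (fun t => - (C * expR (- ((s - s0) * t)))) (fun t => C * expR (- ((s - s0) * t)))).
  + near=> t; rewrite -ler_norml; apply: bnd; near: t; exact: nbhs_pinfty_gt.
  + rewrite -oppr0 -(mulr0 C); apply: cvgN; apply: cvgMr; exact: expRN_cvgy.
  + rewrite -(mulr0 C); apply: cvgMr; exact: expRN_cvgy.
Unshelve. all: by end_near. Qed.

Lemma laplace_derive1n (y : R -> R) (m : nat) (l : nat -> R) (s0 : R) : 0 < s0 ->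
  (forall j (t : R), (j < m)%N -> 0 < t -> derivable (derive1n j y) t 1) ->
  (forall j, (j < m)%N -> derive1n j y t @[t --> 0^'+] --> l j) ->
  laplace_integrable (derive1n m y) s0 ->
  forall s : R, s0 < s -> laplace_integrable y s /\
    laplace (derive1n m y) s =
    s ^+ m * laplace y s - \sum_(j < m) s ^+ (m - j.+1) * l j.
Proof.
elim: m s0 => [|m IH] s0 s00 dy yl im s s0s.
  split; first exact: laplace_integrable_le (ltW s0s) im.
  by rewrite big_ord0 expr0 mul1r subr0.
have dm (t : R) : 0 < t -> is_derive t 1 (derive1n m y) (derive1n m.+1 y t).
  by move=> t0; split; [exact: dy|rewrite derive1nS derive1E].
(* each differentiation loses a part of the half-line, so an intermediate abscissa is needed *)
pose s1 := (s0 + s) / 2.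
have s01 : s0 < s1 by rewrite /s1; lra.
have s1s : s1 < s by rewrite /s1; lra.
have [i1 _] := laplace_derive s00 s01 dm (yl m (ltnSn m)) im.
have [_ ->] := laplace_derive s00 s0s dm (yl m (ltnSn m)) im.
have [] := IH s1 (lt_trans s00 s01) _ _ i1 s s1s.
- by move=> j t jm; apply: dy; exact: ltnW.
- by move=> j jm; apply: yl; exact: ltnW.
move=> iy ->; split => //.
rewrite big_ord_recr/= subnn expr0 mul1r exprS mulrBr mulrA -addrA -opprD.
congr (_ - (_ + _)); rewrite mulr_sumr; apply: eq_bigr => j _.
by rewrite mulrA -exprS -subSn.
Qed.

End HalfLine.

(** * Absolutely convergent series and real-analytic germs *)

Section AbsSeries.
Variable R : realType.

(** Absolute convergence as an extended-real inequality, the form in which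
    Tonelli's theorem delivers it. *)
Definition abs_summable (u : nat -> R) : Prop := (\sum_(n <oo) (`|u n|)%:E < +oo)%E.

Lemma abs_summable_le (u v : nat -> R) : (forall n, `|u n| <= `|v n|) ->
  abs_summable v -> abs_summable u.
Proof.
move=> uv; apply: le_lt_trans; apply: lee_nneseries => n _; first by rewrite lee_fin.
by rewrite lee_fin.
Qed.

Lemma abs_summable_bound (u : nat -> R) (M : R) :
  (forall n, series (fun i => `|u i|) n <= M) -> abs_summable u.
Proof.
move=> uM; apply: (@le_lt_trans _ _ M%:E); last exact: ltry.
apply: lime_le; first by apply: is_cvg_nneseries => n _ _; rewrite lee_fin.
by apply: nearW => n; rewrite sumEFin lee_fin; exact: uM.
Qed.

Lemma abs_summable_fin (u : nat -> R) : abs_summable u ->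
  (\sum_(n <oo) (`|u n|)%:E)%E = (fine (\sum_(n <oo) (`|u n|)%:E)%E)%:E.
Proof.
move=> su; rewrite fineK// ge0_fin_numE//.
by apply: nneseries_ge0 => n _ _; rewrite lee_fin.
Qed.

Lemma abs_summable_series_le (u : nat -> R) n : abs_summable u ->
  series (fun i => `|u i|) n <= fine (\sum_(n <oo) (`|u n|)%:E)%E.
Proof.
move=> su; rewrite -lee_fin -abs_summable_fin// /series /= -sumEFin.
by apply: nneseries_lim_ge => i _ _; rewrite lee_fin.
Qed.

Lemma abs_summable_norm_cvg (u : nat -> R) : abs_summable u ->
  cvgn (series (fun i => `|u i|)).
Proof.
move=> su; apply: nondecreasing_is_cvgn; first exact: nondecreasing_series.
by exists (fine (\sum_(n <oo) (`|u n|)%:E)%E) => _ [n _ <-]; exact: abs_summable_series_le.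
Qed.

Lemma abs_summable_cvg (u : nat -> R) : abs_summable u -> cvgn (series u).
Proof. by move=> /abs_summable_norm_cvg; exact: normed_cvg. Qed.

Lemma cvg_abs_summable (u : nat -> R) :
  cvgn (series (fun i => `|u i|)) -> abs_summable u.
Proof.
move=> cu; apply: (@abs_summable_bound _ (limn (series (fun i => `|u i|)))) => n.
by apply: nondecreasing_cvgn_le => //; exact: nondecreasing_series.
Qed.

Lemma abs_summable_scale (u : nat -> R) c : abs_summable u ->
  abs_summable (fun n => c * u n).
Proof.
move=> su; rewrite /abs_summable; under eq_eseriesr do rewrite normrM EFinM.
by rewrite nneseriesZl// abs_summable_fin// -EFinM ltry.
Qed.

Lemma abs_summable_add (u v : nat -> R) : abs_summable u -> abs_summable v ->
  abs_summable (fun n => u n + v n).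
Proof.
move=> su sv.
apply: (@abs_summable_bound _ (fine (\sum_(n <oo) (`|u n|)%:E)%E + fine (\sum_(n <oo) (`|v n|)%:E)%E)) => n.
apply: le_trans (lerD (abs_summable_series_le n su) (abs_summable_series_le n sv)).
by rewrite /series/= -big_split/=; apply: ler_sum => i _; exact: ler_normD.
Qed.

Lemma cvg_series_scale (u : nat -> R) (c l : R) : series u @ \oo --> l ->
  series (fun n => c * u n) @ \oo --> c * l.
Proof.
move=> cu; rewrite (_ : series _ = fun n => c * series u n).
  by apply: cvgM => //; exact: cvg_cst.
by apply/funext => n; rewrite /series/= mulr_sumr.
Qed.

Lemma cvg_series_add (u v : nat -> R) (k l : R) : series u @ \oo --> k ->
  series v @ \oo --> l -> series (fun n => u n + v n) @ \oo --> k + l.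
Proof.
move=> cu cv; rewrite (_ : series _ = fun n => series u n + series v n).
  exact: cvgD.
by apply/funext => n; rewrite /series/= -big_split.
Qed.

Lemma cvg_series_norm_le (u : nat -> R) (l : R) : abs_summable u ->
  series u @ \oo --> l -> `|l| <= fine (\sum_(n <oo) (`|u n|)%:E)%E.
Proof.
move=> su cu; have cn : (fun n => `|series u n|) @ \oo --> `|l| by apply: cvg_norm.
rewrite -(cvg_lim _ cn)//; apply: limr_le; first by apply/cvg_ex; eexists; exact: cn.
apply: nearW => n; apply: le_trans (abs_summable_series_le n su).
exact: ler_norm_sum.
Qed.

Lemma ratio_test (u : nat -> R) (q : R) (N : nat) : q < 1 -> (forall n, 0 <= u n) ->
  (forall n, (N <= n)%N -> u n.+1 <= q * u n) -> abs_summable u.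
Proof.
move=> q1 u0 uq; pose p := Num.max q (1 / 2).
have p0 : 0 < p by rewrite /p lt_max; apply/orP; right; lra.
have p1 : p < 1 by rewrite /p gt_max q1; lra.
have up n : (N <= n)%N -> u n.+1 <= p * u n.
  by move=> Nn; apply: (le_trans (uq n Nn)); rewrite ler_wpM2r// /p le_max lexx.
(* C is chosen so that u n <= C p^n also holds for the first N + 1 terms *)
pose C := (\sum_(i < N.+1) u i) / p ^+ N.
have C0 : 0 <= C by rewrite divr_ge0 ?exprn_ge0 ?(ltW p0)// sumr_ge0.
have uC n : (n <= N)%N -> u n <= C * p ^+ n.
  move=> nN; rewrite /C -mulrA mulrC; apply: (@le_trans _ _ (\sum_(i < N.+1) u i)).
    rewrite (bigD1 (Ordinal (nN : (n < N.+1)%N)))//= lerDl sumr_ge0//.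
  rewrite ler_peMl ?sumr_ge0// mulrC ler_pdivlMr ?exprn_gt0// mul1r.
  by rewrite ler_wiXn2l// ltW.
have {}uC n : u n <= C * p ^+ n.
  have [/uC//|/ltnW] := leqP n N.
  elim: n => [|n IH]; first by rewrite leqn0 => /eqP N0; apply: uC; rewrite N0.
  rewrite leq_eqVlt => /predU1P[<-|]; first exact: uC.
  rewrite ltnS => Nn; apply: (le_trans (up _ Nn)).
  by rewrite exprS mulrCA ler_wpM2l ?(ltW p0)// IH.
apply: (@abs_summable_le _ (geometric C p)).
  move=> n; rewrite /geometric/= !ger0_norm//.
  by rewrite mulr_ge0// exprn_ge0// ltW.
apply: cvg_abs_summable.
have -> : (fun i => `|geometric C p i|) = geometric C p.
  by apply/funext => n; rewrite ger0_norm// /geometric /= mulr_ge0// exprn_ge0// ltW.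
by apply: is_cvg_geometric_series; rewrite ger0_norm// ltW.
Qed.

Lemma nneseries_term_le (u : nat -> \bar R) n : (forall k, (0 <= u k)%E) ->
  (u n <= \sum_(k <oo) u k)%E.
Proof.
move=> u0; apply: le_trans (nneseries_lim_ge n.+1 _) => //.
by rewrite big_nat_recr//= leeDr// sume_ge0.
Qed.

Section Swap.
Context d (T : measurableType d) (nu : {measure set T -> \bar R}) (D : set T).
Hypothesis mD : measurable D.
Variables (b : nat -> T -> R) (B : T -> R).
Hypothesis mb : forall n, measurable_fun D (b n).
Hypothesis sb : (\sum_(n <oo) \int[nu]_(x in D) (`|b n x|)%:E < +oo)%E.
Hypothesis cb : forall x, D x -> series (fun n => b n x) @ \oo --> B x.

Lemma integrable_series_term n : nu.-integrable D (EFin \o b n).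
Proof.
apply/integrableP; split; first exact/measurable_EFinP.
apply: le_lt_trans sb.
apply: (nneseries_term_le (u := fun n => \int[nu]_(x in D) (`|b n x|)%:E)%E) => k.
by apply: integral_ge0 => x _; rewrite lee_fin.
Qed.

(** Dominated convergence for the partial sums: the sum of the |b n| dominates
    them, and is integrable by Tonelli's theorem. *)
Lemma integral_series_swap :
  nu.-integrable D (EFin \o B) /\
  series (fun n => \int[nu]_(x in D) b n x) @ \oo --> \int[nu]_(x in D) B x.
Proof.
pose G x := (\sum_(n <oo) (`|b n x|)%:E)%E.
have mab n : measurable_fun D (fun x => (`|b n x|)%:E).
  by apply/measurable_EFinP; exact: measurableT_comp.
have iG : nu.-integrable D G.
  apply/integrableP; split.
    by apply: (@ge0_emeasurable_sum _ _ _ _ (fun n x => (`|b n x|)%:E) xpredT).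
  rewrite (eq_integral G); last first.
    by move=> x _; rewrite gee0_abs//; apply: nneseries_ge0.
  by rewrite /G integral_nneseries.
have mS n : measurable_fun D (fun x => series (fun n => b n x) n).
  by apply: measurable_sum.
have mB : measurable_fun D B.
  by apply: (measurable_fun_cvg (h := fun n x => series (fun n => b n x) n)).
have [|||||iB _ cv] := @dominated_convergence _ T R nu D mD
    (fun n => EFin \o (fun x => series (fun n => b n x) n)) (EFin \o B) G => //.
- by move=> n; exact/measurable_EFinP.
- exact/measurable_EFinP.
- by apply: aeW => x Dx; apply: cvg_EFin; [exact: nearW|exact: cb].
- apply: aeW => x n Dx; rewrite /= /series/=.
  apply: (@le_trans _ _ (\sum_(0 <= i < n) `|b i x|)%:E).
    by rewrite lee_fin; exact: ler_norm_sum.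
  rewrite -sumEFin; exact: nneseries_lim_ge.
split => //.
rewrite (_ : series _ = fine \o [sequence (\int[nu]_(x in D)
    (EFin \o (fun x0 : T => series (b^~ x0) n)) x)%E]_n); last first.
  apply/funext => n /=; rewrite /series/= /Rintegral.
  under [in RHS]eq_integral do rewrite -sumEFin.
  rewrite integral_sum//; last by move=> i; exact: integrable_series_term.
  rewrite -[LHS]/(fine _%:E) -sumEFin; congr fine; apply: eq_bigr => i _.
  rewrite fineK//; exact: (integrable_fin_num mD (integrable_series_term i)).
apply: fine_cvg; rewrite /Rintegral fineK//; exact: integrable_fin_num.
Qed.

End Swap.

Lemma Rintegral_counting (u : nat -> R) : abs_summable u ->
  series u @ \oo --> \int[@counting _ R]_n u n.
Proof.
move=> su.
have -> : \int[@counting _ R]_n u n = limn (series u); last exact: abs_summable_cvg.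
rewrite /Rintegral integral_count; last first.
  by rewrite /summable -nneseries_esumT.
rewrite (_ : (\sum_(k <oo) (u k)%:E)%E = (limn (series u))%:E)//.
rewrite -EFin_lim; last exact: abs_summable_cvg.
by congr (limn _); apply/funext => n /=; rewrite sumEFin.
Qed.

(** [integral_series_swap] for the counting measure. *)
Lemma double_series_swap (A : nat -> nat -> R) (p q : nat -> R) (P : R) :
  (\sum_(n <oo) \sum_(j <oo) (`|A n j|)%:E < +oo)%E ->
  (forall n, series (A n) @ \oo --> p n) ->
  (forall j, series (A ^~ j) @ \oo --> q j) ->
  series p @ \oo --> P -> series q @ \oo --> P.
Proof.
move=> sA cp cq cP.
have sA' := sA; rewrite nneseries_interchange// in sA'.
have sj j : abs_summable (A ^~ j).
  rewrite /abs_summable; apply: le_lt_trans sA'.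
  apply: (nneseries_term_le (u := fun j => \sum_(n <oo) (`|A n j|)%:E)%E) => k.
  by apply: nneseries_ge0 => i _ _; rewrite lee_fin.
have [|||iP] := @integral_series_swap _ _ (@counting nat R) setT measurableT
   (fun j n => A n j) p => //.
- by under eq_eseriesr do rewrite ge0_integral_count//.
have -> : \int[@counting _ R]_n p n = P.
  apply: cvg_unique cP => //; apply: Rintegral_counting.
  move/integrableP : iP => [_]; rewrite ge0_integral_count//.
by under eq_fun do rewrite -(cvg_lim _ (Rintegral_counting (sj _)))// (cvg_lim _ (cq _))//.
Qed.

(** [phi] is real-analytic at [s]: absolute convergence is required at the
    radius [r] itself, which makes products and double series immediate. *)
Definition germ (phi : R -> R) (s : R) : Prop :=
  exists (a : nat -> R) (r : R), [/\ 0 < r, abs_summable (fun n => a n * r ^+ n) &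
    forall x, `|x| <= r -> series (fun n => a n * x ^+ n) @ \oo --> phi (s + x)].

Lemma abs_summable_power (a : nat -> R) (x r : R) : `|x| <= r ->
  abs_summable (fun n => a n * r ^+ n) -> abs_summable (fun n => a n * x ^+ n).
Proof.
move=> xr; apply: abs_summable_le => n; rewrite !normrM ler_wpM2l// !normrX.
by rewrite lerXn2r ?nnegrE// (le_trans xr)// ler_norm.
Qed.

Lemma germ_eq (phi psi : R -> R) (s e : R) : 0 < e ->
  (forall x, `|x| <= e -> phi (s + x) = psi (s + x)) -> germ phi s -> germ psi s.
Proof.
move=> e0 pp [a [r [r0 sa ca]]]; exists a, (Num.min r e); split.
- by rewrite lt_min r0.
- apply: abs_summable_power sa; rewrite ger0_norm; first by rewrite ge_min lexx.
  by rewrite le_min !ltW.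
- by move=> x; rewrite le_min => /andP[xr xe]; rewrite -pp//; exact: ca.
Qed.

Lemma germ_add (phi psi : R -> R) (s : R) : germ phi s -> germ psi s ->
  germ (fun t => phi t + psi t) s.
Proof.
move=> [a [r [r0 sa ca]]] [b [q [q0 sb cb]]].
have m0 : 0 < Num.min r q by rewrite lt_min r0.
exists (fun n => a n + b n), (Num.min r q); split => //.
- under eq_fun do rewrite mulrDl; apply: abs_summable_add.
    by apply: abs_summable_power sa; rewrite ger0_norm ?(ltW m0)// ge_min lexx.
  by apply: abs_summable_power sb; rewrite ger0_norm ?(ltW m0)// ge_min lexx orbT.
- move=> x; rewrite le_min => /andP[xr xq].
  rewrite (_ : series _ = series (fun n => a n * x ^+ n) \+ series (fun n => b n * x ^+ n)).
    by apply: cvgD; [exact: ca|exact: cb].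
  apply/funext => n; rewrite /series/= -big_split/=; apply: eq_bigr => i _.
  by rewrite mulrDl.
Qed.

Lemma germ_scale (phi : R -> R) (s c : R) : germ phi s -> germ (fun t => c * phi t) s.
Proof.
move=> [a [r [r0 sa ca]]]; exists (fun n => c * a n), r; split => //.
- by under eq_fun do rewrite -mulrA; exact: abs_summable_scale.
- move=> x xr; rewrite (_ : series _ = c \*o series (fun n => a n * x ^+ n)).
    by apply: cvgMr; exact: ca.
  apply/funext => n; rewrite /series/= mulr_sumr; apply: eq_bigr => i _.
  by rewrite mulrA.
Qed.

(** A series of power series is a power series when the double series of
    absolute values converges at the radius [r]. *)
Lemma germ_series (A : nat -> nat -> R) (p : nat -> R -> R) (phi : R -> R) (s r : R) :
  0 < r -> (\sum_(n <oo) \sum_(j <oo) (`|A n j * r ^+ j|)%:E < +oo)%E ->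
  (forall n x, `|x| <= r -> series (fun j => A n j * x ^+ j) @ \oo --> p n x) ->
  (forall x, `|x| <= r -> series (fun n => p n x) @ \oo --> phi (s + x)) ->
  germ phi s.
Proof.
move=> r0 sA cp cphi.
have sA' := sA; rewrite nneseries_interchange// in sA'.
have sj j : abs_summable (fun n => A n j * r ^+ j).
  rewrite /abs_summable; apply: le_lt_trans sA'.
  apply: (nneseries_term_le (u := fun j => \sum_(n <oo) (`|A n j * r ^+ j|)%:E)%E) => k.
  by apply: nneseries_ge0 => i _ _; rewrite lee_fin.
have {}sj j : abs_summable (A ^~ j).
  have := abs_summable_scale (r ^+ j)^-1 (sj j); apply: abs_summable_le => n.
  by rewrite mulrC mulfK// expf_neq0// gt_eqF.
pose a j := limn (series (A ^~ j)).
have ca j : series (A ^~ j) @ \oo --> a j by exact: abs_summable_cvg.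
exists a, r; split => //.
- apply: le_lt_trans sA'; apply: lee_nneseries => j _; first by rewrite lee_fin.
  have sjr : abs_summable (fun n => A n j * r ^+ j).
    by under eq_fun do rewrite mulrC; exact: abs_summable_scale.
  rewrite abs_summable_fin// lee_fin normrM.
  rewrite -normrM; apply: cvg_series_norm_le => //.
  under eq_fun do rewrite mulrC; rewrite mulrC.
  by apply: cvg_series_scale; exact: ca.
- move=> x xr.
  apply: (@double_series_swap (fun n j => A n j * x ^+ j) (fun n => p n x)).
  + apply: le_lt_trans sA; apply: lee_nneseries => [n _ _|n _].
      by apply: nneseries_ge0 => j _ _; rewrite lee_fin.
    apply: lee_nneseries => j _; first by rewrite lee_fin.
    rewrite lee_fin !normrM ler_wpM2l// !normrX lerXn2r ?nnegrE//.
    by rewrite (le_trans xr)// ler_norm.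
  + by move=> n; exact: cp.
  + move=> j; under eq_fun do rewrite mulrC; rewrite mulrC.
    by apply: cvg_series_scale; exact: ca.
  + exact: cphi.
Qed.

(** Used with [k = n] to write the Cauchy product of two power series as a double
    series over a triangle. *)
Lemma series_shift (c : nat -> R) (k n : nat) :
  series (fun j => if (k <= j)%N then c (j - k)%N else 0) n = series c (n - k)%N.
Proof.
elim: n => [|n IH]; first by rewrite sub0n /series/= !big_nil.
rewrite seriesSr IH; have [kn|nk] := leqP k n; last first.
  rewrite addr0; congr (series c _); have := nk; rewrite -subn_eq0 => /eqP ->.
  by apply/eqP; rewrite subn_eq0 ltnW.
by rewrite subSn// seriesSr.
Qed.

Lemma cvg_series_shift (c : nat -> R) (k : nat) (l : R) : series c @ \oo --> l ->
  series (fun j => if (k <= j)%N then c (j - k)%N else 0) @ \oo --> l.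
Proof.
move=> cl; rewrite (_ : series _ = fun n => series c (n - k)%N).
  by apply: (cvg_comp _ _ _ cl); exact: cvg_subnr.
by apply/funext => n; rewrite series_shift.
Qed.

(** The n-th inner series is a n x^n times the power series of [psi], that is
    the coefficients A n j vanish for j < n. *)
Lemma germ_mul (phi psi : R -> R) (s : R) : germ phi s -> germ psi s ->
  germ (fun t => phi t * psi t) s.
Proof.
move=> [a [q [q0 sa ca]]] [b [q' [q'0 sb cb]]].
pose r := Num.min q q'.
have r0 : 0 < r by rewrite lt_min q0.
have {}sa : abs_summable (fun n => a n * r ^+ n).
  by apply: abs_summable_power sa; rewrite ger0_norm ?(ltW r0)// ge_min lexx.
have {}sb : abs_summable (fun n => b n * r ^+ n).
  by apply: abs_summable_power sb; rewrite ger0_norm ?(ltW r0)// ge_min lexx orbT.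
pose A n j := if (n <= j)%N then a n * b (j - n)%N else 0.
have AE (x : R) n j : A n j * x ^+ j =
    if (n <= j)%N then a n * x ^+ n * (b (j - n)%N * x ^+ (j - n)%N) else 0.
  rewrite /A; case: leqP => nj; last by rewrite mul0r.
  have -> : x ^+ j = x ^+ n * x ^+ (j - n) by rewrite -exprD subnKC.
  by ring.
pose M := fine (\sum_(n <oo) (`|b n * r ^+ n|)%:E)%E.
apply: (@germ_series A (fun n x => a n * x ^+ n * psi (s + x)) _ s r) => //.
- apply: (@le_lt_trans _ _ (\sum_(n <oo) (`|M * (a n * r ^+ n)|)%:E)%E); last first.
    exact: (abs_summable_scale M sa).
  apply: lee_nneseries => [n _ _|n _].
    by apply: nneseries_ge0 => j _ _; rewrite lee_fin.
  apply: lime_le; first by apply: is_cvg_nneseries => j _ _; rewrite lee_fin.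
  apply: nearW => N; rewrite sumEFin lee_fin.
  rewrite (_ : \sum_(0 <= i < N) _ = series (fun j => if (n <= j)%N then
     `|a n * r ^+ n| * `|b (j - n)%N * r ^+ (j - n)%N| else 0) N); last first.
    rewrite /series/=; apply: eq_bigr => j _; rewrite AE; case: ifP => _.
      by rewrite normrM.
    by rewrite normr0.
  rewrite (series_shift (fun i => `|a n * r ^+ n| * `|b i * r ^+ i|)).
  rewrite (_ : series _ _ = `|a n * r ^+ n| * series (fun i => `|b i * r ^+ i|) (N - n)%N); last first.
    by rewrite /series/= mulr_sumr.
  rewrite (normrM M) [leLHS]mulrC; apply: ler_wpM2r => //.
  by apply: le_trans (ler_norm _); exact: abs_summable_series_le.
- move=> n x xr; under eq_fun do rewrite AE.
  apply: (cvg_series_shift (c := fun i => a n * x ^+ n * (b i * x ^+ i))).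
  apply: cvg_series_scale; apply: cb; rewrite (le_trans xr)// ge_min lexx orbT//.
- move=> x xr; under eq_fun do rewrite mulrC; rewrite mulrC.
  apply: cvg_series_scale; apply: ca; rewrite (le_trans xr)// ge_min lexx//.
Qed.

(** The coefficients vanish one after the other: if the first n are zero, then
    |a n| = O(x) as x tends to 0+. *)
Lemma germ_zero_right (phi : R -> R) (s e : R) : 0 < e -> germ phi s ->
  (forall x, 0 < x <= e -> phi (s + x) = 0) ->
  exists2 r : R, 0 < r & forall x, `|x| <= r -> phi (s + x) = 0.
Proof.
move=> e0 [a [r [r0 sa ca]]] pz.
pose M := fine (\sum_(n <oo) (`|a n * r ^+ n|)%:E)%E.
have az n : a n = 0.
  elim/ltn_ind: n => n IH.
  have key x : 0 < x -> x <= Num.min r e -> `|a n| <= x * (M / r ^+ n.+1).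
    move=> x0; rewrite le_min => /andP[xr xe].
    have xrn : `|x| <= r by rewrite ger0_norm ?(ltW x0).
    have := ca x xrn; rewrite pz ?x0// => c0.
    rewrite -(@ler_pM2r _ (x ^+ n)) ?exprn_gt0//.
    have -> : `|a n| * x ^+ n = `|0 - a n * x ^+ n|.
      by rewrite sub0r normrN normrM (@ger0_norm _ (x ^+ n))// exprn_ge0// ltW.
    have cn : (fun N => `|series (fun n => a n * x ^+ n) N - a n * x ^+ n|) @ \oo
        --> `|0 - a n * x ^+ n|.
      by apply: cvg_norm; apply: cvgB => //; exact: cvg_cst.
    rewrite -(cvg_lim _ cn)//; apply: limr_le; first by apply/cvg_ex; eexists; exact: cn.
    near=> N.
    have nN : (n.+1 <= N)%N by near: N; exact: nbhs_infty_ge.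
    rewrite /series /= (big_cat_nat (n := n.+1))//= big_nat_recr//= big1_seq ?add0r; last first.
      by move=> i; rewrite mem_index_iota => /andP[_ /andP[_ /IH ->]]; rewrite mul0r.
    rewrite addrAC subrr add0r; apply: (le_trans (ler_norm_sum _ _ _)).
    rewrite (_ : x * _ * _ = (x / r) ^+ n.+1 * M); last first.
      by rewrite exprMn exprVn (exprS x); ring.
    apply: (@le_trans _ _ ((x / r) ^+ n.+1 * \sum_(n.+1 <= i < N) `|a i * r ^+ i|)).
      rewrite mulr_sumr !big_seq; apply: ler_sum => i; rewrite mem_index_iota => /andP[ni _].
      rewrite !normrM mulrCA ler_wpM2l// !normrX !(ger0_norm (ltW _))//.
      rewrite -[X in _ <= _ * X]mulr1.
      have -> : x ^+ i = (x / r) ^+ i * r ^+ i.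
        by rewrite -exprMn divfK// gt_eqF.
      rewrite mulr1 ler_wpM2r ?exprn_ge0 ?(ltW r0)//.
      apply: ler_wiXn2l => //; first by rewrite divr_ge0// ltW.
      by rewrite ler_pdivrMr// mul1r.
    rewrite ler_wpM2l ?exprn_ge0 ?divr_ge0 ?(ltW x0) ?(ltW r0)//.
    apply: le_trans (abs_summable_series_le N sa).
    by rewrite /series/= [leRHS](big_cat_nat (n := n.+1))//= lerDr sumr_ge0.
  have m0 : 0 < Num.min r e by rewrite lt_min r0.
  apply/eqP; rewrite -normr_eq0 eq_le normr_ge0 andbT.
  apply/ler_addgt0Pr => d d0; rewrite add0r.
  pose K := `|M / r ^+ n.+1| + 1.
  have K0 : 0 < K by rewrite /K ltr_pwDr.
  pose x := Num.min (Num.min r e) (d / K).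
  have x0 : 0 < x by rewrite lt_min m0 divr_gt0.
  apply: (le_trans (key x x0 _)); first by rewrite ge_min lexx.
  apply: (@le_trans _ _ (x * K)).
    by rewrite ler_wpM2l ?(ltW x0)// (le_trans (ler_norm _))// /K lerDl.
  by rewrite -ler_pdivlMr// ge_min lexx orbT.
exists r => // x xr; apply: cvg_unique (ca x xr) _ => //.
rewrite (_ : series _ = fun=> 0); first exact: cvg_cst.
by apply/funext => n; rewrite /series/= big1// => i _; rewrite az mul0r.
Unshelve. all: by end_near. Qed.

(** Let t be the infimum of the points beyond which [phi] vanishes.  If t > s0,
    the germ of [phi] at t is zero on the right of t, hence on both sides, a
    contradiction. *)
Lemma germ_identity (phi : R -> R) (s0 S : R) :
  (forall s : R, s0 < s -> germ phi s) -> (forall s, S <= s -> phi s = 0) ->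
  forall s : R, s0 < s -> phi s = 0.
Proof.
move=> gphi phiS s1 s01; apply/eqP/negPn/negP => /eqP nz.
pose E := [set s : R | s0 < s /\ forall t, s <= t -> phi t = 0].
have lbE : lbound E s1.
  move=> s [s0s Es]; rewrite leNgt; apply/negP => ss1.
  by apply: nz; apply: Es; exact: ltW.
have E0 : E !=set0.
  exists (Num.max S (s0 + 1)); split; first by rewrite lt_max ltrDl ltr01 orbT.
  by move=> t; rewrite ge_max => /andP[St _]; exact: phiS.
have hE : has_inf E by split => //; exists s1.
have s1E : s1 <= inf E by apply: lb_le_inf.
have zE t : inf E < t -> phi t = 0.
  move=> Et; have Et0 : 0 < t - inf E by rewrite subr_gt0.
  have [s [_ Es] st] := inf_adherent Et0 hE.
  by apply: Es; apply: ltW; move: st; rewrite addrC subrK.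
have s0E : s0 < inf E by exact: lt_le_trans s1E.
have zE1 x : 0 < x <= 1 -> phi (inf E + x) = 0.
  by move=> /andP[x0 _]; apply: zE; rewrite ltrDl.
have [r r0 Hr] := germ_zero_right ltr01 (gphi _ s0E) zE1.
pose t := Num.max (inf E - r) ((s0 + inf E) / 2).
have Et : E t.
  split; first by rewrite lt_max; apply/orP; right; lra.
  move=> z tz; have [zE'|zE'] := ltP (inf E) z; first exact: zE.
  rewrite (_ : z = inf E + (z - inf E)); last by ring.
  apply: Hr; rewrite ler0_norm ?subr_le0// opprB lerBlDl.
  by move: tz; rewrite ge_max => /andP[]; lra.
have : inf E <= t by apply: ge_inf => //; case: hE.
by rewrite leNgt => /negP; apply; rewrite /t gt_max; apply/andP; split; lra.
Qed.

Notation mu := (@lebesgue_measure R).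
Notation pos := (`]0%R, +oo[%classic : set R).

Lemma cvg_expR_series (x : R) : series (exp_coeff x) @ \oo --> expR x.
Proof. exact: is_cvg_series_exp_coeff. Qed.

(** exp(- (s + x) t) is expanded in powers of x.  For |x| <= r = (s - s0) / 2,
    the sum of the absolute values of the terms is exp(r t) exp(- s t) |h t|,
    integrable because s - r > s0. *)
Lemma germ_laplace (h : R -> R) (s0 : R) :
  (forall s : R, s0 < s -> laplace_integrable h s) ->
  forall s : R, s0 < s -> germ (laplace h) s.
Proof.
move=> ih s s0s; pose r := (s - s0) / 2.
have r0 : 0 < r by rewrite /r; lra.
have mh := laplace_integrable_measurable (ih s s0s).
pose c j t : R := expR (- (s * t)) * h t * ((- t) ^+ j / j`!%:R).
have mc j (x : R) : measurable_fun pos (fun t => c j t * x ^+ j).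
  apply: measurable_funM => //; apply: measurable_funM.
    by apply: measurable_funM => //; exact: measurable_expRN.
  apply: measurable_funM => //; apply: measurable_funX.
  exact: oppr_measurable.
have cE j (x t : R) : c j t * x ^+ j = expR (- (s * t)) * h t * exp_coeff (- t * x) j.
  by rewrite /c /exp_coeff/= exprMn; ring.
have S : (\sum_(j <oo) \int[mu]_(t in pos) (`|c j t * r ^+ j|)%:E < +oo)%E.
  rewrite -integral_nneseries//; last first.
    by move=> j; apply/measurable_EFinP; apply: measurableT_comp => //; exact: mc.
  have isr : laplace_integrable h (s - r) by apply: ih; rewrite /r; lra.
  have /integrableP[_] := isr.
  apply: le_lt_trans; rewrite le_eqVlt; apply/orP; left; apply/eqP.
  apply: eq_integral => t /set_mem/posP t0.
  under eq_eseriesr do rewrite cE normrM EFinM.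
  rewrite nneseriesZl//.
  have -> : (\sum_(j <oo) (`|exp_coeff (- t * r) j|)%:E = (expR (t * r))%:E)%E.
    have aE j : `|exp_coeff (- t * r) j| = exp_coeff (t * r) j.
      rewrite /exp_coeff/= mulNr normrM normrX normrN normfV.
      by rewrite !ger0_norm// mulr_ge0// ltW.
    under eq_eseriesr do rewrite aE.
    rewrite /expR -EFin_lim; last first.
      exact: is_cvg_series_exp_coeff.
    by congr (limn _); apply/funext => n /=; rewrite sumEFin.
  rewrite /= -EFinM; congr EFin; rewrite !normrM !(ger0_norm (expR_ge0 _)).
  by rewrite mulrAC -expRD; congr (expR _ * _); ring.
have icr j : mu.-integrable pos (EFin \o (fun t => c j t * r ^+ j)).
  exact: (@integrable_series_term _ (measurableTypeR R) mu pos (fun j t => c j t * r ^+ j) (fun j => mc j r) S j).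
have ic j : mu.-integrable pos (EFin \o c j).
  have := integrable_scale (r ^+ j)^-1 (measurable_itv _) (icr j).
  apply: eq_integrable => // t _ /=; congr EFin.
  by rewrite mulrC mulfK// expf_neq0// gt_eqF.
exists (fun j => \int[mu]_(t in pos) c j t), r; split => //.
- apply: le_lt_trans S; apply: lee_nneseries => j _; first by rewrite lee_fin.
  rewrite -RintegralZr// EFin_normr_Rintegral//.
  apply: (le_abse_integral mu _ _) => //; apply/measurable_EFinP; exact: mc.
- move=> x xr.
  have S' : (\sum_(j <oo) \int[mu]_(t in pos) (`|c j t * x ^+ j|)%:E < +oo)%E.
    apply: le_lt_trans S; apply: lee_nneseries => [j _ _|j _].
      by apply: integral_ge0 => t _; rewrite lee_fin.
    apply: ge0_le_integral => //.
    + by apply/measurable_EFinP; apply: measurableT_comp => //; exact: mc.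
    + by apply/measurable_EFinP; apply: measurableT_comp => //; exact: mc.
    move=> t _; rewrite lee_fin !normrM ler_wpM2l// !normrX lerXn2r ?nnegrE//.
    by rewrite (le_trans xr)// ler_norm.
  have [|_] := @integral_series_swap _ (measurableTypeR R) mu pos (measurable_itv _) (fun j t => c j t * x ^+ j)
     (fun t => expR (- ((s + x) * t)) * h t) (fun j => mc j x) S'.
    move=> t _; under eq_fun do rewrite cE.
    have -> : expR (- ((s + x) * t)) * h t = expR (- (s * t)) * h t * expR (- t * x).
      by rewrite mulrAC -expRD; congr (expR _ * _); ring.
    by apply: cvg_series_scale; exact: cvg_expR_series.
  apply: cvg_trans; apply: near_eq_cvg; near=> n.
  by rewrite /series/=; apply: eq_bigr => j _; rewrite RintegralZr.
Unshelve. all: by end_near. Qed.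

End AbsSeries.

(** * Complex exponentials, powers, series and the binomial series *)

Section ComplexBasics.
Variable R : realType.
Implicit Types z w a : R[i].

Lemma cReD z w : Re (z + w) = Re z + Re w. Proof. by case: z w => [? ?] []. Qed.
Lemma cImD z w : Im (z + w) = Im z + Im w. Proof. by case: z w => [? ?] []. Qed.
Lemma cReN z : Re (- z) = - Re z. Proof. by case: z. Qed.
Lemma cImN z : Im (- z) = - Im z. Proof. by case: z. Qed.
Lemma cReM z w : Re (z * w) = Re z * Re w - Im z * Im w.
Proof. by case: z w => [? ?] []. Qed.
Lemma cImM z w : Im (z * w) = Re z * Im w + Im z * Re w.
Proof. by case: z w => [? ?] []. Qed.
Lemma cReRM (x : R) z : Re (x%:C * z) = x * Re z.
Proof. by rewrite cReM /= mul0r subr0. Qed.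
Lemma cImRM (x : R) z : Im (x%:C * z) = x * Im z.
Proof. by rewrite cImM /= mul0r addr0. Qed.
Lemma Re_sum n (F : nat -> R[i]) : Re (\sum_(0 <= i < n) F i) = \sum_(0 <= i < n) Re (F i).
Proof. by elim: n => [|n IH]; rewrite ?big_nil// !big_nat_recr//= cReD IH. Qed.
Lemma Im_sum n (F : nat -> R[i]) : Im (\sum_(0 <= i < n) F i) = \sum_(0 <= i < n) Im (F i).
Proof. by elim: n => [|n IH]; rewrite ?big_nil// !big_nat_recr//= cImD IH. Qed.
Lemma complex_ext z w : Re z = Re w -> Im z = Im w -> z = w.
Proof. by case: z w => [? ?] [? ?] /= -> ->. Qed.

Lemma normcE z : normc z = Num.sqrt (Re z ^+ 2 + Im z ^+ 2).
Proof. by case: z. Qed.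
Lemma normc_ge0 z : 0 <= normc z.
Proof. by rewrite normcE sqrtr_ge0. Qed.
Lemma normcM z w : normc (z * w) = normc z * normc w.
Proof. exact: Normc.normcM. Qed.
Lemma normcR (x : R) : normc x%:C = `|x|.
Proof. by rewrite normcE /= expr0n addr0 sqrtr_sqr. Qed.
Lemma normc_eq0 z : (normc z == 0) = (z == 0).
Proof.
apply/eqP/eqP => [/Normc.eq0_normc//|->]; exact: Normc.normc0.
Qed.
Lemma normcX z n : normc (z ^+ n) = normc z ^+ n.
Proof.
elim: n => [|n IH]; first by rewrite !expr0 Normc.normc1.
by rewrite !exprS normcM IH.
Qed.
Lemma normcV z : normc z^-1 = (normc z)^-1.
Proof. exact: Normc.normcV. Qed.
Lemma normc_nat (n : nat) : normc (n%:R : R[i]) = n%:R.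
Proof.
have -> : n%:R = (n%:R : R)%:C :> R[i] by rewrite rmorph_nat.
by rewrite normcR ger0_norm.
Qed.
Lemma le_normcD z w : normc (z + w) <= normc z + normc w.
Proof. exact: (@ler_normD R (Rcomplex R)). Qed.
Lemma normr_complex z : `|z| = (normc z)%:C.
Proof. by rewrite normcE normc_def. Qed.
Lemma Re_le_normc z : `|Re z| <= normc z.
Proof.
rewrite normcE -sqrtr_sqr ler_wsqrtr// lerDl sqr_ge0//.
Qed.
Lemma Im_le_normc z : `|Im z| <= normc z.
Proof.
rewrite normcE -sqrtr_sqr ler_wsqrtr// lerDr sqr_ge0//.
Qed.
Lemma normc_le z : normc z <= `|Re z| + `|Im z|.
Proof.
rewrite normcE -(@ger0_norm _ (`|Re z| + `|Im z|)) ?addr_ge0// -sqrtr_sqr.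
rewrite ler_wsqrtr// sqrrD !real_normK ?num_real// -addrA lerD2l lerDr.
by rewrite mulrn_wge0// mulr_ge0.
Qed.

Lemma cexp0 : cexp (0 : R[i]) = 1.
Proof. by rewrite /cexp /= expR0 cos0 sin0 !mul1r. Qed.
Lemma cexpD z w : cexp (z + w) = cexp z * cexp w.
Proof.
by apply: complex_ext; rewrite ?cReM ?cImM /cexp /= cReD cImD expRD ?cosD ?sinD; ring.
Qed.
Lemma normc_cexp z : normc (cexp z) = expR (Re z).
Proof.
rewrite normcE /cexp /= !exprMn -mulrDr cos2Dsin2 mulr1 sqrtr_sqr.
by rewrite ger0_norm// expR_ge0.
Qed.
Lemma cexp_neq0 z : cexp z != 0.
Proof. by rewrite -normc_eq0 normc_cexp gt_eqF// expR_gt0. Qed.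
Lemma cexpN z : cexp (- z) = (cexp z)^-1.
Proof.
apply: (mulfI (cexp_neq0 z)); rewrite -cexpD subrr cexp0 mulfV//; exact: cexp_neq0.
Qed.
Lemma cexpR (x : R) : cexp x%:C = (expR x)%:C.
Proof. by apply: complex_ext; rewrite /cexp /= ?cos0 ?sin0 ?mulr1 ?mulr0. Qed.
Lemma cexpMn z n : cexp (z * n%:R) = cexp z ^+ n.
Proof.
elim: n => [|n IH]; first by rewrite mulr0 cexp0 expr0.
by rewrite -natr1 mulrDr mulr1 cexpD IH exprSr.
Qed.

Lemma clogR (t : R) : 0 < t -> clog t%:C = (ln t)%:C.
Proof.
move=> t0; rewrite /clog normcR gtr0_norm//; congr (_ +i* _).
rewrite /carg normcR gtr0_norm//.
have -> : Re t%:C / t = 1 by rewrite /= divff// gt_eqF.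
by rewrite acos1 oppr0 if_same.
Qed.

Lemma cpowE (t : R) a : 0 < t -> cpow t%:C a = cexp (a * (ln t)%:C).
Proof.
move=> t0; rewrite /cpow clogR//; case: eqP => // /(f_equal Re) /= t0'.
by move: t0; rewrite t0' ltxx.
Qed.

Lemma normc_cpow (t : R) a : 0 < t -> normc (cpow t%:C a) = expR (Re a * ln t).
Proof. by move=> t0; rewrite cpowE// normc_cexp cReM /= mulr0 subr0. Qed.

Lemma cpow_neq0 (t : R) a : 0 < t -> cpow t%:C a != 0.
Proof. by move=> t0; rewrite cpowE// cexp_neq0. Qed.

Lemma cpowD (t : R) a z : 0 < t -> cpow t%:C (a + z) = cpow t%:C a * cpow t%:C z.
Proof. by move=> t0; rewrite !cpowE// mulrDl cexpD. Qed.

Lemma cpowN (t : R) a : 0 < t -> cpow t%:C (- a) = (cpow t%:C a)^-1.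
Proof. by move=> t0; rewrite !cpowE// mulNr cexpN. Qed.

Lemma cpowM (s t : R) a : 0 < s -> 0 < t ->
  cpow (s * t)%:C a = cpow s%:C a * cpow t%:C a.
Proof.
by move=> s0 t0; rewrite !cpowE ?mulr_gt0// lnM ?posrE// rmorphD/= mulrDr cexpD.
Qed.

Lemma cpowV (t : R) a : 0 < t -> cpow (t^-1)%:C a = (cpow t%:C a)^-1.
Proof.
by move=> t0; rewrite !cpowE ?invr_gt0// lnV ?posrE// rmorphN/= mulrN cexpN.
Qed.

Lemma cpow_nat (t : R) a n : 0 < t -> cpow t%:C (a * n%:R) = cpow t%:C a ^+ n.
Proof. by move=> t0; rewrite !cpowE// mulrAC cexpMn. Qed.

Lemma cpow1 (t : R) : 0 < t -> cpow t%:C 1 = t%:C.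
Proof. by move=> t0; rewrite cpowE// mul1r cexpR lnK. Qed.

Lemma cpow_natr (t : R) n : 0 < t -> cpow t%:C n%:R = (t ^+ n)%:C.
Proof. by move=> t0; rewrite -[n%:R]mul1r cpow_nat// cpow1// rmorphXn. Qed.

(** Componentwise differentiation, so that the differentiation rules reduce to
    the real ones. *)
Definition is_cderive (f : R -> R[i]) (x : R) (d : R[i]) : Prop :=
  is_derive x 1 (fun t => Re (f t)) (Re d) /\ is_derive x 1 (fun t => Im (f t)) (Im d).

Lemma is_cderive_val f x d d' : is_cderive f x d -> d = d' -> is_cderive f x d'.
Proof. by move=> + <-. Qed.

Lemma is_cderive_cst a x : is_cderive (fun=> a) x 0.
Proof. by split; exact: is_derive_cst. Qed.

Lemma is_cderive_real (p : R -> R) (x d : R) : is_derive x 1 p d ->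
  is_cderive (fun t => (p t)%:C) x d%:C.
Proof. by move=> pd; split => //=; exact: is_derive_cst. Qed.

Lemma is_cderive_add f g x d e : is_cderive f x d -> is_cderive g x e ->
  is_cderive (fun t => f t + g t) x (d + e).
Proof.
move=> [f1 f2] [g1 g2]; split.
  under eq_fun do rewrite cReD; rewrite cReD; exact: is_deriveD.
under eq_fun do rewrite cImD; rewrite cImD; exact: is_deriveD.
Qed.

Lemma is_derive_sub (p q : R -> R) (x d e : R) : is_derive x 1 p d ->
  is_derive x 1 q e -> is_derive x 1 (fun t => p t - q t) (d - e).
Proof. by move=> hp hq; exact: is_deriveB. Qed.

Lemma is_derive_add (p q : R -> R) (x d e : R) : is_derive x 1 p d ->
  is_derive x 1 q e -> is_derive x 1 (fun t => p t + q t) (d + e).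
Proof. by move=> hp hq; exact: is_deriveD. Qed.

Lemma is_cderive_mul f g x d e : is_cderive f x d -> is_cderive g x e ->
  is_cderive (fun t => f t * g t) x (d * g x + f x * e).
Proof.
move=> [f1 f2] [g1 g2]; split.
  under eq_fun do rewrite cReM.
  apply: (is_derive_val (is_derive_sub (is_derive_mul f1 g1) (is_derive_mul f2 g2))).
  by rewrite cReD !cReM; ring.
under eq_fun do rewrite cImM.
apply: (is_derive_val (is_derive_add (is_derive_mul f1 g2) (is_derive_mul f2 g1))).
by rewrite cImD !cImM; ring.
Qed.

Lemma is_cderive_scale a f x d : is_cderive f x d ->
  is_cderive (fun t => a * f t) x (a * d).
Proof.
move=> fd; apply: (is_cderive_val (is_cderive_mul (is_cderive_cst a x) fd)).
by rewrite mul0r add0r.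
Qed.

Lemma is_cderive_cexp f x d : is_cderive f x d ->
  is_cderive (fun t => cexp (f t)) x (d * cexp (f x)).
Proof.
move=> [f1 f2]; have E := is_derive_expR_comp f1.
have C := is_derive_chain (is_derive_cos (Im (f x))) f2.
have S := is_derive_chain (is_derive_sin (Im (f x))) f2.
split.
  apply: (is_derive_val (is_derive_mul E C)).
  by rewrite cReM /cexp /=; ring.
apply: (is_derive_val (is_derive_mul E S)).
by rewrite cImM /cexp /=; ring.
Qed.

(** On the right half-plane the principal argument is smooth; this formula
    makes it visible. *)
Lemma carg_atan z : 0 < Re z -> carg z = atan (Im z / Re z).
Proof.
case: z => a b /= a0; rewrite /carg /=.
have cE : a / Num.sqrt (a ^+ 2 + b ^+ 2) = cos (atan (b / a)).
  rewrite cos_atan.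
  have -> : a ^+ 2 + b ^+ 2 = a ^+ 2 * (1 + (b / a) ^+ 2).
    by rewrite mulrDr mulr1 -exprMn mulrCA divff ?mulr1// gt_eqF.
  rewrite sqrtrM ?sqr_ge0// sqrtr_sqr gtr0_norm// invfM mulrA divff ?mul1r//.
  by rewrite gt_eqF.
rewrite cE; have := atan_gtNpi2 (b / a); have := atan_ltpi2 (b / a).
have := pi_gt0 R => p0 h1 h2; case: (leP 0 b) => b0.
  rewrite cosK// in_itv/=; apply/andP; split; last by lra.
  by rewrite -atan0 le_atan// divr_ge0// ltW.
rewrite cosKN ?opprK//; apply/andP; split; first by lra.
by rewrite -atan0 le_atan// mulr_le0_ge0 ?invr_ge0// ltW.
Qed.

Lemma is_cderive_clog f x d : 0 < Re (f x) -> is_cderive f x d ->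
  is_cderive (fun t => clog (f t)) x (d / f x).
Proof.
move=> f0 [f1 f2].
pose q t := Re (f t) ^+ 2 + Im (f t) ^+ 2.
have q0 : 0 < q x by rewrite /q ltr_pwDl ?exprn_gt0// sqr_ge0.
have s0 : 0 < Num.sqrt (q x) by rewrite sqrtr_gt0.
have dq : is_derive x 1 q (2 * (Re d * Re (f x) + Im d * Im (f x))).
  have := is_derive_add (is_derive_mul f1 f1) (is_derive_mul f2 f2).
  rewrite /q; under [in X in _ -> X]eq_fun do rewrite !expr2.
  by move/is_derive_val; apply; ring.
have invE : (f x)^-1 = (Re (f x) / q x) -i* (Im (f x) / q x).
  by rewrite /q; case: (f x) => a b.
split.
  have ds := is_derive_chain (is_derive1_sqrt q0) dq.
  have dl := @is_derive_chain R (@ln R) (fun t => Num.sqrt (q t)) x _ _ (is_derive1_ln s0) ds.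
  under eq_fun do rewrite /clog /= normcE.
  apply: (is_derive_val dl); rewrite invE cReM /=.
  have sq : Num.sqrt (q x) ^+ 2 = q x by rewrite sqr_sqrtr// ltW.
  set v := Num.sqrt (q x) in sq s0 *; rewrite -sq.
  by field; rewrite gt_eqF.
have dv : is_derive x 1 (fun t => Im (f t) / Re (f t))
   ((Im d * Re (f x) - Im (f x) * Re d) / Re (f x) ^+ 2).
  have Rn : Re (f x) != 0 by rewrite gt_eqF.
  have := is_derive_mul f2 (is_deriveV Rn f1).
  move/is_derive_val; apply; rewrite /GRing.scale/=.
  by field.
have da := @is_derive_chain R atan (fun t => Im (f t) / Re (f t)) x _ _ (is_derive1_atan _) dv.
apply: (is_derive_val (near_eq_is_derive _ da)).
  have := is_derive_continuous f1 => /cvgr_gt /(_ 0 f0); apply: filterS => t ft.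
  by rewrite /clog /= carg_atan.
rewrite invE cImM /= /q; field.
rewrite (gt_eqF f0) /= gt_eqF//=; exact: q0.
Qed.

Lemma is_cderive_continuous f x d : is_cderive f x d ->
  {for x, continuous (fun t => Re (f t))} /\ {for x, continuous (fun t => Im (f t))}.
Proof. by move=> [f1 f2]; split; [exact: is_derive_continuous f1|exact: is_derive_continuous f2]. Qed.

(** Componentwise convergence; see [limn_cseries] for the limit in
    [Rcomplex R]. *)
Definition cseries_cvg (u : nat -> R[i]) (l : R[i]) : Prop :=
  series (fun n => Re (u n)) @ \oo --> Re l /\ series (fun n => Im (u n)) @ \oo --> Im l.

Definition csummable (u : nat -> R[i]) : Prop := abs_summable (fun n => normc (u n)).

Lemma csummable_Re u : csummable u -> abs_summable (fun n => Re (u n)).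
Proof.
apply: abs_summable_le => n; rewrite (ger0_norm (normc_ge0 _)); exact: Re_le_normc.
Qed.

Lemma csummable_Im u : csummable u -> abs_summable (fun n => Im (u n)).
Proof.
apply: abs_summable_le => n; rewrite (ger0_norm (normc_ge0 _)); exact: Im_le_normc.
Qed.

Lemma csummable_cvg u : csummable u -> exists l, cseries_cvg u l.
Proof.
move=> su; exists (limn (series (fun n => Re (u n))) +i* limn (series (fun n => Im (u n)))).
by split; apply: abs_summable_cvg; [exact: csummable_Re|exact: csummable_Im].
Qed.

Lemma cseries_cvg_unique u l l' : cseries_cvg u l -> cseries_cvg u l' -> l = l'.
Proof.
by move=> [u1 u2] [v1 v2]; apply: complex_ext; [exact: (cvg_unique _ u1 v1)|exact: (cvg_unique _ u2 v2)].
Qed.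

Lemma cseries_cvg_scale u l a : cseries_cvg u l -> cseries_cvg (fun n => a * u n) (a * l).
Proof.
move=> [u1 u2]; split.
  under eq_fun do rewrite cReM; rewrite cReM.
  have := cvg_series_add (cvg_series_scale (c := Re a) u1) (cvg_series_scale (c := - Im a) u2).
  by under eq_fun do rewrite mulNr; rewrite mulNr.
under eq_fun do rewrite cImM; rewrite cImM.
exact: cvg_series_add (cvg_series_scale (c := Re a) u2) (cvg_series_scale (c := Im a) u1).
Qed.

(** The Pochhammer symbol a (a + 1) ... (a + n - 1). *)
Definition rising (F : fieldType) (a : F) (n : nat) : F := \prod_(i < n) (a + i%:R).

Lemma risingS (F : fieldType) (a : F) n : rising a n.+1 = rising a n * (a + n%:R).
Proof. by rewrite /rising big_ord_recr. Qed.

(** The ratio test for the quotients met in binomial series: (B + n) / (n + 1)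
    tends to 1, so the ratio is eventually at most (1 + q) / 2. *)
Lemma ratio_quotient (u : nat -> R) (B q : R) : q < 1 -> (forall n, 0 <= u n) ->
  (forall n, u n.+1 = (B + n%:R) / n.+1%:R * q * u n) -> 0 <= q -> abs_summable u.
Proof.
move=> q1 u0 uE q0; pose p := (1 + q) / 2.
have qp : 0 < p - q by rewrite /p; lra.
have p1 : p < 1 by rewrite /p; lra.
apply: (@ratio_test R u p (Num.truncn (`|B| / (p - q))).+1 p1 u0) => n Nn.
rewrite uE ler_wpM2r// mulrAC ler_pdivrMr//.
have Bn : `|B| / (p - q) <= n%:R.
  by apply: le_trans (ltW (truncnS_gt _)) _; rewrite ler_nat.
rewrite ler_pdivrMr// in Bn.
have := ler_wpM2l q0 (ler_norm B); have : `|B| * q <= `|B| by rewrite ler_piMr// ltW.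
rewrite -natr1 mulrDl mulrDr mulr1.
have p0 : 0 <= p by rewrite /p; lra.
move: (ler0n R n) => n0; nra.
Qed.

Lemma rising_ge0 (A : R) n : 0 <= A -> 0 <= rising A n.
Proof. by move=> A0; apply: prodr_ge0 => i _; rewrite addr_ge0. Qed.

Lemma normc_rising_le a n : normc (rising a n) <= rising (normc a) n.
Proof.
elim: n => [|n IH]; first by rewrite /rising !big_ord0 Normc.normc1.
rewrite !risingS normcM ler_pM ?normc_ge0//.
by rewrite (le_trans (le_normcD _ _))// normc_nat.
Qed.

(** The coefficient of z^n in (1 - z)^(- a). *)
Definition binomial_coef (F : fieldType) (a : F) (n : nat) : F := rising a n / n`!%:R.

Lemma binomial_coefS (F : numFieldType) (a : F) n :
  binomial_coef a n.+1 = binomial_coef a n * (a + n%:R) / n.+1%:R.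
Proof.
rewrite /binomial_coef risingS factS natrM invfM; ring.
Qed.

Lemma binomial_coef_ge0 (A : R) n : 0 <= A -> 0 <= binomial_coef A n.
Proof. by move=> A0; rewrite divr_ge0// rising_ge0. Qed.

Lemma normc_binomial_coef_le a n : normc (binomial_coef a n) <= binomial_coef (normc a) n.
Proof.
by rewrite /binomial_coef normcM normcV normc_nat ler_wpM2r ?invr_ge0// normc_rising_le.
Qed.

Lemma abs_summable_binomial (A q : R) : 0 <= A -> 0 <= q < 1 ->
  abs_summable (fun n => binomial_coef A n * q ^+ n).
Proof.
move=> A0 /andP[q0 q1]; apply: (@ratio_quotient _ A q) => //.
  by move=> n; rewrite mulr_ge0 ?exprn_ge0// binomial_coef_ge0.
by move=> n; rewrite binomial_coefS exprS; ring.
Qed.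

Lemma cseries_cvg_add u v l k : cseries_cvg u l -> cseries_cvg v k ->
  cseries_cvg (fun n => u n + v n) (l + k).
Proof.
move=> [u1 u2] [v1 v2]; split.
  under eq_fun do rewrite cReD; rewrite cReD; exact: cvg_series_add.
under eq_fun do rewrite cImD; rewrite cImD; exact: cvg_series_add.
Qed.

Lemma cseries_cvg_eq u v l : u =1 v -> cseries_cvg u l -> cseries_cvg v l.
Proof. by move=> /funext ->. Qed.

(** Multiplication by the variable shifts the coefficients of a power series. *)
Lemma cseries_cvg_lift u l : cseries_cvg u l ->
  cseries_cvg (fun n => if (1 <= n)%N then u (n - 1)%N else 0) l.
Proof.
move=> [u1 u2]; split.
  have := cvg_series_shift 1 u1.
rewrite (_ : (fun j => if _ then Re _ else 0) = fun n => Re (if (1 <= n)%N then u (n - 1)%N else 0))//.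
  by apply/funext => n; case: ifP.
have := cvg_series_shift 1 u2.
rewrite (_ : (fun j => if _ then Im _ else 0) = fun n => Im (if (1 <= n)%N then u (n - 1)%N else 0))//.
  by apply/funext => n; case: ifP.
Qed.

Lemma cseries_cvg0 u : (forall n, (0 < n)%N -> u n = 0) -> cseries_cvg u (u 0%N).
Proof.
move=> u0; split; apply: cvg_near_cst; exists 1%N => // n /= n1.
  rewrite /series/= big_ltn// big_nat big1 ?addr0// => i /andP[i1 _].
  by rewrite u0.
rewrite /series/= big_ltn// big_nat big1 ?addr0// => i /andP[i1 _].
by rewrite u0.
Qed.

Lemma constant_of_is_derive0 (p : R -> R) :
  (forall t : R, 0 <= t <= 1 -> is_derive t 1 p 0) -> p 1 = p 0.
Proof.
move=> dp; apply/eqP; rewrite -subr_eq0; apply/eqP.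
rewrite -(@ftc_integrable R p (cst 0) 0 1 ltr01 dp).
  by rewrite Rintegral_cst//= mul0r.
by apply: eq_integrable (integrable0 _ _) => //.
Qed.

Lemma ler_normM_norm (x y w : R) : 0 <= x -> x <= y -> `|x * `|w| | <= `|y * w|.
Proof.
move=> x0 xy; rewrite !normrM normr_id ler_wpM2r// !ger0_norm//.
exact: le_trans xy.
Qed.

Section BinomialSeries.
Variables (a z : R[i]).
Hypothesis z1 : normc z < 1.
(** A radius larger than 1 for which |z| K < 1: the series is studied along the
    segment t z with t in [0, 1], inside an open interval. *)
Let K : R := 2 / (1 + normc z).
Let c n : R[i] := binomial_coef a n * z ^+ n.

Let z0 : 0 <= normc z := normc_ge0 z.
Let K1 : 1 < K.
Proof. by rewrite /K; move: z0 z1; set r := normc z => r0 r1; rewrite ltr_pdivlMr; lra. Qed.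
Let K0 : 0 < K. Proof. exact: lt_trans K1. Qed.
Let zK0 : 0 <= normc z * K. Proof. by rewrite mulr_ge0// ltW. Qed.
Let zK1 : normc z * K < 1.
Proof. by rewrite /K; move: z0 z1; set r := normc z => r0 r1; rewrite mulrA ltr_pdivrMr; lra. Qed.

(** A majorant of the coefficients; [uS] puts its ratio in the form required by
    [ratio_quotient]. *)
Let u n : R := binomial_coef (normc a) n * normc z ^+ n.
Let u0 n : 0 <= u n.
Proof. by rewrite mulr_ge0 ?exprn_ge0// binomial_coef_ge0// normc_ge0. Qed.
Let uS n : u n.+1 = (normc a + n%:R) / n.+1%:R * normc z * u n.
Proof. by rewrite /u binomial_coefS exprS; ring. Qed.
Let cu n : normc (c n) <= u n.
Proof.
by rewrite /c normcM normcX ler_wpM2r ?exprn_ge0//; exact: normc_binomial_coef_le.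
Qed.

(** Termwise differentiation needs the convergence, at K, of the series and of
    its first two formal derivatives. *)
Let summ0 : csummable (fun n => c n * (K ^+ n)%:C).
Proof.
have : abs_summable (fun n => u n * K ^+ n).
  apply: (@ratio_quotient _ (normc a) (normc z * K)) => // n.
    by rewrite mulr_ge0 ?exprn_ge0// ltW.
  by rewrite uS exprS; ring.
apply: abs_summable_le => n; rewrite normcM normcR.
by apply: ler_normM_norm; [exact: normc_ge0|exact: cu].
Qed.

Let summ1 : csummable (fun n => n.+1%:R * c n.+1 * (K ^+ n)%:C).
Proof.
have : abs_summable (fun n => n.+1%:R * u n.+1 * K ^+ n).
  apply: (@ratio_quotient _ (normc a + 1) (normc z * K)) => // n.
    exact: (mulr_ge0 (mulr_ge0 (ler0n _ _) (u0 _)) (exprn_ge0 _ (ltW K0))).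
  have N1 : n%:R + 1 != 0 :> R by rewrite natr1 pnatr_eq0.
  have N2 : n%:R + 2 != 0 :> R by rewrite -natrD pnatr_eq0 addn2.
  rewrite (uS n.+1) exprS; set v := u n.+1; set r := normc z; set A := normc a.
  have -> : n.+2%:R = n%:R + 2 :> R by rewrite -natrD addn2.
  have -> : n.+1%:R = n%:R + 1 :> R by rewrite natr1.
  by field; rewrite N1 N2.
apply: abs_summable_le => n; rewrite normcM normcR normcM normc_nat.
by apply: ler_normM_norm; rewrite ?mulr_ge0 ?normc_ge0// ler_wpM2l.
Qed.

Let summ2 : csummable (fun n => n.+1%:R * (n.+2%:R * c n.+2) * (K ^+ n)%:C).
Proof.
have : abs_summable (fun n => n.+1%:R * (n.+2%:R * u n.+2) * K ^+ n).
  apply: (@ratio_quotient _ (normc a + 2) (normc z * K)) => // n.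
    exact: (mulr_ge0 (mulr_ge0 (ler0n _ _) (mulr_ge0 (ler0n _ _) (u0 _))) (exprn_ge0 _ (ltW K0))).
  have N1 : n%:R + 1 != 0 :> R by rewrite natr1 pnatr_eq0.
  have N3 : n%:R + 3 != 0 :> R by rewrite -natrD pnatr_eq0 addn3.
  rewrite (uS n.+2) exprS; set v := u n.+2; set r := normc z; set A := normc a.
  have -> : n.+3%:R = n%:R + 3 :> R by rewrite -natrD addn3.
  have -> : n.+2%:R = n%:R + 2 :> R by rewrite -natrD addn2.
  have -> : n.+1%:R = n%:R + 1 :> R by rewrite natr1.
  by field; rewrite N1 N3.
apply: abs_summable_le => n; rewrite normcM normcR (normcM n.+1%:R) (normcM n.+2%:R) !normc_nat.
by apply: ler_normM_norm; rewrite ?mulr_ge0 ?mulr_ge0 ?normc_ge0// ler_wpM2l// ler_wpM2l.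
Qed.

(** The sum of the binomial series at t z, and its formal derivative. *)
Let phi (t : R) : R[i] :=
  limn (pseries (fun n => Re (c n)) t) +i* limn (pseries (fun n => Im (c n)) t).
Let dphi (t : R) : R[i] :=
  limn (pseries (pseries_diffs (fun n => Re (c n))) t) +i*
  limn (pseries (pseries_diffs (fun n => Im (c n))) t).

Let ReMR (w : R[i]) (x : R) : Re (w * x%:C) = Re w * x.
Proof. by rewrite mulrC cReRM mulrC. Qed.
Let ImMR (w : R[i]) (x : R) : Im (w * x%:C) = Im w * x.
Proof. by rewrite mulrC cImRM mulrC. Qed.
Let natC (n : nat) : n%:R = (n%:R : R)%:C :> R[i].
Proof. by rewrite rmorph_nat. Qed.

Let der (t : R) : `|t| < K -> is_cderive phi t (dphi t).
Proof.
move=> tK; split => /=; apply: (@pseries_snd_diffs R _ K).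
- apply: abs_summable_cvg; have := csummable_Re summ0.
  by under eq_fun do rewrite ReMR.
- apply: abs_summable_cvg; have := csummable_Re summ1.
  by under eq_fun do rewrite ReMR natC cReRM.
- apply: abs_summable_cvg; have := csummable_Re summ2.
  by under eq_fun do rewrite ReMR !natC !cReRM.
- by rewrite (gtr0_norm K0).
- apply: abs_summable_cvg; have := csummable_Im summ0.
  by under eq_fun do rewrite ImMR.
- apply: abs_summable_cvg; have := csummable_Im summ1.
  by under eq_fun do rewrite ImMR natC cImRM.
- apply: abs_summable_cvg; have := csummable_Im summ2.
  by under eq_fun do rewrite ImMR !natC !cImRM.
- by rewrite (gtr0_norm K0).
Qed.

Let tn_le (t : R) n : `|t| <= K -> `|t ^+ n| <= `|K ^+ n|.
Proof.
by move=> tK; rewrite !normrX lerXn2r ?nnegrE// (le_trans tK)// ler_norm.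
Qed.

Let cphi (t : R) : `|t| <= K -> cseries_cvg (fun n => c n * (t ^+ n)%:C) (phi t).
Proof.
move=> tK; have su : csummable (fun n => c n * (t ^+ n)%:C).
  apply: abs_summable_le summ0 => n.
  by rewrite !(ger0_norm (normc_ge0 _)) !(normcM (c n)) !normcR ler_wpM2l ?normc_ge0// tn_le.
split.
  under eq_fun do rewrite ReMR; apply: abs_summable_cvg.
  by have := csummable_Re su; under eq_fun do rewrite ReMR.
under eq_fun do rewrite ImMR; apply: abs_summable_cvg.
by have := csummable_Im su; under eq_fun do rewrite ImMR.
Qed.

Let cdphi (t : R) : `|t| <= K ->
  cseries_cvg (fun n => n.+1%:R * c n.+1 * (t ^+ n)%:C) (dphi t).
Proof.
move=> tK; have su : csummable (fun n => n.+1%:R * c n.+1 * (t ^+ n)%:C).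
  apply: abs_summable_le summ1 => n.
  by rewrite !(ger0_norm (normc_ge0 _)) !(normcM (n.+1%:R * c n.+1)) !normcR ler_wpM2l ?normc_ge0// tn_le.
split.
  under eq_fun do rewrite ReMR natC cReRM; apply: abs_summable_cvg.
  by have := csummable_Re su; under eq_fun do rewrite ReMR natC cReRM.
under eq_fun do rewrite ImMR natC cImRM; apply: abs_summable_cvg.
by have := csummable_Im su; under eq_fun do rewrite ImMR natC cImRM.
Qed.

(** The recurrence (n + 1) c_(n+1) = (a + n) z c_n, summed: that is,
    (1 - t z) phi' = a z phi. *)
Let ode (t : R) : `|t| <= K -> dphi t = z * (a * phi t + t%:C * dphi t).
Proof.
move=> tK; apply: (cseries_cvg_unique (cdphi tK)).
have h := cseries_cvg_lift (cseries_cvg_scale t%:C (cdphi tK)).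
have := cseries_cvg_scale z (cseries_cvg_add (cseries_cvg_scale a (cphi tK)) h).
apply: cseries_cvg_eq => n.
have -> : c n.+1 = c n * (a + n%:R) / n.+1%:R * z.
  by rewrite /c binomial_coefS exprSr; ring.
rewrite [n.+1%:R * _](_ : _ = c n * (a + n%:R) * z); last first.
  have : (n.+1%:R : R[i]) != 0 by rewrite pnatr_eq0.
  by set N := n.+1%:R => N0; field.
case: n => [|n] /=; first by rewrite expr0 addr0; ring.
rewrite subSS subn0 exprS rmorphM/=; ring.
Qed.

(** The base 1 - t z stays in the right half-plane for t in [0, 1], where the
    principal logarithm is smooth. *)
Let base (t : R) : R[i] := 1 - z * t%:C.

Let base_pos (t : R) : `|t| <= 1 -> 0 < Re (base t).
Proof.
move=> t1; rewrite /base cReD cReN /=.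
have := Re_le_normc (z * t%:C); rewrite normcM normcR => h.
have h2 : normc z * `|t| <= normc z by rewrite ler_piMr.
by have := ler_norm (Re (z * t%:C)); have := z1; lra.
Qed.

Let dbase (t : R) : is_cderive base t (- z).
Proof.
have := is_cderive_scale (- z) (is_cderive_real (is_derive_id t 1)).
move=> /(is_cderive_add (is_cderive_cst 1 t)).
rewrite mulr1 add0r; congr (is_cderive _ _ _).
by apply/funext => x; rewrite /base mulNr.
Qed.

(** By [ode], phi(t) (1 - t z)^a has derivative 0 on [0, 1], hence has the same
    value at 0 and 1. *)
Lemma binomial_series : cseries_cvg (fun n => binomial_coef a n * z ^+ n) (cpow (1 - z) (- a)).
Proof.
pose psi t := phi t * cexp (a * clog (base t)).
have dpsi (t : R) : 0 <= t <= 1 -> is_cderive psi t 0.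
  move=> /andP[t0 t1]; have tn : `|t| <= 1 by rewrite ger0_norm.
  have tK : `|t| < K by apply: le_lt_trans tn _.
  have dl := is_cderive_cexp (is_cderive_scale a (is_cderive_clog (base_pos tn) (dbase t))).
  apply: (is_cderive_val (is_cderive_mul (der tK) dl)).
  have b0 : base t != 0.
    by apply/eqP => b0; have := base_pos tn; rewrite b0 /= ltxx.
  have od := ode (ltW tK).
  have od' : base t * dphi t = a * z * phi t.
    by rewrite /base mulrBl mul1r {1}od; ring.
  apply: (mulfI b0); rewrite mulr0 mulrDr (mulrA (base t) (dphi t)) od'; field.
  exact: b0.
have p0 : phi 0 = 1.
  have c0 : cseries_cvg (fun n => c n * ((0 : R) ^+ n)%:C) (phi 0).
    by apply: cphi; rewrite normr0 ltW.
  apply: (cseries_cvg_unique c0).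
  rewrite (_ : 1 = c 0%N * ((0 : R) ^+ 0)%:C); last first.
    by rewrite /c /binomial_coef /rising big_ord0 fact0 !expr0 divr1 !mulr1.
  apply: (@cseries_cvg0 (fun n => c n * ((0 : R) ^+ n)%:C)) => n n0.
  by rewrite expr0n gtn_eqF// mulr0.
have E : psi 1 = psi 0.
  apply: complex_ext.
    by apply: (@constant_of_is_derive0 (fun t => Re (psi t))) => t /dpsi[].
  by apply: (@constant_of_is_derive0 (fun t => Im (psi t))) => t /dpsi[].
have b1 : base 1 = 1 - z by rewrite /base mulr1.
have psi0 : psi 0 = 1.
  rewrite /psi p0 mul1r /base mulr0 subr0 -[1]/((1 : R)%:C) clogR// ln1 mulr0.
  exact: cexp0.
rewrite (_ : cpow _ _ = phi 1).
  have := @cphi 1; rewrite normr1 => /(_ (ltW K1)).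
  by apply: cseries_cvg_eq => n; rewrite expr1n mulr1.
rewrite /cpow ifF; last first.
  apply/eqP => bz; have := @base_pos 1; rewrite normr1 b1 bz /= ltxx => /(_ (lexx 1)).
  by [].
move: E; rewrite psi0 /psi b1 => E1.
apply: (mulIf (cexp_neq0 (a * clog (1 - z)))); rewrite E1 mulNr cexpN mulVf//.
exact: cexp_neq0.
Qed.

End BinomialSeries.

End ComplexBasics.

(** * Powers on the half-line and the Gamma function *)

Section Gamma.
Variable R : realType.
Implicit Types z w a : R[i].
Notation mu := (@lebesgue_measure R).
Notation pos := (`]0%R, +oo[%classic : set R).

(** The real power t^x, with the arguments ordered so that [rpow x] is a
    function of the base. *)
Definition rpow (x t : R) : R := expR (x * ln t).

Lemma rpow_gt0 x t : 0 < rpow x t. Proof. exact: expR_gt0. Qed.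
Lemma rpowD x y t : rpow (x + y) t = rpow x t * rpow y t.
Proof. by rewrite /rpow mulrDl expRD. Qed.
Lemma rpow1 t : 0 < t -> rpow 1 t = t.
Proof. by move=> t0; rewrite /rpow mul1r lnK. Qed.
Lemma rpow_rpow x y t : rpow y (rpow x t) = rpow (x * y) t.
Proof. by rewrite /rpow expRK mulrA [x * y]mulrC. Qed.
Lemma rpowB1 x t : 0 < t -> rpow (x - 1) t = rpow x t / t.
Proof.
move=> t0; have tn : t != 0 by rewrite gt_eqF.
by apply: (mulIf tn); rewrite divfK// -[X in _ * X]rpow1// -rpowD subrK.
Qed.
Lemma ln_rpow x t : ln (rpow x t) = x * ln t.
Proof. by rewrite /rpow expRK. Qed.

Lemma is_derive_rpow x (t : R) : 0 < t -> is_derive t 1 (rpow x) (x * rpow (x - 1) t).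
Proof.
move=> t0; have := is_derive_expR_comp (is_derive_scale x (is_derive1_ln t0)).
move/is_derive_val; apply; rewrite -/(rpow x t).
have -> : rpow x t = rpow (x - 1) t * t by rewrite -[X in _ * X]rpow1// -rpowD subrK.
by rewrite mulrCA mulfK// gt_eqF.
Qed.

Lemma rpow_continuous x (t : R) : 0 < t -> {for t, continuous (rpow x)}.
Proof. by move=> t0; exact: is_derive_continuous (is_derive_rpow x t0). Qed.

Lemma rpow_cvg0 x : 0 < x -> rpow x t @[t --> 0^'+] --> 0.
Proof.
move=> x0; apply: cvg_trans (powR_cvg0 x0); apply: near_eq_cvg; near=> t.
by rewrite /powR gt_eqF.
Unshelve. all: by end_near. Qed.

Lemma rpow_le_expR y s : 0 <= y -> 0 < s ->
  exists2 C : R, 0 < C & forall t : R, 0 < t -> rpow y t <= C * expR (s * t).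
Proof.
move=> y0 s0; pose c := s / (y + 1).
have y1 : 0 < y + 1 by lra.
have c0 : 0 < c by rewrite divr_gt0.
exists (expR (- (y * ln c))); first exact: expR_gt0.
move=> t t0; rewrite /rpow -expRD ler_expR.
have := ltW (ln_sublinear (mulr_gt0 c0 t0)); rewrite lnM ?posrE// => h.
have : y * (ln c + ln t) <= y * (c * t) by rewrite ler_wpM2l.
have : y * (c * t) <= s * t.
  rewrite mulrA ler_wpM2r ?(ltW t0)// /c mulrCA ler_piMr ?(ltW s0)//.
  by rewrite ler_pdivrMr// mul1r lerDl.
by rewrite mulrDr; lra.
Qed.

(** The integrand of Gamma after the substitution t -> t^k.  It is dominated by
    a multiple of the derivative of the bounded function - 1 / (1 + t^(k x)),
    which settles the behaviour at 0 and at +oo together; k = 1 gives the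
    Laplace transform of a power. *)
Lemma integrable_stretched (k x s : R) : 0 < k -> 0 < x -> 0 < s ->
  mu.-integrable pos (EFin \o (fun t => expR (- (s * rpow k t)) * rpow (k * x - 1) t)).
Proof.
move=> k0 x0 s0; have kx0 : 0 < k * x by rewrite mulr_gt0.
pose F t := - (1 + rpow (k * x) t)^-1.
pose F' t := k * x * rpow (k * x - 1) t / (1 + rpow (k * x) t) ^+ 2.
have den t : 0 < 1 + rpow (k * x) t by rewrite addr_gt0// rpow_gt0.
have dF (t : R) : 0 < t -> is_derive t 1 F (F' t).
  move=> t0; have d1 := is_derive_add (is_derive_cst (1 : R) t 1) (is_derive_rpow (k * x) t0).
  have nz : (cst 1 t + rpow (k * x) t) != 0 by rewrite gt_eqF.
  have := is_derive_scale (-1) (@is_deriveV R (fun t => cst (1 : R) t + rpow (k * x) t) t _ 1 nz d1).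
  rewrite (_ : (fun _ => -1 * _) = F); last by apply/funext => y; rewrite mulN1r.
  move/is_derive_val; apply; rewrite /GRing.scale/= /F' add0r.
  by rewrite mulN1r mulNr opprK mulrC.
have F'0 (t : R) : 0 <= F' t.
  by rewrite divr_ge0 ?sqr_ge0 ?mulr_ge0 ?(ltW (rpow_gt0 _ _)) ?(ltW k0) ?(ltW x0).
have iF' : mu.-integrable pos (EFin \o F').
  apply: (@integrable_bounded_antiderivative R F F' 1) => //.
  - move=> t t0; apply: cvgM; last first.
      apply: cvgV; first by rewrite expf_neq0// gt_eqF.
      apply: (@continuous_comp _ _ _ (fun t => 1 + rpow (k * x) t) (fun y => y ^+ 2)).
        by apply: cvgD; [exact: cvg_cst|exact: rpow_continuous].
      exact: exprn_continuous.
    by apply: cvgM; [exact: cvg_cst|exact: rpow_continuous].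
  - move=> t t0; rewrite normrN normfV gtr0_norm// invf_le1//.
    by rewrite lerDl ltW// rpow_gt0.
(* (1 + t^(k x))^2 <= (2 + 2 C) exp(s t^k), where C exp(s v) bounds v^(2 x) *)
have [C C0 HC] := rpow_le_expR (ltW (mulr_gt0 (ltr0n R 2) x0)) s0.
pose M := (2 + 2 * C) / (k * x).
have := integrable_scale M (measurable_itv _) iF'.
apply: le_integrable => //.
  apply/measurable_EFinP; apply: pos_continuous_measurable => t t0.
  apply: cvgM; last exact: rpow_continuous.
  apply: (@continuous_comp _ _ _ (fun t => - (s * rpow k t)) expR).
    by apply: cvgN; apply: cvgM; [exact: cvg_cst|exact: rpow_continuous].
  exact: continuous_expR.
move=> t /posP t0; rewrite lee_fin !ger0_norm; last 2 first.
- rewrite mulr_ge0// ?F'0// divr_ge0 ?(ltW kx0)//.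
  by rewrite addr_ge0// mulr_ge0// ltW.
- by rewrite mulr_ge0 ?expR_ge0// ltW// rpow_gt0.
have -> : M * F' t = (2 + 2 * C) / (1 + rpow (k * x) t) ^+ 2 * rpow (k * x - 1) t.
  by rewrite /M /F'; field; rewrite !gt_eqF.
rewrite ler_wpM2r ?(ltW (rpow_gt0 _ _))// ler_pdivlMr ?exprn_gt0//.
have tk := rpow_gt0 k t.
have E : (1 + rpow (k * x) t) ^+ 2 <= (2 + 2 * C) * expR (s * rpow k t).
  have h1 := HC _ tk; rewrite rpow_rpow in h1.
  have e1 : 1 <= expR (s * rpow k t) by rewrite expR_ge1// mulr_ge0// ltW.
  have -> : (1 + rpow (k * x) t) ^+ 2 = 1 + 2 * rpow (k * x) t + rpow (k * (2 * x)) t.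
    rewrite (_ : k * (2 * x) = k * x + k * x); last by ring.
    by rewrite rpowD; ring.
  have h2 : 2 * rpow (k * x) t <= 1 + rpow (k * (2 * x)) t.
    rewrite (_ : k * (2 * x) = k * x + k * x); last by ring.
    rewrite rpowD -subr_ge0; set r := rpow _ _.
    by rewrite (_ : _ - _ = (r - 1) ^+ 2) ?sqr_ge0//; ring.
  have : C * expR (s * rpow k t) >= rpow (k * (2 * x)) t by [].
  by lra.
rewrite mulrC -ler_pdivlMr ?expR_gt0//; apply: (le_trans E).
by rewrite expRN invrK.
Qed.

Lemma laplace_integrable_rpow x s : 0 < x -> 0 < s -> laplace_integrable (rpow (x - 1)) s.
Proof.
move=> x0 s0; have := @integrable_stretched 1 x s ltr01 x0 s0.
by apply: eq_integrable => // t /set_mem/posP t0 /=; rewrite rpow1// mul1r.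
Qed.

Lemma cpow_re (t : R) a : 0 < t -> Re (cpow t%:C a) = rpow (Re a) t * cos (Im a * ln t).
Proof.
by move=> t0; rewrite cpowE// /cexp /= cReM cImM /= !mulr0 subr0 add0r.
Qed.
Lemma cpow_im (t : R) a : 0 < t -> Im (cpow t%:C a) = rpow (Re a) t * sin (Im a * ln t).
Proof.
by move=> t0; rewrite cpowE// /cexp /= cReM cImM /= !mulr0 subr0 add0r.
Qed.
Lemma normc_cpow_rpow (t : R) a : 0 < t -> normc (cpow t%:C a) = rpow (Re a) t.
Proof. by move=> t0; rewrite normc_cpow. Qed.

Lemma is_cderive_eq (f g : R -> R[i]) (x : R) d : (\forall t \near x, f t = g t) ->
  is_cderive f x d -> is_cderive g x d.
Proof.
move=> fg [f1 f2]; split.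
  by apply: near_eq_is_derive f1; apply: filterS fg => t ->.
by apply: near_eq_is_derive f2; apply: filterS fg => t ->.
Qed.

Lemma is_cderive_cpow a (t : R) : 0 < t ->
  is_cderive (fun t => cpow t%:C a) t (a * cpow t%:C (a - 1)).
Proof.
move=> t0.
have d1 := is_cderive_cexp (is_cderive_scale a (is_cderive_real (is_derive1_ln t0))).
apply: (is_cderive_eq _ (is_cderive_val d1 _)).
  by near=> x; rewrite cpowE//; near: x; exact: lt_nbhsr.
rewrite -cpowE// cpowD// cpowN// cpow1// fmorphV/=; ring.
Unshelve. all: by end_near. Qed.

Definition claplace (f : R -> R[i]) (s : R) : R[i] :=
  laplace (fun t => Re (f t)) s +i* laplace (fun t => Im (f t)) s.

Definition claplace_integrable (f : R -> R[i]) (s : R) : Prop :=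
  laplace_integrable (fun t => Re (f t)) s /\ laplace_integrable (fun t => Im (f t)) s.

Lemma eq_laplace (g h : R -> R) s : (forall t, 0 < t -> g t = h t) -> laplace g s = laplace h s.
Proof. by move=> gh; apply: eq_Rintegral => t /set_mem/posP t0; rewrite gh. Qed.

Lemma eq_laplace_integrable (g h : R -> R) s : (forall t, 0 < t -> g t = h t) ->
  laplace_integrable g s -> laplace_integrable h s.
Proof.
by move=> gh; apply: eq_integrable => // t /set_mem/posP t0 /=; rewrite gh.
Qed.

Lemma laplace_lin (g h : R -> R) (a b s : R) :
  laplace_integrable g s -> laplace_integrable h s ->
  laplace_integrable (fun t => a * g t + b * h t) s /\
  laplace (fun t => a * g t + b * h t) s = a * laplace g s + b * laplace h s.
Proof.
move=> ig ih; rewrite /laplace_integrable /laplace.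
have -> : (fun t => expR (- (s * t)) * (a * g t + b * h t)) =
  (fun t => a * (expR (- (s * t)) * g t) + b * (expR (- (s * t)) * h t)).
  by apply/funext => t; ring.
split; first by apply: integrable_add => //; exact: integrable_scale.
by rewrite RintegralD ?RintegralZl//; exact: integrable_scale.
Qed.

Lemma claplace_scale a (f : R -> R[i]) s : claplace_integrable f s ->
  claplace_integrable (fun t => a * f t) s /\
  claplace (fun t => a * f t) s = a * claplace f s.
Proof.
move=> [i1 i2]; have [j1 e1] := laplace_lin (Re a) (- Im a) i1 i2.
have [j2 e2] := laplace_lin (Re a) (Im a) i2 i1.
have E1 : (fun t => Re (a * f t)) = (fun t => Re a * Re (f t) + - Im a * Im (f t)).
  by apply/funext => t; rewrite cReM mulNr.
have E2 : (fun t => Im (a * f t)) = (fun t => Re a * Im (f t) + Im a * Re (f t)).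
  by apply/funext => t; rewrite cImM.
split; first by split; rewrite ?E1 ?E2.
apply: complex_ext; rewrite /= ?E1 ?E2 ?e1 ?e2 ?cReM ?cImM /=; ring.
Qed.

Lemma cintegrable_le (f : R -> R[i]) (b : R -> R) :
  mu.-integrable pos (EFin \o b) ->
  (forall t : R, 0 < t -> exists d, is_cderive f t d) ->
  (forall t : R, 0 < t -> normc (f t) <= b t) -> cintegrable pos f.
Proof.
move=> ib df fb; split; apply: le_integrable ib => //.
- by apply/measurable_EFinP; apply: pos_continuous_measurable => t /df[d /is_cderive_continuous[]].
- move=> t /posP t0; rewrite lee_fin (le_trans (Re_le_normc _))//.
  by rewrite (le_trans (fb t t0))// ler_norm.
- by apply/measurable_EFinP; apply: pos_continuous_measurable => t /df[d /is_cderive_continuous[]].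
- move=> t /posP t0; rewrite lee_fin (le_trans (Im_le_normc _))//.
  by rewrite (le_trans (fb t t0))// ler_norm.
Qed.

Lemma claplace_integrable_cpow z s : 0 < Re z -> 0 < s ->
  claplace_integrable (fun t => cpow t%:C (z - 1)) s.
Proof.
move=> z0 s0; have [||j1 j2] := @cintegrable_le
  (fun t => (expR (- (s * t)))%:C * cpow t%:C (z - 1)) _ (laplace_integrable_rpow z0 s0).
- move=> t t0; eexists.
  exact: is_cderive_mul (is_cderive_real (is_derive_expRN s t)) (is_cderive_cpow _ t0).
- move=> t t0; rewrite normcM normcR (ger0_norm (expR_ge0 _)) normc_cpow_rpow//.
  by rewrite cReD cReN.
by split; [apply: eq_integrable j1|apply: eq_integrable j2] => // t _ /=; rewrite ?cReRM ?cImRM.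
Qed.

(** Gamma on the half-plane Re z > 0, as a Laplace transform at 1. *)
Definition cgamma z : R[i] := claplace (fun t => cpow t%:C (z - 1)) 1.
Definition rgamma (x : R) : R := laplace (rpow (x - 1)) 1.

Lemma cgamma_real x : 0 < x -> cgamma x%:C = (rgamma x)%:C.
Proof.
move=> x0; apply: complex_ext => /=.
  apply: eq_laplace => t t0; rewrite cpow_re//= subr0.
  by rewrite mul0r cos0 mulr1.
rewrite (@eq_laplace _ (cst 0)); last first.
  by move=> t t0; rewrite cpow_im//= subr0 mul0r sin0 mulr0.
rewrite /laplace; under eq_Rintegral do rewrite mulr0.
by rewrite Rintegral_cst// mul0r.
Qed.

Lemma cpow_cvg0 z : 0 < Re z ->
  Re (cpow t%:C z) @[t --> 0^'+] --> (0 : R) /\ Im (cpow t%:C z) @[t --> 0^'+] --> (0 : R).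
Proof.
move=> z0; have c0 := rpow_cvg0 z0.
split; apply/cvgrPdist_le => e e0; move/cvgrPdist_le : c0 => /(_ e e0) c0; near=> t.
  have t0 : 0 < t by near: t; exact: nbhs_right_gt.
  rewrite sub0r normrN; apply: (le_trans (Re_le_normc _)).
  rewrite normc_cpow_rpow//; have : `|0 - rpow (Re z) t| <= e by near: t.
  by rewrite sub0r normrN ger0_norm// ltW// rpow_gt0.
have t0 : 0 < t by near: t; exact: nbhs_right_gt.
rewrite sub0r normrN; apply: (le_trans (Im_le_normc _)).
rewrite normc_cpow_rpow//; have : `|0 - rpow (Re z) t| <= e by near: t.
by rewrite sub0r normrN ger0_norm// ltW// rpow_gt0.
Unshelve. all: by end_near. Qed.

(** [laplace_derive] at s = 1 applied to t^z, which vanishes at 0+. *)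
Lemma cgammaS z : 0 < Re z -> cgamma (z + 1) = z * cgamma z.
Proof.
move=> z0; have [c1 c2] := cpow_cvg0 z0.
have h0 : (0 : R) < 1 / 2 by lra.
have h1 : (1 / 2 : R) < 1 by lra.
have iz := claplace_integrable_cpow z0 h0.
have [izs _] := claplace_scale z iz.
have [_ <-] := claplace_scale z (claplace_integrable_cpow z0 ltr01).
have d1 (t : R) : 0 < t -> is_derive t 1 (fun t => Re (cpow t%:C z)) (Re (z * cpow t%:C (z - 1))).
  by move=> t0; have [] := is_cderive_cpow z t0.
have d2 (t : R) : 0 < t -> is_derive t 1 (fun t => Im (cpow t%:C z)) (Im (z * cpow t%:C (z - 1))).
  by move=> t0; have [] := is_cderive_cpow z t0.
have [_ e1] := laplace_derive h0 h1 d1 c1 izs.1.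
have [_ e2] := laplace_derive h0 h1 d2 c2 izs.2.
rewrite /cgamma addrK; apply: complex_ext => /=.
  by rewrite e1 mul1r subr0.
by rewrite e2 mul1r subr0.
Qed.

Lemma rgammaS x : 0 < x -> rgamma (x + 1) = x * rgamma x.
Proof.
move=> x0; have := @cgammaS x%:C x0; rewrite cgamma_real//.
have -> : x%:C + 1 = (x + 1)%:C by rewrite rmorphD.
by rewrite cgamma_real ?addr_gt0// => /(congr1 Re) /=; rewrite mul0r subr0.
Qed.

(** The integral over [T, 2 T] is already this large.  With x = Re l_n this
    bounds the terms of the kernel at T by their Laplace transforms, and turns
    the summability of the latter into the convergence of the kernel. *)
Lemma laplace_rpow_ge x s T : 0 < x -> 0 < s -> 0 < T ->
  expR (- (2 * s * T)) * rpow x T / 2 <= laplace (rpow (x - 1)) s.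
Proof.
move=> x0 s0 T0; have ir := laplace_integrable_rpow x0 s0.
have T2 : T < 2 * T by lra.
have sub : `[T, 2 * T]%classic `<=` pos.
  by move=> t /=; rewrite !in_itv/= andbT => /andP[+ _]; exact: lt_le_trans.
have irT : mu.-integrable `[T, 2 * T] (EFin \o (fun t => expR (- (s * t)) * rpow (x - 1) t)).
  exact: integrableS ir.
apply: (@le_trans _ _ (\int[mu]_(t in `[T, 2 * T]) (expR (- (s * t)) * rpow (x - 1) t))); last first.
  rewrite /laplace /Rintegral fine_le//.
  - by apply: integrable_fin_num.
  - by apply: integrable_fin_num.
  - apply: ge0_subset_integral => //; first exact: measurable_int ir.
    by move=> t _; rewrite lee_fin mulr_ge0 ?expR_ge0// ltW// rpow_gt0.
set c := expR _ * _ / 2.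
have -> : c = \int[mu]_(t in `[T, 2 * T]) (cst (c / T) t).
  rewrite Rintegral_cst//= lebesgue_measure_itv/= lte_fin T2 -EFinB/=.
  by field; rewrite gt_eqF.
apply: le_Rintegral => //.
  apply: measurable_bounded_integrable => //.
    by rewrite /= lebesgue_measure_itv/= lte_fin T2 -EFinB ltry.
  by exists `|c / T|; split => // M ltM t _ /=; exact: ltW.
move=> t /=; rewrite in_itv/= => /andP[Tt tT].
have t0 : 0 < t by exact: lt_le_trans Tt.
have e1 : expR (- (2 * s * T)) <= expR (- (s * t)).
  by rewrite ler_expR lerN2 -mulrA [2 * (s * T)]mulrCA ler_wpM2l// ltW.
have p1 : rpow x T / (2 * T) <= rpow (x - 1) t.
  rewrite rpowB1//.
  apply: ler_pM => //; rewrite ?invr_ge0 ?(ltW (rpow_gt0 _ _))//; first by lra.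
    by rewrite /rpow ler_expR ler_wpM2l ?(ltW x0)// ler_ln ?posrE.
  by rewrite lef_pV2 ?posrE// mulr_gt0.
rewrite (_ : c / T = expR (- (2 * s * T)) * (rpow x T / (2 * T))); last first.
  by rewrite /c; field; rewrite gt_eqF.
by apply: ler_pM => //; rewrite ?expR_ge0// divr_ge0 ?(ltW (rpow_gt0 _ _))//; lra.
Qed.

Lemma rgamma_gt0 x : 0 < x -> 0 < rgamma x.
Proof.
move=> x0; apply: lt_le_trans (laplace_rpow_ge x0 ltr01 ltr01).
by rewrite divr_gt0// mulr_gt0 ?expR_gt0 ?rpow_gt0.
Qed.

Lemma sin_le_id v : 0 <= v -> `|sin v| <= v :> R.
Proof.
rewrite le_eqVlt => /predU1P[<-|v0]; first by rewrite sin0 normr0.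
have [c _] := MVT v0 (fun x _ => is_derive_sin x)
  (continuous_subspaceT (@continuous_sin R)).
rewrite sin0 !subr0 => ->; rewrite normrM (gtr0_norm v0) ler_piMl ?(ltW v0)//.
by rewrite ler_norml cos_geN1 cos_le1.
Qed.

Lemma cos_ge_quad u : 1 - u ^+ 2 / 2 <= cos u :> R.
Proof.
have -> : cos u = 1 - 2 * sin (u / 2) ^+ 2.
  have uE : u = (u / 2) *+ 2 by rewrite -mulr_natr divfK.
  by rewrite {1}uE cos_mulr2n cos2sin2 -mulr_natr; ring.
have : `|sin (u / 2)| <= `|u / 2|.
  have [h|h] := leP 0 (u / 2); first by rewrite (ger0_norm h); exact: sin_le_id.
  rewrite -normrN -sinN (ltr0_norm h); apply: sin_le_id; lra.
rewrite -ler_sqr ?nnegrE// !real_normK ?num_real// expr_div_n => h.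
have e4 : (2 : R) ^+ 2 = 4 by rewrite -natrX.
by rewrite e4 in h; lra.
Qed.

(** The weight t / X - 2 + X / t integrates explicitly against the Gamma
    integrand, which the square of ln (t / X) does not. *)
Lemma ln_sqr_le (r : R) : 0 < r -> ln r ^+ 2 <= 4 * (r - 2 + r^-1).
Proof.
move=> r0; pose v := ln r / 2.
have rE : r = expR v * expR v by rewrite -expRD -mulr2n -[v *+ 2]mulr_natr divfK// lnK.
have iE : r^-1 = expR (- v) * expR (- v) by rewrite rE invfM -expRN.
have vE : ln r = 2 * v by rewrite /v mulrC divfK.
have ee : expR v * expR (- v) = 1 by rewrite -expRD subrr expR0.
(* with r = exp(2 v), the claim is v^2 <= (exp v - exp(- v))^2 *)
have -> : r - 2 + r^-1 = (expR v - expR (- v)) ^+ 2.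
  have -> : r - 2 + r^-1 = expR v * expR v - 2 * (expR v * expR (- v)) + expR (- v) * expR (- v).
    by rewrite ee mulr1 -rE -iE.
  by ring.
rewrite vE exprMn (_ : 2 ^+ 2 = 4 :> R); last by rewrite -natrX.
rewrite ler_pM2l//.
have key (w : R) : 0 <= w -> w ^+ 2 <= (expR w - expR (- w)) ^+ 2.
  move=> w0; have w1 := expR_ge1Dx w.
  have w2 : expR (- w) <= 1 by rewrite -expR0 ler_expR oppr_le0.
  by rewrite ler_sqr ?nnegrE; lra.
have [v0|v0] := leP 0 v; first exact: key.
have := key (- v); rewrite opprK sqrrN => /(_ _)/le_trans; apply; first by lra.
by rewrite -sqrrN opprB.
Qed.

(** For large X the integrand of Gamma(X) concentrates near t = X.  Multiplying
    Gamma(X + i y) by X^(- i y) replaces the oscillating factor by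
    cos (y ln (t / X)) in the real part; this is at least
    1 - 2 y^2 (t / X - 2 + X / t) by [cos_ge_quad] and [ln_sqr_le], and the
    last function integrates by the functional equation of Gamma. *)
Lemma cgamma_ge (X y : R) : 1 < X -> rgamma X * (1 - 2 * y ^+ 2 / (X - 1)) <= normc (cgamma (X +i* y)).
Proof.
move=> X1; have X0 : 0 < X by lra.
have Xm : 0 < X - 1 by lra.
pose z := X +i* y; pose th := y * ln X.
have [iR iI] := @claplace_integrable_cpow z 1 X0 ltr01.
have [iL eL] := laplace_lin (cos th) (sin th) iR iI.
have n1 : Re (cgamma z * cexp ((- th)*i)) = cos th * Re (cgamma z) + sin th * Im (cgamma z).
  by rewrite cReM /cexp /= expR0 cosN sinN; ring.
apply: (@le_trans _ _ (Re (cgamma z * cexp ((- th)*i)))); last first.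
  apply: (le_trans (ler_norm _)); apply: (le_trans (Re_le_normc _)).
  by rewrite normcM normc_cexp /= expR0 mulr1.
rewrite n1 /cgamma /= -eL.
have i0 := laplace_integrable_rpow X0 ltr01.
have ip : laplace_integrable (rpow (X + 1 - 1)) 1 by apply: laplace_integrable_rpow; lra.
have im : laplace_integrable (rpow (X - 1 - 1)) 1 by apply: laplace_integrable_rpow.
have [i1 e1] := laplace_lin X^-1 X ip im.
have [i2 e2] := laplace_lin 1 (- 2) i1 i0.
have [i3 e3] := laplace_lin 1 (- (2 * y ^+ 2)) i0 i2.
have -> : rgamma X * (1 - 2 * y ^+ 2 / (X - 1)) = laplace (fun t => 1 * rpow (X - 1) t +
   - (2 * y ^+ 2) * (1 * (X^-1 * rpow (X + 1 - 1) t + X * rpow (X - 1 - 1) t) + - 2 * rpow (X - 1) t)) 1.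
  rewrite e3 e2 e1 -!/(rgamma _) rgammaS//.
  have g1 : rgamma X = (X - 1) * rgamma (X - 1) by rewrite -rgammaS// subrK.
  rewrite g1; field; rewrite (gt_eqF X0)/= gt_eqF//.
apply: le_Rintegral => // t /posP t0; rewrite ler_wpM2l ?expR_ge0//.
rewrite !cpow_re// !cpow_im//= !subr0.
have rE : X^-1 * rpow (X + 1 - 1) t + X * rpow (X - 1 - 1) t =
    rpow (X - 1) t * (t / X + X / t).
  have -> : X + 1 - 1 = X - 1 + 1 by ring.
  rewrite rpowD rpow1//.
  rewrite (rpowB1 (X - 1))//.
  by field; rewrite !gt_eqF.
rewrite rE.
have -> : cos th * (rpow (X - 1) t * cos (y * ln t)) + sin th * (rpow (X - 1) t * sin (y * ln t)) =
    rpow (X - 1) t * cos (y * ln t - th).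
  by rewrite cosB; ring.
have -> : 1 * rpow (X - 1) t + - (2 * y ^+ 2) * (1 * (rpow (X - 1) t * (t / X + X / t)) + - 2 * rpow (X - 1) t)
   = rpow (X - 1) t * (1 - 2 * y ^+ 2 * (t / X - 2 + X / t)).
  by ring.
rewrite ler_wpM2l ?(ltW (rpow_gt0 _ _))//.
apply: le_trans (cos_ge_quad _).
have -> : y * ln t - th = y * ln (t / X).
  by rewrite /th lnM ?posrE ?invr_gt0// lnV ?posrE//; ring.
have tX : 0 < t / X by rewrite divr_gt0.
have := ln_sqr_le tX; rewrite invfM invrK [t^-1 * X]mulrC exprMn => h.
rewrite lerD2l lerN2 ler_pdivrMr//.
rewrite (_ : 2 * y ^+ 2 * _ * 2 = y ^+ 2 * (4 * (t / X - 2 + X / t))); last by ring.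
by rewrite ler_wpM2l ?sqr_ge0.
Qed.

(** By the functional equation, Gamma(x) / |Gamma(x + i y)| is the same quotient
    at x + N times the product of the |x + j + i y| / (x + j) for j < N.  Each
    factor is at most exp(y^2 / (2 (x + j)^2)), the sum over j of 1 / (x + j)^2
    is at most 1 / x^2 + 1 / x, and the quotient at x + N is at most 2 for large
    N by [cgamma_ge]. *)
Lemma rgamma_le_cgamma (x y : R) : 0 < x ->
  rgamma x <= 2 * expR ((y ^+ 2 / x ^+ 2 + y ^+ 2 / x) / 2) * normc (cgamma (x +i* y)).
Proof.
move=> x0.
pose S (N : nat) : R := \sum_(j < N) ((x + j%:R) ^+ 2)^-1.
have xj (j : nat) : 0 < x + j%:R by rewrite ltr_wpDr.
have step (N : nat) : rgamma x * normc (cgamma ((x + N%:R) +i* y)) <=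
    rgamma (x + N%:R) * normc (cgamma (x +i* y)) * expR (y ^+ 2 * S N / 2).
  elim: N => [|N IH]; first by rewrite addr0 /S big_ord0 mulr0 mul0r expR0 mulr1.
  have -> : x + N.+1%:R = x + N%:R + 1 by rewrite -natr1 addrA.
  have -> : (x + N%:R + 1) +i* y = ((x + N%:R) +i* y) + 1.
    by apply: complex_ext; rewrite ?cReD ?cImD /= ?addr0.
  have xN0 : 0 < Re ((x + N%:R) +i* y) by exact: xj.
  rewrite (cgammaS xN0) (rgammaS (xj N)) normcM.
  have nz : normc ((x + N%:R) +i* y) <= (x + N%:R) * expR (y ^+ 2 * ((x + N%:R) ^+ 2)^-1 / 2).
    rewrite -(ler_sqr) ?nnegrE ?normc_ge0 ?mulr_ge0 ?expR_ge0 ?(ltW (xj N))//.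
    rewrite normcE sqr_sqrtr ?addr_ge0 ?sqr_ge0//= exprMn -[expR _ ^+ 2]expRM_natl.
    rewrite [2 * _]mulrC divfK//.
    have : 1 + y ^+ 2 * ((x + N%:R) ^+ 2)^-1 <= expR (y ^+ 2 * ((x + N%:R) ^+ 2)^-1).
      exact: expR_ge1Dx.
    move=> /(ler_wpM2l (sqr_ge0 (x + N%:R))); apply: le_trans.
    rewrite mulrDr mulr1 mulrCA mulfV ?mulr1// expf_neq0// gt_eqF//.
  have -> : S N.+1 = S N + ((x + N%:R) ^+ 2)^-1 by rewrite /S big_ord_recr.
  rewrite mulrDr mulrDl expRD.
  rewrite mulrCA; apply: (le_trans (ler_pM (normc_ge0 _) _ nz IH)).
    by rewrite mulr_ge0 ?normc_ge0// ltW// rgamma_gt0.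
  by rewrite le_eqVlt; apply/orP; left; apply/eqP; ring.
have Sle N : S N.+1 <= (x ^+ 2)^-1 + x^-1 - (x + N%:R)^-1.
  elim: N => [|N IH].
    by rewrite /S big_ord_recr big_ord0 /= add0r addr0; lra.
  rewrite /S big_ord_recr/= -/(S N.+1).
  have xN := xj N; have xN1 := xj N.+1.
  have : ((x + N.+1%:R) ^+ 2)^-1 <= (x + N%:R)^-1 - (x + N.+1%:R)^-1.
    rewrite (_ : _ - _ = ((x + N%:R) * (x + N.+1%:R))^-1); last first.
      rewrite -natr1 addrA; field.
      by rewrite (gt_eqF xN) -addrA natr1 (gt_eqF xN1).
    rewrite lef_pV2 ?posrE ?exprn_gt0 ?mulr_gt0// expr2 ler_wpM2r ?(ltW xN1)//.
    by rewrite lerD2l ler_nat.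
  by lra.
(* with X = x + N + 1, this makes 2 y^2 / (X - 1) at most 1/2 in the lower bound *)
pose N := (Num.truncn (4 * y ^+ 2 + 1)).+1.
have Ny : 4 * y ^+ 2 + 1 < N%:R by exact: truncnS_gt.
have y2 : 0 <= y ^+ 2 by exact: sqr_ge0.
have XN : 1 < x + N.+1%:R by rewrite -natr1; lra.
have big : rgamma (x + N.+1%:R) <= 2 * normc (cgamma ((x + N.+1%:R) +i* y)).
  have := cgamma_ge y XN => h.
  have g0 : 0 < rgamma (x + N.+1%:R) by apply: rgamma_gt0.
  have : rgamma (x + N.+1%:R) * (1 / 2) <= normc (cgamma ((x + N.+1%:R) +i* y)).
    apply: le_trans h; rewrite ler_pM2l//.
    have : 2 * y ^+ 2 / (x + N.+1%:R - 1) <= 1 / 2.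
      rewrite ler_pdivrMr; last by lra.
      have -> : N.+1%:R = N%:R + 1 :> R by rewrite natr1.
      by lra.
    by lra.
  by lra.
have g0 : 0 < rgamma (x + N.+1%:R) by apply: rgamma_gt0.
have := ler_wpM2l (ltW (rgamma_gt0 x0)) big => h.
have h2 := step N.+1.
rewrite -(ler_pM2r g0); apply: (le_trans h); rewrite mulrCA.
have h3 : expR (y ^+ 2 * S N.+1 / 2) <= expR ((y ^+ 2 / x ^+ 2 + y ^+ 2 / x) / 2).
  rewrite ler_expR ler_wpM2r// -mulrDr ler_wpM2l//.
  apply: (le_trans (Sle N)); rewrite lerBlDr lerDl invr_ge0 ltW//.
have h4 : rgamma (x + N.+1%:R) * normc (cgamma (x +i* y)) * expR (y ^+ 2 * S N.+1 / 2) <=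
  rgamma (x + N.+1%:R) * normc (cgamma (x +i* y)) * expR ((y ^+ 2 / x ^+ 2 + y ^+ 2 / x) / 2).
  by rewrite ler_wpM2l// mulr_ge0 ?normc_ge0// ltW.
have h5 := le_trans h2 h4.
set E := expR ((y ^+ 2 / x ^+ 2 + y ^+ 2 / x) / 2) in h5 *.
rewrite (_ : 2 * E * _ * _ = 2 * (rgamma (x + N.+1%:R) * normc (cgamma (x +i* y)) * E)); last by ring.
by rewrite ler_pM2l.
Qed.

Lemma cgamma_neq0 z : 0 < Re z -> cgamma z != 0.
Proof.
case: z => x y /= x0; apply/eqP => z0; have := rgamma_le_cgamma y x0.
by rewrite z0 Normc.normc0 mulr0 leNgt rgamma_gt0.
Qed.

End Gamma.

(** * The k-gamma function and the transform of a complex power *)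

Section KGamma.
Variable R : realType.
Implicit Types z w a : R[i].
Notation mu := (@lebesgue_measure R).
Notation pos := (`]0%R, +oo[%classic : set R).

(** Substitution y = c t^k in an improper integral, as the limit of the
    substitution on the compact intervals of [expanding_itv] and on their
    images. *)
Lemma Rintegral_substitution_rpow (k c : R) (G : R -> R) : 0 < k -> 0 < c ->
  (forall t : R, 0 < t -> {for t, continuous G}) ->
  mu.-integrable pos (EFin \o G) ->
  mu.-integrable pos (EFin \o (fun t => G (c * rpow k t) * (c * (k * rpow (k - 1) t)))) ->
  \int[mu]_(t in pos) G t =
  \int[mu]_(t in pos) (G (c * rpow k t) * (c * (k * rpow (k - 1) t))).
Proof.
move=> k0 c0 cG iG iGF.
pose F t := c * rpow k t.
have dF (t : R) : 0 < t -> is_derive t 1 F (c * (k * rpow (k - 1) t)).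
  by move=> t0; apply: is_derive_scale; exact: is_derive_rpow.
have F0 t : 0 < F t by rewrite mulr_gt0// rpow_gt0.
have Flt (x y : R) : 0 < x -> x < y -> F x < F y.
  move=> x0 xy; rewrite /F ltr_pM2l// /rpow ltr_expR ltr_pM2l//.
  by rewrite ltr_ln ?posrE//; exact: lt_trans xy.
have Fle (x y : R) : 0 < x -> x <= y -> F x <= F y.
  by move=> x0; rewrite le_eqVlt => /predU1P[->//|/(Flt _ _ x0)/ltW].
have n0 n : 0 < n.+1%:R^-1 :> R by rewrite invr_gt0.
pose E n : set R := `[F n.+1%:R^-1, F n.+2%:R]%classic.
have cvgE : (\int[mu]_(x in E n) G x) @[n --> \oo] --> \int[mu]_(t in pos) G t.
  apply: Rintegral_exhaustion => //.
  - by move=> n; exact: measurable_itv.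
  - move=> n m nm; apply/subsetPset => t; rewrite /E /= !in_itv/= => /andP[h1 h2].
    apply/andP; split.
      by apply: le_trans h1; apply: Fle => //; rewrite lef_pV2 ?posrE// ler_nat.
    by apply: (le_trans h2); apply: Fle => //; rewrite ler_nat.
  - move=> n t; rewrite /E /= !in_itv/= andbT => /andP[h1 _].
    exact: lt_le_trans h1.
  move=> t /posP t0; pose v := rpow k^-1 (t / c).
  have v0 : 0 < v by exact: rpow_gt0.
  have Fv : F v = t.
    rewrite /F /v rpow_rpow mulVf ?gt_eqF// rpow1 ?divr_gt0//.
    by rewrite mulrC divfK// gt_eqF.
  have : (\bigcup_n expanding_itv n) v by rewrite expanding_itv_bigcup/= in_itv/= v0.
  move=> [n _]; rewrite /expanding_itv /= in_itv/= => /andP[h1 h2].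
  exists n => //; rewrite /E /= in_itv/= -Fv; apply/andP; split; exact: Fle.
apply: cvg_unique cvgE _ => //.
have := Rintegral_expanding iGF; apply: cvg_trans; apply: near_eq_cvg; near=> n.
rewrite /Rintegral /E /expanding_itv; congr fine.
have nn : n.+1%:R^-1 <= n.+2%:R :> R by apply: ltW; exact: expanding_itv_lt.
have dFE (t : R) : 0 < t -> F^`()%classic t = c * (k * rpow (k - 1) t).
  by move=> t0; rewrite derive1E; have [_] := dF t t0.
have cdF (t : R) : 0 < t -> F^`()%classic x @[x --> t] --> c * (k * rpow (k - 1) t).
  move=> t0; have : c * (k * rpow (k - 1) x) @[x --> t] --> c * (k * rpow (k - 1) t).
    apply: cvgM; first exact: cvg_cst.
    by apply: cvgM; [exact: cvg_cst|exact: rpow_continuous].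
  apply: cvg_trans; apply: near_eq_cvg; near=> x; rewrite dFE//.
  by near: x; exact: lt_nbhsr.
have N2 : 0 < n.+2%:R :> R by [].
rewrite (@integration_by_substitution_increasing R F G _ _ nn).
- apply: eq_integral => t /set_mem; rewrite /= in_itv/= => /andP[h1 _].
  by rewrite fctE dFE// (lt_le_trans (n0 n) h1).
- move=> x y; rewrite !in_itv/= => /andP[x1 _] _; apply: Flt.
  exact: lt_le_trans x1.
- move=> x; rewrite in_itv/= => /andP[x1 _]; have x0 := lt_trans (n0 n) x1.
  by rewrite /continuous_at dFE//; exact: cdF.
- apply/cvg_ex; exists (c * (k * rpow (k - 1) n.+1%:R^-1)).
  by apply: cvg_at_right_filter; exact: cdF.
- apply/cvg_ex; exists (c * (k * rpow (k - 1) n.+2%:R)).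
  by apply: cvg_at_left_filter; exact: cdF.
- split.
  + move=> x; rewrite in_itv/= => /andP[x1 _]; have x0 := lt_trans (n0 n) x1.
    by have [] := dF x x0.
  + by apply: cvg_at_right_filter; exact: is_derive_continuous (dF _ (n0 n)).
  + by apply: cvg_at_left_filter; exact: is_derive_continuous (dF _ N2).
- apply: continuous_in_subspaceT => x /set_mem; rewrite /= in_itv/= => /andP[x1 _].
  by apply: cG; exact: lt_le_trans x1.
Unshelve. all: by end_near. Qed.

Lemma eq_integrable_pos (g h : R -> R) : (forall t : R, 0 < t -> g t = h t) ->
  mu.-integrable pos (EFin \o g) -> mu.-integrable pos (EFin \o h).
Proof. by move=> gh; apply: eq_integrable => // t /set_mem/posP t0 /=; rewrite gh. Qed.

Lemma eq_Rintegral_pos (g h : R -> R) : (forall t : R, 0 < t -> g t = h t) ->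
  \int[mu]_(t in pos) g t = \int[mu]_(t in pos) h t.
Proof. by move=> gh; apply: eq_Rintegral => t /set_mem/posP t0; rewrite gh. Qed.

Lemma Rintegral_lin (D : set R) (a b : R) (g h : R -> R) :
  measurable (D : set (measurableTypeR R)) ->
  mu.-integrable D (EFin \o g) -> mu.-integrable D (EFin \o h) ->
  \int[mu]_(t in D) (a * g t + b * h t) = a * \int[mu]_(t in D) g t + b * \int[mu]_(t in D) h t.
Proof. by move=> mD ig ih; rewrite RintegralD ?RintegralZl//; exact: integrable_scale. Qed.

Variables (k : R).
Hypothesis k0 : 0 < k.

Let k_gamma_integrand (l : R[i]) (t : R) : R[i] := (expR (- (t `^ k / k)))%:C * cpow t%:C (k%:C * l - 1).

Lemma k_gamma_integrable l : 0 < Re l ->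
  mu.-integrable pos (EFin \o (fun t => Re (k_gamma_integrand l t))) /\
  mu.-integrable pos (EFin \o (fun t => Im (k_gamma_integrand l t))).
Proof.
move=> l0; have ik : 0 < k^-1 by rewrite invr_gt0.
apply: (cintegrable_le (integrable_stretched k0 l0 ik)) => t t0.
  have d1 := is_derive_scale (- k^-1) (is_derive1_powR k t0).
  eexists; apply: is_cderive_mul (is_cderive_cpow _ t0).
  apply: is_cderive_real; apply: is_derive_expR_comp.
  rewrite (_ : (fun t => - (t `^ k / k)) = (fun t => - k^-1 * t `^ k)); first exact: d1.
  by apply/funext => y; rewrite mulNr [_ / k]mulrC.
rewrite /k_gamma_integrand normcM normcR ger0_norm ?expR_ge0// normc_cpow_rpow//.
by rewrite cReD cReN cReRM /powR (gt_eqF t0) [_ / k]mulrC.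
Qed.

(** The substitution y = t^k / (k s) in the Laplace integral.  For k = 1 it
    expresses the homogeneity in s. *)
Lemma claplace_cpow_k_gamma l s : 0 < Re l -> 0 < s ->
  claplace (fun t => cpow t%:C (l - 1)) s =
  k%:C * cpow (k * s)%:C (- l) * k_gamma k (k%:C * l).
Proof.
move=> l0 s0; have ks0 : 0 < k * s by rewrite mulr_gt0.
have c0 : 0 < (k * s)^-1 by rewrite invr_gt0.
have [iR iI] := k_gamma_integrable l0.
pose A := k%:C * cpow (k * s)%:C (- l).
have key (t : R) : 0 < t ->
  (expR (- (s * ((k * s)^-1 * rpow k t))))%:C * cpow ((k * s)^-1 * rpow k t)%:C (l - 1) *
   ((k * s)^-1 * (k * rpow (k - 1) t))%:C = A * k_gamma_integrand l t.
  move=> t0.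
  have -> : s * ((k * s)^-1 * rpow k t) = t `^ k / k.
    by rewrite /powR gt_eqF// -/(rpow k t); field; rewrite !gt_eqF.
  rewrite cpowM// ?rpow_gt0// cpowV//.
  have -> : cpow (rpow k t)%:C (l - 1) = cpow t%:C (k%:C * (l - 1)).
    by rewrite !cpowE ?rpow_gt0// ln_rpow rmorphM/= mulrCA mulrA.
  rewrite /k_gamma_integrand (_ : k%:C * l - 1 = k%:C * (l - 1) + (k - 1)%:C); last by rewrite rmorphB/=; ring.
  rewrite [cpow t%:C (_ + (k - 1)%:C)]cpowD// [cpow t%:C (k - 1)%:C]cpowE// -rmorphM/= cexpR -/(rpow (k - 1) t).
  rewrite /A (_ : - l = - (l - 1) - 1); last by ring.
  rewrite [cpow _ (- _ - 1)]cpowD// !cpowN// cpow1//.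
  rewrite !rmorphM/= fmorphV/= !rmorphM/=; field.
  rewrite !fmorph_eq0 (gt_eqF s0) (gt_eqF k0) /=.
  by have := cpow_neq0 (l - 1) ks0; rewrite rmorphM.
have [jR jI] := claplace_integrable_cpow l0 s0.
have cd (t : R) : 0 < t -> is_cderive (fun t => cpow t%:C (l - 1)) t _ :=
  fun t0 => is_cderive_cpow (l - 1) t0.
have ce (t : R) : {for t, continuous (fun t : R => expR (- (s * t)))}.
  by have := is_derive_continuous (is_derive_expRN s t).
have kR (t : R) : 0 < t ->
    (expR (- (s * ((k * s)^-1 * rpow k t))) * Re (cpow ((k * s)^-1 * rpow k t)%:C (l - 1))) *
    ((k * s)^-1 * (k * rpow (k - 1) t)) = Re A * Re (k_gamma_integrand l t) + - Im A * Im (k_gamma_integrand l t).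
  by move=> t0; rewrite mulNr -cReM -key// [in RHS]mulrC cReRM cReRM; ring.
have kI (t : R) : 0 < t ->
    (expR (- (s * ((k * s)^-1 * rpow k t))) * Im (cpow ((k * s)^-1 * rpow k t)%:C (l - 1))) *
    ((k * s)^-1 * (k * rpow (k - 1) t)) = Re A * Im (k_gamma_integrand l t) + Im A * Re (k_gamma_integrand l t).
  by move=> t0; rewrite -cImM -key// [in RHS]mulrC cImRM cImRM; ring.
rewrite -/A; clearbody A; apply: complex_ext; rewrite ?cReM ?cImM.
  change (laplace (fun t => Re (cpow t%:C (l - 1))) s = Re A * \int[mu]_(t in pos) Re (k_gamma_integrand l t) - Im A * \int[mu]_(t in pos) Im (k_gamma_integrand l t)); rewrite /laplace.
  rewrite (Rintegral_substitution_rpow k0 c0); first last.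
  - apply: (@eq_integrable_pos (fun t => Re A * Re (k_gamma_integrand l t) + - Im A * Im (k_gamma_integrand l t))).
      by move=> t t0; rewrite kR.
    by apply: integrable_add => //; exact: integrable_scale.
  - exact: jR.
  - by move=> t t0; apply: cvgM; [exact: ce|have [] := is_cderive_continuous (cd t t0)].
  rewrite (eq_Rintegral_pos kR).
  by rewrite Rintegral_lin// mulNr.
change (laplace (fun t => Im (cpow t%:C (l - 1))) s = Re A * \int[mu]_(t in pos) Im (k_gamma_integrand l t) + Im A * \int[mu]_(t in pos) Re (k_gamma_integrand l t)); rewrite /laplace.
rewrite (Rintegral_substitution_rpow k0 c0); first last.
- apply: (@eq_integrable_pos (fun t => Re A * Im (k_gamma_integrand l t) + Im A * Re (k_gamma_integrand l t))).
    by move=> t t0; rewrite kI.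
  by apply: integrable_add => //; exact: integrable_scale.
- exact: jI.
- by move=> t t0; apply: cvgM; [exact: ce|have [] := is_cderive_continuous (cd t t0)].
rewrite (eq_Rintegral_pos kI).
by rewrite Rintegral_lin.
Qed.

End KGamma.

(** * Laplace transform of a convolution *)

Section Convolution.
Variable R : realType.
Local Notation mu := (@lebesgue_measure R).
Notation pos := (`]0%R, +oo[%classic : set R).

Let shift_measurable (t : R) : measurable_fun [set: measurableTypeR R] (fun x : measurableTypeR R => x - t : measurableTypeR R).
Proof. exact: measurable_funB. Qed.

Let shifted (t : R) : {measure set (measurableTypeR R) -> \bar R} :=
  measure_function_pushforward__canonical__measure_function_Measure mu (shift_measurable t).

(** Lebesgue measure is determined by its values on intervals. *)
Lemma lebesgue_measure_shift (t : R) (A : set (measurableTypeR R)) : measurable A ->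
  mu A = mu ((fun x : R => x - t) @^-1` A).
Proof.
move=> mA.
transitivity (shifted t A); last by [].
apply: lebesgue_measure_unique mA => X [[a b] _ <-] /=.
rewrite -[RHS]/(shifted t `]a, b]%classic); have -> : shifted t `]a, b]%classic = mu `]a + t, b + t]%classic.
  rewrite /shifted /= /pushforward; congr (mu _); apply/seteqP; split => x; rewrite /= !in_itv/=.
  - by rewrite ltrBrDr lerBlDr.
  - by rewrite ltrBrDr lerBlDr.
rewrite !lebesgue_measure_itv/= !lte_fin ltrD2r; case: ifP => // _.
by rewrite -!EFinB; congr EFin; ring.
Qed.

Lemma ge0_integral_shift (t : R) (G : R -> R) : measurable_fun [set: measurableTypeR R] G ->
  (forall x, 0 <= G x) ->
  (\int[mu]_x (G (x - t))%:E = \int[mu]_x (G x)%:E)%E.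
Proof.
move=> mG G0.
rewrite [RHS](eq_measure_integral (shifted t)); last first.
  by move=> A mA _; exact: lebesgue_measure_shift.
rewrite (ge0_integral_pushforward (shift_measurable t))//; first exact/measurable_EFinP.
by move=> x _; rewrite lee_fin.
Qed.

Lemma integrable_shift (t : R) (G : R -> R) : mu.-integrable [set: R] (EFin \o G) ->
  mu.-integrable [set: R] (EFin \o (fun x => G (x - t))).
Proof.
move=> iG; have mG : measurable_fun [set: measurableTypeR R] G by apply/measurable_EFinP; exact: measurable_int iG.
apply/integrableP; split.
  by apply/measurable_EFinP; apply: (measurableT_comp mG); exact: shift_measurable.
rewrite (@ge0_integral_shift t (fun x => `|G x|))//; last exact: measurableT_comp.
by have /integrableP[_] := iG.
Qed.

Lemma integral_shift (t : R) (G : R -> R) : mu.-integrable [set: R] (EFin \o G) ->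
  (\int[mu]_x (G (x - t))%:E = \int[mu]_x (G x)%:E)%E.
Proof.
move=> iG; rewrite [RHS](eq_measure_integral (shifted t)); last first.
  by move=> A mA _; exact: lebesgue_measure_shift.
rewrite (integral_pushforward (shift_measurable t))//.
  exact: measurable_int iG.
exact: integrable_shift.
Qed.

Lemma EFin_Rintegral (D : set (measurableTypeR R)) (h : R -> R) : measurable D ->
  mu.-integrable D (EFin \o h) -> (\int[mu]_(t in D) h t)%:E = (\int[mu]_(t in D) (h t)%:E)%E.
Proof. by move=> mD ih; rewrite /Rintegral fineK//; exact: integrable_fin_num. Qed.

(** Fubini's theorem and the invariance of the integral under translation. *)
Lemma convolution_integral (P Q : R -> R) :
  mu.-integrable [set: R] (EFin \o P) -> mu.-integrable [set: R] (EFin \o Q) ->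
  let F := fun z : measurableTypeR R * measurableTypeR R => P (z.1 - z.2) * Q z.2 in
  (mu \x mu)%E.-integrable setT (EFin \o F) /\
  (\int[(mu \x mu)%E]_z (F z)%:E = (\int[mu]_t P t * \int[mu]_t Q t)%:E)%E.
Proof.
move=> iP iQ F.
have mP : measurable_fun [set: measurableTypeR R] P by apply/measurable_EFinP; exact: measurable_int iP.
have mQ : measurable_fun [set: measurableTypeR R] Q by apply/measurable_EFinP; exact: measurable_int iQ.
have mF : measurable_fun setT (EFin \o F).
  apply/measurable_EFinP; apply: measurable_funM.
    apply: (measurableT_comp mP); apply: measurable_funB.
      exact: measurable_fst.
    exact: measurable_snd.
  apply: (measurableT_comp mQ); exact: measurable_snd.
have iF : (mu \x mu)%E.-integrable setT (EFin \o F).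
  apply/(integrable21ltyP _ _ mF).
  have /integrableP[_ fP] := iP; have /integrableP[_ fQ] := iQ.
  apply: (@le_lt_trans _ _ (\int[mu]_y ((\int[mu]_x (`|P x|)%:E) * (`|Q y|)%:E))%E).
    rewrite le_eqVlt; apply/orP; left; apply/eqP; apply: eq_integral => y _.
    rewrite -(@ge0_integral_shift y (fun x => `|P x|))//; last exact: measurableT_comp.
    rewrite -ge0_integralZr//.
    - by apply: eq_integral => x _; rewrite /F /= normrM EFinM.
    - by apply/measurable_EFinP; apply: measurableT_comp => //; apply: (measurableT_comp mP); exact: shift_measurable.
  rewrite ge0_integralZl//; first (by apply: lte_mul_pinfty => //; [exact: integral_ge0|rewrite ge0_fin_numE//; exact: integral_ge0]).
  - by apply/measurable_EFinP; exact: measurableT_comp.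
  - exact: integral_ge0.
split => //.
rewrite -integral21_prod_meas1//.
rewrite /fubini_G.
transitivity (\int[mu]_y ((\int[mu]_t P t) * Q y)%:E)%E.
  apply: eq_integral => y _; rewrite /F /=.
  under eq_integral do rewrite EFinM.
  rewrite integralZr//; last exact: integrable_shift.
  by rewrite integral_shift// -EFin_Rintegral// -EFinM.
under eq_integral do rewrite EFinM.
by rewrite integralZl// -EFin_Rintegral// -EFinM.
Qed.

(** The convolution over ]0, x[ of functions on ]0, +oo[ is the convolution over
    the line of their extensions by zero. *)
Lemma integrable_extension (h : R -> R) : mu.-integrable pos (EFin \o h) ->
  mu.-integrable [set: R] (EFin \o (h \_ pos)) /\
  (\int[mu]_t (h \_ pos) t) = \int[mu]_(t in pos) h t.
Proof.
move=> ih; split.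
  by rewrite -restrict_EFin; apply/integrable_restrict => //; rewrite setTI.
by rewrite [RHS]Rintegral_mkcond.
Qed.

(** Two products are treated together because the real and imaginary parts of a
    complex convolution are such sums, and only these sums are supposed
    integrable over ]0, x[.  The factor exp(- s x) is split as
    exp(- s (x - t)) exp(- s t). *)
Lemma laplace_convolution (p q p' q' g : R -> R) (c s : R) :
  laplace_integrable p s -> laplace_integrable q s ->
  laplace_integrable p' s -> laplace_integrable q' s ->
  (forall x : R, 0 < x ->
    mu.-integrable `]0, x[ (EFin \o (fun t => p (x - t) * q t + c * (p' (x - t) * q' t)))) ->
  (forall x : R, 0 < x -> g x = \int[mu]_(t in `]0, x[) (p (x - t) * q t + c * (p' (x - t) * q' t))) ->
  laplace_integrable g s /\
  laplace g s = laplace p s * laplace q s + c * (laplace p' s * laplace q' s).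
Proof.
move=> ip iq ip' iq' ig gE.
pose w (h : R -> R) := (fun t => expR (- (s * t)) * h t) \_ pos.
have wE h (x : R) : 0 < x -> w h x = expR (- (s * x)) * h x.
  by move=> x0; rewrite /w patchE mem_set//= in_itv/= x0.
have w0 h (x : R) : x <= 0 -> w h x = 0.
  by move=> x0; rewrite /w patchE memNset//= in_itv/= andbT; apply/negP; rewrite -leNgt.
have [jp ep] := integrable_extension ip; have [jq eq] := integrable_extension iq.
have [jp' ep'] := integrable_extension ip'; have [jq' eq'] := integrable_extension iq'.
have [iF eF] := convolution_integral jp jq.
have [iF' eF'] := convolution_integral jp' jq'.
rewrite ep eq in eF; rewrite ep' eq' in eF'.
clear ep eq ep' eq'.
pose F (z : measurableTypeR R * measurableTypeR R) : R :=
  w p (z.1 - z.2) * w q z.2 + c * (w p' (z.1 - z.2) * w q' z.2).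
have icF' := integrableZl measurableT c iF'.
have iS : (mu \x mu)%E.-integrable setT (EFin \o F).
  exact: (integrableD measurableT iF icF').
have eS : (\int[(mu \x mu)%E]_z (F z)%:E = (laplace p s * laplace q s + c * (laplace p' s * laplace q' s))%:E)%E.
  rewrite /F; under eq_integral do rewrite EFinD EFinM.
  rewrite (integralD measurableT iF icF').
  rewrite (integralZl measurableT iF') [RHS]EFinD [(c * _)%:E]EFinM.
  by congr (_ + _ * _)%E.
(* the inner integral over t is exp(- s x) g(x) for x > 0, and 0 otherwise *)
have key (x : R) : fubini_F mu (EFin \o F) x = ((fun x => expR (- (s * x)) * g x) \_ pos x)%:E.
  rewrite /fubini_F patchE; case: ifPn => [/set_mem/posP x0|]; last first.
    rewrite notin_setE /= in_itv/= andbT => /negP; rewrite -leNgt => x0.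
    rewrite (eq_integral (cst 0%E)) ?integral0// => t _; rewrite /F /=; congr EFin.
    have [t0|t0] := leP t 0; first by rewrite !(w0 _ _ t0) !mulr0 addr0.
    have xt : x - t <= 0 by rewrite subr_le0 (le_trans x0)// ltW.
    by rewrite !(w0 _ _ xt) !mul0r mulr0 addr0.
  rewrite gE// -RintegralZl//; last exact: ig.
  rewrite EFin_Rintegral//; last by apply: integrable_scale => //; exact: ig.
  rewrite [RHS]integral_mkcond; apply: eq_integral => t _.
  rewrite patchE /F /=.
  case: ifPn => [/set_mem /=|]; rewrite ?notin_setE /= in_itv/=.
    move=> /andP[t0 tx]; rewrite !wE ?subr_gt0//; congr EFin.
    have -> : expR (- (s * x)) = expR (- (s * (x - t))) * expR (- (s * t)).
      by rewrite -expRD; congr expR; ring.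
    by ring.
  move=> /negP; rewrite negb_and -!leNgt => /orP[t0|xt]; congr EFin.
    by rewrite !(w0 _ _ t0) !mulr0 addr0.
  by rewrite !(w0 _ (x - t)) ?subr_le0// !mul0r mulr0 addr0.
have iG := integrable_fubini_F iS.
have jG : mu.-integrable [set: R] (EFin \o ((fun x => expR (- (s * x)) * g x) \_ pos)).
  by apply: eq_integrable iG => // x _; rewrite key.
have jg : laplace_integrable g s.
  by rewrite -restrict_EFin in jG; have /integrable_restrict := jG; rewrite setTI; apply.
split => //; apply: EFin_inj; rewrite -eS -integral12_prod_meas1//.
rewrite EFin_Rintegral// integral_mkcond; apply: eq_integral => x _.
by rewrite key !patchE; case: ifP.
Qed.

Lemma claplace_convolution (K f g : R -> R[i]) (s : R) :
  claplace_integrable K s -> claplace_integrable f s ->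
  (forall x : R, 0 < x -> cintegrable `]0, x[ (fun t => K (x - t) * f t)) ->
  (forall x : R, 0 < x -> g x = cintegral `]0, x[ (fun t => K (x - t) * f t)) ->
  claplace_integrable g s /\ claplace g s = claplace K s * claplace f s.
Proof.
move=> [K1 K2] [f1 f2] ig gE.
have [|x x0|j1 e1] := @laplace_convolution _ _ _ _ (fun x => Re (g x)) (-1) s K1 f1 K2 f2.
- move=> x x0; have [h _] := ig x x0; apply: eq_integrable h => // t _ /=.
  by rewrite cReM mulN1r.
- rewrite gE//=; apply: eq_Rintegral => t _; by rewrite cReM mulN1r.
have [|x x0|j2 e2] := @laplace_convolution _ _ _ _ (fun x => Im (g x)) 1 s K1 f2 K2 f1.
- move=> x x0; have [_ h] := ig x x0; apply: eq_integrable h => // t _ /=.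
  by rewrite cImM mul1r.
- rewrite gE//=; apply: eq_Rintegral => t _; by rewrite cImM mul1r.
split; first by split.
by apply: complex_ext; rewrite /= ?cReM ?cImM/= ?e1 ?e2 ?mulN1r ?mul1r.
Qed.

End Convolution.

(** * Limits and iterated derivatives of complex-valued functions *)

Section RcomplexLimits.
Variable R : realType.
Implicit Types z w a : R[i].

(** The norm of [Rcomplex R] lies between the modulus of each component and the
    sum of these moduli. *)
Lemma Rcomplex_cvgP (T : Type) (F : set_system T) {FF : Filter F} (g : T -> Rcomplex R) (l : Rcomplex R) :
  (g @ F --> l) <-> ((fun x => Re (g x)) @ F --> Re l /\ (fun x => Im (g x)) @ F --> Im l).
Proof.
split=> [gl|[g1 g2]].
  split; apply/cvgrPdist_lt => e e0; move/cvgrPdist_lt : gl => /(_ e e0);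
  apply: filterS => x; apply: le_lt_trans.
    by have := Re_le_normc (l - g x); rewrite cReD cReN.
  by have := Im_le_normc (l - g x); rewrite cImD cImN.
apply/cvgrPdist_lt => e e0.
have e2 : 0 < e / 2 by rewrite divr_gt0.
move/cvgrPdist_lt : g1 => /(_ _ e2) h1; move/cvgrPdist_lt : g2 => /(_ _ e2) h2.
apply: filterS2 h1 h2 => x h1 h2.
apply: (@le_lt_trans _ _ (`|Re l - Re (g x)| + `|Im l - Im (g x)|)); last by lra.
by have := normc_le (l - g x); rewrite cReD cReN cImD cImN.
Qed.

Lemma Rcomplex_hausdorff : hausdorff_space (Rcomplex R).
Proof. exact: norm_hausdorff. Qed.

Lemma limn_cseries (u : nat -> R[i]) (l : R[i]) : cseries_cvg u l ->
  limn (series (u : nat -> Rcomplex R)) = l.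
Proof.
move=> [h1 h2]; apply: (cvg_lim Rcomplex_hausdorff); apply/Rcomplex_cvgP; split.
  by apply: cvg_trans h1; apply: near_eq_cvg; apply: nearW => n; rewrite /series/= Re_sum.
by apply: cvg_trans h2; apply: near_eq_cvg; apply: nearW => n; rewrite /series/= Im_sum.
Qed.

Lemma at0p_cvg (g : R -> R[i]) : has_at0p g ->
  Re (g t) @[t --> 0^'+] --> Re (at0p g) /\ Im (g t) @[t --> 0^'+] --> Im (at0p g).
Proof. by move=> hg; apply/Rcomplex_cvgP; exact: hg. Qed.

Lemma Rcomplex_is_derive (g : R -> Rcomplex R) (t : R) : derivable g t 1 ->
  is_cderive g t (derive1 g t).
Proof.
move=> dg; rewrite derive1E.
have [h1 h2] : (fun x => Re (x^-1 *: (g (x *: 1 + t) - g t))) @ 0^' --> Re ('D_1 g t) /\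
    (fun x => Im (x^-1 *: (g (x *: 1 + t) - g t))) @ 0^' --> Im ('D_1 g t).
  by apply/Rcomplex_cvgP; exact: dg.
have ReE : (fun x : R => Re (x^-1 *: (g (x *: 1 + t) - g t))) =
    (fun x => x^-1 *: (Re (g (x *: 1 + t)) - Re (g t))).
  by apply/funext => x; case: (g _) (g t) => [a b] [c e].
have ImE : (fun x : R => Im (x^-1 *: (g (x *: 1 + t) - g t))) =
    (fun x => x^-1 *: (Im (g (x *: 1 + t)) - Im (g t))).
  by apply/funext => x; case: (g _) (g t) => [a b] [c e].
rewrite ReE in h1; rewrite ImE in h2.
split; apply: DeriveDef.
- by apply/cvg_ex; eexists; exact: h1.
- exact: cvg_lim h1.
- by apply/cvg_ex; eexists; exact: h2.
- exact: cvg_lim h2.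
Qed.

Lemma Rcomplex_derive1n (g : R -> Rcomplex R) (m : nat) :
  (forall j (t : R), (j < m)%N -> 0 < t -> derivable (derive1n j g) t 1) ->
  forall j, (j <= m)%N -> forall t : R, 0 < t ->
    derive1n j (fun x => Re (g x)) t = Re (derive1n j g t) /\
    derive1n j (fun x => Im (g x)) t = Im (derive1n j g t).
Proof.
move=> dg; elim => [//|j IH] jm t t0.
have [d1 d2] := Rcomplex_is_derive (dg j t jm t0).
have {}IH := IH (ltnW jm); rewrite !derive1nS.
have near_pos : \forall x \near t, 0 < x by exact: lt_nbhsr.
split; rewrite derive1E; apply: derive_val.
  apply: near_eq_is_derive d1; apply: filterS near_pos => x /IH[]//.
apply: near_eq_is_derive d2; apply: filterS near_pos => x /IH[]//.
Qed.

Lemma Rcomplex_derivable1n (g : R -> Rcomplex R) (m : nat) :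
  (forall j (t : R), (j < m)%N -> 0 < t -> derivable (derive1n j g) t 1) ->
  forall j (t : R), (j < m)%N -> 0 < t ->
    derivable (derive1n j (fun x => Re (g x))) t 1 /\
    derivable (derive1n j (fun x => Im (g x))) t 1.
Proof.
move=> dg j t jm t0; have [[d1 _] [d2 _]] := Rcomplex_is_derive (dg j t jm t0).
have near_pos : \forall x \near t, 0 < x by exact: lt_nbhsr.
split; [apply: near_eq_derivable d1|apply: near_eq_derivable d2];
  by apply: filterS near_pos => x x0; have [] := Rcomplex_derive1n dg (ltnW jm) x0.
Qed.

End RcomplexLimits.

(** * The kernel of the k-Prabhakar integral *)

Section Kernel.
Variable R : realType.
Implicit Types z w : R[i].
Local Notation mu := (@lebesgue_measure R).
Notation pos := (`]0%R, +oo[%classic : set R).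

Lemma cpow_one z : cpow (1 : R)%:C z = 1.
Proof. by rewrite cpowE ?ln1 ?mulr0 ?cexp0//; exact: ltr01. Qed.

Lemma claplace_cpow (l : R[i]) (s : R) : 0 < Re l -> 0 < s ->
  claplace (fun t => cpow t%:C (l - 1)) s = cpow s%:C (- l) * cgamma l.
Proof.
move=> l0 s0; rewrite /cgamma !(claplace_cpow_k_gamma ltr01 l0)//.
by rewrite !mul1r cpow_one mul1r.
Qed.

Lemma cpow_real (x t : R) : 0 < t -> cpow t%:C x%:C = (rpow x t)%:C.
Proof.
move=> t0; rewrite cpowE// (_ : x%:C * _ = (x * ln t)%:C); last by rewrite rmorphM.
exact: cexpR.
Qed.

Lemma laplace_rpow (x s : R) : 0 < x -> 0 < s ->
  laplace (rpow (x - 1)) s = rpow (- x) s * rgamma x.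
Proof.
move=> x0 s0; have := @claplace_cpow x%:C s x0 s0; rewrite cgamma_real// => /(congr1 Re).
have -> : cpow s%:C (- x%:C) = (rpow (- x) s)%:C.
  by rewrite -cpow_real// rmorphN.
rewrite cReRM /= => <-; apply: eq_laplace => t t0.
have -> : x%:C - 1 = (x - 1)%:C :> R[i] by rewrite rmorphB.
by rewrite cpow_real.
Qed.

Variables (k : R) (alpha nu omega a : R[i]).
Hypotheses (k0 : 0 < k) (alpha0 : 0 < Re alpha) (nu0 : 0 < Re nu).

Definition kernel_exponent (n : nat) : R[i] := (alpha * n%:R + nu) / k%:C.

(** By [transfer_coefE], the n-th coefficient of the k-Mittag-Leffler series
    without its k-gamma factor. *)
Definition transfer_coef (n : nat) : R[i] := binomial_coef (a / k%:C) n * (omega * k%:C) ^+ n.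

Definition kernel_coef (n : nat) : R[i] := transfer_coef n / (k%:C * k_gamma k (k%:C * kernel_exponent n)).

(** The function K such that the integrand of the k-Prabhakar integral is
    K(x - t) f(t). *)
Definition kernel (t : R) : R[i] :=
  cpow t%:C (nu / k%:C - 1) / k%:C *
  k_mittag_leffler k alpha nu a (omega * cpow t%:C (alpha / k%:C)).

Lemma kC_neq0 : k%:C != 0 :> R[i]. Proof. by rewrite fmorph_eq0 gt_eqF. Qed.

Lemma transfer_coefE n : transfer_coef n = k_pochhammer k a n * (omega ^+ n / n`!%:R).
Proof.
have -> : k_pochhammer k a n = k%:C ^+ n * rising (a / k%:C) n.
  elim: n => [|n IH]; first by rewrite /k_pochhammer /rising !big_ord0 mulr1.
  rewrite /k_pochhammer big_ord_recr/= -/(k_pochhammer k a n) IH risingS exprS rmorphM/=.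
  by rewrite rmorph_nat; field; exact: kC_neq0.
by rewrite /transfer_coef /binomial_coef exprMn; ring.
Qed.

Lemma Re_kernel_exponent n : Re (kernel_exponent n) = (Re alpha * n%:R + Re nu) / k.
Proof. by rewrite /kernel_exponent mulrC -fmorphV/= cReRM cReD -(rmorph_nat (@real_complex R)) [alpha * _]mulrC cReRM; ring. Qed.

Lemma Im_kernel_exponent n : Im (kernel_exponent n) = (Im alpha * n%:R + Im nu) / k.
Proof. by rewrite /kernel_exponent mulrC -fmorphV/= cImRM cImD -(rmorph_nat (@real_complex R)) [alpha * _]mulrC cImRM; ring. Qed.

Lemma Re_kernel_exponent_gt0 n : 0 < Re (kernel_exponent n).
Proof. by rewrite Re_kernel_exponent divr_gt0// ltr_wpDl// mulr_ge0// ltW. Qed.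

Lemma kernel_coefE n : kernel_coef n = transfer_coef n * cpow k%:C (- kernel_exponent n) / cgamma (kernel_exponent n).
Proof.
have l0 := Re_kernel_exponent_gt0 n; rewrite /kernel_coef /cgamma (claplace_cpow_k_gamma k0 l0)// mulr1.
have c0 := cpow_neq0 (- kernel_exponent n) k0.
rewrite [k%:C * cpow _ _]mulrC -[cpow _ _ * _ * _]mulrA -[LHS]mulr1 -(divff c0).
by rewrite [in RHS]invfM; ring.
Qed.

Lemma claplace_kernel_term n (s : R) : 0 < s ->
  claplace_integrable (fun t => kernel_coef n * cpow t%:C (kernel_exponent n - 1)) s /\
  claplace (fun t => kernel_coef n * cpow t%:C (kernel_exponent n - 1)) s = transfer_coef n * cpow (k * s)%:C (- kernel_exponent n).
Proof.
move=> s0; have l0 := Re_kernel_exponent_gt0 n.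
have [i1 ->] := claplace_scale (kernel_coef n) (claplace_integrable_cpow l0 s0).
split => //; rewrite claplace_cpow// kernel_coefE cpowM//.
by field; exact: cgamma_neq0.
Qed.

(** A slope of a sector around the positive real axis that contains all the
    exponents: [Im_kernel_exponent_le]. *)
Definition aperture : R := `|Im alpha| / Re alpha + `|Im nu| / Re nu.

Lemma Im_kernel_exponent_le n : `|Im (kernel_exponent n)| <= aperture * Re (kernel_exponent n).
Proof.
rewrite Im_kernel_exponent Re_kernel_exponent normrM normfV (gtr0_norm k0) mulrA ler_wpM2r ?invr_ge0 ?(ltW k0)//.
apply: (le_trans (ler_normD _ _)).
have h1 : `|Im alpha * n%:R| = `|Im alpha| / Re alpha * (Re alpha * n%:R).
  by rewrite normrM normr_nat mulrA divfK// gt_eqF.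
have h2 : `|Im nu| = `|Im nu| / Re nu * Re nu by rewrite divfK// gt_eqF.
rewrite h1 [X in _ + X <= _]h2 /aperture.
have : 0 <= `|Im alpha| / Re alpha * Re nu by rewrite mulr_ge0 ?divr_ge0 ?(ltW alpha0) ?(ltW nu0).
have : 0 <= `|Im nu| / Re nu * (Re alpha * n%:R) by rewrite !mulr_ge0 ?invr_ge0 ?(ltW alpha0) ?(ltW nu0).
by move=> p1 p2; rewrite mulrDl !mulrDr -addrA lerD2l addrCA ler_wpDl// ler_wpDl.
Qed.

Let b2 := aperture ^+ 2 / 2.
(** The terms of [kernel_term_bound] are those of a binomial series at
    [ratio s], which tends to 0 at +oo. *)
Let ratio (s : R) : R := normc (omega * k%:C) * expR (- (Re alpha / k * (ln (k * s) - b2))).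
Let amp (s : R) : R := 2 * expR b2 * expR (- (Re nu / k * (ln (k * s) - b2))).

(** By [rgamma_le_cgamma] and the sector condition, the Gamma quotient is at most
    2 exp(b2 + b2 Re l_n).  The exponential factor is absorbed by replacing
    ln (k s) with ln (k s) - b2. *)
Lemma kernel_term_bound n (s : R) : 0 < s ->
  normc (kernel_coef n) * laplace (rpow (Re (kernel_exponent n) - 1)) s <=
  amp s * (binomial_coef (normc (a / k%:C)) n * ratio s ^+ n).
Proof.
move=> s0; have l0 := Re_kernel_exponent_gt0 n; set x := Re (kernel_exponent n) in l0 *.
have g0 : 0 < normc (cgamma (kernel_exponent n)) by rewrite lt_neqAle eq_sym normc_eq0 cgamma_neq0// normc_ge0.
have x2 : Im (kernel_exponent n) ^+ 2 <= aperture ^+ 2 * x ^+ 2.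
  rewrite -exprMn -real_normK ?num_real//; apply: lerXn2r; rewrite ?nnegrE ?normr_ge0//; last exact: Im_kernel_exponent_le.
  exact: le_trans (Im_kernel_exponent_le n).
have h : rgamma x <= 2 * expR (b2 + b2 * x) * normc (cgamma (kernel_exponent n)).
  have := @rgamma_le_cgamma R x (Im (kernel_exponent n)) l0; rewrite (_ : x +i* Im (kernel_exponent n) = kernel_exponent n); last by apply: complex_ext.
  move=> h; apply: (le_trans h); rewrite ler_wpM2r ?normc_ge0// ler_wpM2l// ler_expR.
  rewrite /b2 -mulrA [2^-1 * x]mulrC mulrA -mulrDl ler_wpM2r//; apply: lerD.
    by rewrite ler_pdivrMr ?exprn_gt0.
  by rewrite ler_pdivrMr// -mulrA -expr2.
rewrite laplace_rpow// kernel_coefE normcM [normc (transfer_coef n * _)]normcM normcV normc_cpow_rpow// cReN.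
apply: (@le_trans _ _ (normc (transfer_coef n) * rpow (- x) k * rpow (- x) s * (2 * expR (b2 + b2 * x)))).
  set X := normc (transfer_coef n) * rpow (- x) k * rpow (- x) s.
  have X0 : 0 <= X by rewrite /X !mulr_ge0 ?normc_ge0 ?(ltW (rpow_gt0 _ _)).
  rewrite -/x (_ : _ * _ = X * (rgamma x / normc (cgamma (kernel_exponent n)))); last by rewrite /X; ring.
  by rewrite ler_wpM2l// ler_pdivrMr.
have -> : normc (transfer_coef n) = normc (binomial_coef (a / k%:C) n) * normc (omega * k%:C) ^+ n.
  by rewrite /transfer_coef [LHS]normcM normcX.
have := normc_binomial_coef_le (a / k%:C) n.
set B := normc (binomial_coef _ _); set B' := binomial_coef _ n => BB.
rewrite (_ : amp s * _ = B' * (normc (omega * k%:C) ^+ n * (rpow (- x) k * (rpow (- x) s * (2 * expR (b2 + b2 * x)))))).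
  set Y := _ ^+ n * (_ * _); rewrite (_ : _ * _ = B * Y); last by rewrite /Y; ring.
  by rewrite ler_wpM2r// /Y !mulr_ge0 ?exprn_ge0 ?normc_ge0 ?expR_ge0 ?(ltW (rpow_gt0 _ _)).
have E : expR (- (Re nu / k * (ln (k * s) - b2))) * expR (- (Re alpha / k * (ln (k * s) - b2))) ^+ n =
    rpow (- x) k * rpow (- x) s * expR (b2 * x).
  rewrite -expRM_natl /rpow -!expRD /x Re_kernel_exponent lnM ?posrE//; congr expR.
  by field; rewrite gt_eqF.
rewrite /amp /ratio exprMn expRD.
transitivity (2 * expR b2 * B' * normc (omega * k%:C) ^+ n *
  (expR (- (Re nu / k * (ln (k * s) - b2))) * expR (- (Re alpha / k * (ln (k * s) - b2))) ^+ n)); first by ring.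
by rewrite E; ring.
Qed.

Lemma ratio_lt1 : exists2 S : R, 0 < S & forall s, S <= s -> 0 <= ratio s < 1.
Proof.
pose N := normc (omega * k%:C).
have N0 : 0 <= N by exact: normc_ge0.
have N1 : 0 < N + 1 by rewrite ltr_wpDl.
have ka : 0 < Re alpha / k by rewrite divr_gt0.
(* at this point the exponential factor of ratio is 1 / (N + 1) *)
pose S := expR (b2 + ln (N + 1) / (Re alpha / k)) / k.
have S0 : 0 < S by rewrite divr_gt0// expR_gt0.
exists S => // s Ss; have s0 : 0 < s by exact: lt_le_trans Ss.
rewrite /ratio -/N mulr_ge0 ?expR_ge0//=.
apply: (@le_lt_trans _ _ (N * (N + 1)^-1)); last by rewrite ltr_pdivrMr// mul1r ltrDl.
rewrite ler_wpM2l// -[leRHS]lnK ?posrE ?invr_gt0// ler_expR lnV ?posrE//.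
rewrite lerN2 mulrC -ler_pdivrMr// lerBrDl -[leLHS]expRK ler_ln ?posrE ?expR_gt0 ?mulr_gt0//.
by rewrite -ler_pdivrMl// mulrC.
Qed.

Lemma kernel_series_summable : exists2 S : R, 0 < S & forall s, S <= s ->
  abs_summable (fun n => normc (kernel_coef n) * laplace (rpow (Re (kernel_exponent n) - 1)) s).
Proof.
have [S S0 hS] := ratio_lt1; exists S => // s Ss; have s0 := lt_le_trans S0 Ss.
have := abs_summable_binomial (normc_ge0 (a / k%:C)) (hS s Ss).
move=> /(abs_summable_scale (amp s)); apply: abs_summable_le => n.
have h := kernel_term_bound n s0; rewrite ger0_norm ?(le_trans h) ?ler_norm//.
by rewrite mulr_ge0 ?normc_ge0// laplace_rpow ?Re_kernel_exponent_gt0// mulr_ge0 ?(ltW (rpow_gt0 _ _)) ?(ltW (rgamma_gt0 _)) ?Re_kernel_exponent_gt0.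
Qed.

Lemma kernel_csummable (t : R) : 0 < t -> csummable (fun n => kernel_coef n * cpow t%:C (kernel_exponent n - 1)).
Proof.
move=> t0; have [S S0 hS] := kernel_series_summable.
have := abs_summable_scale (2 * expR (2 * S * t) / t) (hS S (lexx S)).
apply: abs_summable_le => n; have l0 := Re_kernel_exponent_gt0 n.
rewrite ger0_norm ?normc_ge0// (le_trans _ (ler_norm _))// normcM normc_cpow_rpow//.
have -> : Re (kernel_exponent n - 1) = Re (kernel_exponent n) - 1 by rewrite cReD cReN.
rewrite mulrCA ler_wpM2l ?normc_ge0// rpowB1//.
have := laplace_rpow_ge l0 S0 t0.
have e0 : 0 < 2 * expR (2 * S * t) / t by rewrite divr_gt0// mulr_gt0// expR_gt0.
move=> /(ler_wpM2l (ltW e0)); apply: le_trans.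
rewrite expRN le_eqVlt; apply/orP; left; apply/eqP; field.
by rewrite gt_eqF ?expR_gt0// gt_eqF.
Qed.

Lemma kernel_cseries (t : R) : 0 < t ->
  cseries_cvg (fun n => kernel_coef n * cpow t%:C (kernel_exponent n - 1)) (kernel t).
Proof.
move=> t0; have [l hl] := csummable_cvg (kernel_csummable t0).
set c := cpow t%:C (nu / k%:C - 1) / k%:C.
have c0 : c != 0 by rewrite mulf_neq0 ?invr_eq0 ?kC_neq0// cpow_neq0.
have E n : k_mittag_leffler_term k alpha nu a (omega * cpow t%:C (alpha / k%:C)) n =
    c^-1 * (kernel_coef n * cpow t%:C (kernel_exponent n - 1)).
  have -> : kernel_exponent n - 1 = (nu / k%:C - 1) + alpha / k%:C * n%:R by rewrite /kernel_exponent; ring.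
  rewrite cpowD// cpow_nat// /kernel_coef transfer_coefE /k_mittag_leffler_term exprMn.
  have -> : alpha * n%:R + nu = k%:C * kernel_exponent n by rewrite /kernel_exponent [RHS]mulrC divfK// kC_neq0.
  rewrite /c [k%:C * k_gamma _ _]mulrC !invfM invrK.
  have p0 := cpow_neq0 (nu / k%:C - 1) t0; have q0 := kC_neq0.
  set g := (k_gamma _ _)^-1; field.
  by apply/and3P; split => //; rewrite pnatr_eq0 -lt0n fact_gt0.
suff -> : kernel t = l by [].
rewrite /kernel -/c /k_mittag_leffler (limn_cseries (l := c^-1 * l)).
  by rewrite mulrA divff// mul1r.
by apply: cseries_cvg_eq (cseries_cvg_scale c^-1 hl) => n; rewrite E.
Qed.

Lemma kernel_laplace : exists2 S : R, 0 < S & forall s, S <= s ->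
  claplace_integrable kernel s /\
  cseries_cvg (fun n => transfer_coef n * cpow (k * s)%:C (- kernel_exponent n)) (claplace kernel s).
Proof.
have [S S0 hS] := kernel_series_summable; exists S => // s Ss.
have s0 := lt_le_trans S0 Ss.
have it n := (claplace_kernel_term n s0).1.
have bnd (p : R[i] -> R) : (forall z, `|p z| <= normc z) ->
  (forall n, laplace_integrable (fun t => p (kernel_coef n * cpow t%:C (kernel_exponent n - 1))) s) ->
  (\sum_(n <oo) \int[mu]_(t in pos) (`|(expR (- (s * t)) * p (kernel_coef n * cpow t%:C (kernel_exponent n - 1)))|)%:E < +oo)%E.
  move=> hp ip; apply: le_lt_trans (hS s Ss); apply: lee_nneseries => [n _ _|n _].
    by apply: integral_ge0 => t _; rewrite lee_fin.
  have l0 := Re_kernel_exponent_gt0 n; have ir := laplace_integrable_rpow l0 s0.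
  rewrite ger0_norm; last first.
    by rewrite mulr_ge0 ?normc_ge0// laplace_rpow// mulr_ge0 ?(ltW (rpow_gt0 _ _)) ?(ltW (rgamma_gt0 _)).
  rewrite /laplace -RintegralZl// EFin_Rintegral//; last exact: integrable_scale.
  apply: ge0_le_integral => //.
  - apply/measurable_EFinP; apply: measurableT_comp => //.
    by apply/measurable_EFinP; exact: measurable_int (ip n).
  - by apply: measurable_int; apply: (integrable_scale (normc (kernel_coef n))) ir.
  move=> t /posP t0; rewrite lee_fin normrM (ger0_norm (expR_ge0 _)) mulrCA ler_wpM2l ?expR_ge0//.
  by apply: (le_trans (hp _)); rewrite normcM normc_cpow_rpow// cReD cReN.
have swap (p : R[i] -> R) : (forall z, `|p z| <= normc z) ->
  (forall n, laplace_integrable (fun t => p (kernel_coef n * cpow t%:C (kernel_exponent n - 1))) s) ->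
  (forall t : R, 0 < t -> series (fun n => p (kernel_coef n * cpow t%:C (kernel_exponent n - 1))) @ \oo --> p (kernel t)) ->
  laplace_integrable (fun t => p (kernel t)) s /\
  series (fun n => laplace (fun t => p (kernel_coef n * cpow t%:C (kernel_exponent n - 1))) s) @ \oo --> laplace (fun t => p (kernel t)) s.
  move=> hp ip cp.
  have mt n : measurable_fun pos (fun t => expR (- (s * t)) * p (kernel_coef n * cpow t%:C (kernel_exponent n - 1))).
    by apply/measurable_EFinP; exact: measurable_int (ip n).
  have [|] := @integral_series_swap R _ (measurableTypeR R) mu pos (measurable_itv _)
    (fun n t => expR (- (s * t)) * p (kernel_coef n * cpow t%:C (kernel_exponent n - 1)))
    (fun t => expR (- (s * t)) * p (kernel t)) mt (bnd p hp ip); last by [].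
  by move=> t /posP t0; apply: cvg_series_scale; exact: cp.
have [|||j1 e1] := swap Re; [exact: Re_le_normc|by move=> n; have [] := it n|by move=> t /kernel_cseries[]|].
have [|||j2 e2] := swap Im; [exact: Im_le_normc|by move=> n; have [] := it n|by move=> t /kernel_cseries[]|].
split; first by split.
split.
  apply: cvg_trans e1; apply: near_eq_cvg; apply: nearW => n; apply: eq_bigr => i _.
  by rewrite -(claplace_kernel_term i s0).2.
apply: cvg_trans e2; apply: near_eq_cvg; apply: nearW => n; apply: eq_bigr => i _.
by rewrite -(claplace_kernel_term i s0).2.
Qed.

End Kernel.

(** * Analytic continuation of the transform of the k-Prabhakar integral *)

Section Continuation.
Variable R : realType.
Implicit Types z w : R[i].
Local Notation mu := (@lebesgue_measure R).
Notation pos := (`]0%R, +oo[%classic : set R).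

Lemma binomial_series_real (A q : R) : 0 <= q < 1 ->
  series (fun n => binomial_coef A n * q ^+ n) @ \oo --> expR (- (A * ln (1 - q))).
Proof.
move=> /andP[q0 q1].
have q1' : 0 < 1 - q by rewrite subr_gt0.
have [|h _] := @binomial_series R A%:C q%:C.
  by rewrite normcR ger0_norm.
have -> : expR (- (A * ln (1 - q))) = Re (cpow (1 - q%:C) (- A%:C)).
  have -> : 1 - q%:C = (1 - q)%:C :> R[i] by rewrite rmorphB.
  by rewrite -rmorphN cpow_real// /= /rpow mulNr.
apply: cvg_trans h; apply: near_eq_cvg; apply: nearW => n; apply: eq_bigr => i _.
have -> : binomial_coef A%:C i = (binomial_coef A i)%:C :> R[i].
  rewrite /binomial_coef rmorphM/= fmorphV/= rmorph_nat; congr (_ / _).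
  by rewrite /rising rmorph_prod; apply: eq_bigr => j _; rewrite rmorphD/= rmorph_nat.
by rewrite -rmorphXn cReRM.
Qed.

Lemma nneseries_fin (u : nat -> R) (l : R) : (forall n, 0 <= u n) -> series u @ \oo --> l ->
  (\sum_(n <oo) (u n)%:E)%E = l%:E.
Proof.
move=> u0 ul; have -> : l = limn (series u) by apply/esym/cvg_lim.
rewrite -EFin_lim; last by apply/cvg_ex; exists l.
by congr (limn _); apply/funext => n /=; rewrite sumEFin.
Qed.

Variables (k : R) (alpha nu omega a : R[i]).
Hypotheses (k0 : 0 < k) (alpha0 : 0 < Re alpha) (nu0 : 0 < Re nu).

Local Notation lam := (kernel_exponent k alpha nu).
Local Notation coef := (transfer_coef k omega a).

Definition transfer_arg (s : R) : R[i] := omega * k%:C * cpow (k * s)%:C (- (alpha / k%:C)).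

(** The sum of the transforms of the terms of the kernel. *)
Definition transfer (s : R) : R[i] :=
  cpow (k * s)%:C (- (nu / k%:C)) * cpow (1 - transfer_arg s) (- (a / k%:C)).

Lemma transfer_term (s : R) n : 0 < s -> coef n * cpow (k * s)%:C (- lam n) =
  cpow (k * s)%:C (- (nu / k%:C)) * (binomial_coef (a / k%:C) n * transfer_arg s ^+ n).
Proof.
move=> s0; have ks : 0 < k * s by rewrite mulr_gt0.
have -> : - lam n = - (nu / k%:C) + - (alpha / k%:C) * n%:R by rewrite /kernel_exponent; ring.
by rewrite cpowD// cpow_nat// /transfer_arg /transfer_coef !exprMn; ring.
Qed.

Lemma transfer_series (s : R) : 0 < s -> normc (transfer_arg s) < 1 ->
  cseries_cvg (fun n => coef n * cpow (k * s)%:C (- lam n)) (transfer s).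
Proof.
move=> s0 z1; have := cseries_cvg_scale (cpow (k * s)%:C (- (nu / k%:C))) (@binomial_series R (a / k%:C) _ z1).
by apply: cseries_cvg_eq => n; rewrite transfer_term.
Qed.

Lemma transfer_arg_le (s t : R) : 0 < s -> s <= t ->
  normc (transfer_arg t) <= normc (transfer_arg s).
Proof.
move=> s0 st; have t0 := lt_le_trans s0 st.
rewrite /transfer_arg !(normcM (omega * k%:C)) ler_wpM2l ?normc_ge0//.
rewrite !normc_cpow_rpow ?mulr_gt0// cReN mulrC -fmorphV/= cReRM /rpow ler_expR !mulNr lerN2.
rewrite ler_wpM2l ?mulr_ge0 ?invr_ge0 ?(ltW k0) ?(ltW alpha0)//.
by rewrite ler_ln ?posrE ?mulr_gt0// ler_pM2l.
Qed.

Lemma normc_kernel_exponent_le n : normc (lam n) <= normc (alpha / k%:C) * n%:R + normc (nu / k%:C).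
Proof.
have -> : lam n = alpha / k%:C * n%:R + nu / k%:C by rewrite /kernel_exponent; ring.
by rewrite (le_trans (le_normcD _ _))// normcM normc_nat.
Qed.

(** Expanding (k (s + x))^(- l_n) = (k s)^(- l_n) (1 + x / s)^(- l_n) in powers
    of x, the inner sum of absolute values is at most
    |c_n (k s)^(- l_n)| (1 - rho)^(- |l_n|) with rho = r / s.  As |l_n| grows
    linearly with n, this is at most a constant times the n-th term of a
    binomial series at |transfer_arg s| exp(c d), where exp(- d) = 1 - rho, and
    c d is made small enough for this argument to be less than 1. *)
Lemma transfer_double_series (s : R) : 0 < s -> normc (transfer_arg s) < 1 ->
  exists2 r : R, 0 < r < s & forall x : R, `|x| <= r ->
    (\sum_(n <oo) \sum_(j <oo) (normc (coef n * cpow (k * s)%:C (- lam n) * (binomial_coef (lam n) j * (- (x / s))%:C ^+ j)))%:E < +oo)%E.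
Proof.
move=> s0 z1; set Z := normc (transfer_arg s) in z1.
have Z0 : 0 <= Z by exact: normc_ge0.
pose c := normc (alpha / k%:C); have c0 : 0 <= c by exact: normc_ge0.
pose q := (Z + 1) / 2; have q0 : 0 < q by rewrite /q; lra.
have q1 : q < 1 by rewrite /q; lra.
have Zq : Z < q by rewrite /q; lra.
have lnq : ln q < 0 by apply: ln_lt0; rewrite q0.
(* then exp(c d) <= 1 / q with Z < q < 1 *)
pose d := - ln q / (c + 1); have d0 : 0 < d by rewrite divr_gt0// ?oppr_gt0// ltr_wpDl.
pose rho := 1 - expR (- d).
have rho0 : 0 < rho by rewrite subr_gt0 -expR0 ltr_expR oppr_lt0.
have rho1 : rho < 1 by rewrite ltrBlDr ltrDl expR_gt0.
have lnrho : ln (1 - rho) = - d by rewrite /rho opprB addrC subrK expRK.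
exists (rho * s); first by rewrite mulr_gt0//= gtr_pMl.
move=> x xr; have xrho : `|- (x / s)| <= rho.
  by rewrite normrN normrM normfV (gtr0_norm s0) ler_pdivrMr.
pose b n := normc (coef n * cpow (k * s)%:C (- lam n)).
have inner n : (\sum_(j <oo) (normc (coef n * cpow (k * s)%:C (- lam n) * (binomial_coef (lam n) j * (- (x / s))%:C ^+ j)))%:E
   <= (b n * expR (normc (lam n) * d))%:E)%E.
  have rr : 0 <= rho < 1 by rewrite (ltW rho0).
  have h := @binomial_series_real (normc (lam n)) _ rr.
  have := @nneseries_fin (fun j => b n * (binomial_coef (normc (lam n)) j * rho ^+ j)) _ _ (@cvg_series_scale R _ (b n) _ h).
  rewrite lnrho mulrN opprK => <-; last first.
    move=> j; apply: mulr_ge0; first exact: normc_ge0.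
    by apply: mulr_ge0; [apply: binomial_coef_ge0; exact: normc_ge0|rewrite exprn_ge0 ?(ltW rho0)].
  apply: lee_nneseries => [j _ _|j _]; first by rewrite lee_fin normc_ge0.
  rewrite lee_fin normcM ler_wpM2l ?normc_ge0// [leLHS]normcM normcX normcR.
  apply: ler_pM; rewrite ?normc_ge0 ?exprn_ge0 ?normc_binomial_coef_le//.
  by rewrite lerXn2r ?nnegrE ?normr_ge0 ?(ltW rho0).
have Zd : Z * expR (c * d) < 1.
  have : c * d <= - ln q.
    by rewrite /d mulrCA ler_piMr// ?oppr_ge0 ?(ltW lnq)// ler_pdivrMr ?mul1r ?lerDl// ltr_wpDl.
  rewrite -ler_expR expRN lnK ?posrE// => /(ler_wpM2l Z0) h; apply: (le_lt_trans h).
  by rewrite ltr_pdivrMr// mul1r.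
have := abs_summable_binomial (normc_ge0 (a / k%:C)) (q := Z * expR (c * d)) _.
rewrite mulr_ge0 ?expR_ge0// Zd => /(_ isT).
move=> /(abs_summable_scale (normc (cpow (k * s)%:C (- (nu / k%:C))) * expR (normc (nu / k%:C) * d))).
apply: le_lt_trans; apply: lee_nneseries => [n _ _|n _].
  by apply: nneseries_ge0 => j _ _; rewrite lee_fin normc_ge0.
apply: (le_trans (inner n)); rewrite lee_fin; apply: le_trans (ler_norm _).
rewrite /b transfer_term// normcM [normc (binomial_coef _ _ * _)]normcM normcX -/Z exprMn -expRM_natl.
have h1 : expR (normc (lam n) * d) <= expR (normc (nu / k%:C) * d) * expR (n%:R * (c * d)).
  rewrite -expRD ler_expR; have := ler_wpM2r (ltW d0) (normc_kernel_exponent_le n); rewrite -/c.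
  by move=> h; apply: (le_trans h); rewrite le_eqVlt; apply/orP; left; apply/eqP; ring.
have h2 := normc_binomial_coef_le (a / k%:C) n.
set N := normc (cpow _ _).
set B := normc (binomial_coef _ n) in h2 *; set B' := binomial_coef (normc _) n in h2 *.
have N0 : 0 <= N by exact: normc_ge0. have B0 : 0 <= B by exact: normc_ge0.
rewrite (_ : N * expR (normc (nu / k%:C) * d) * _ = (N * (B' * Z ^+ n)) * (expR (normc (nu / k%:C) * d) * expR (n%:R * (c * d)))); last by ring.
apply: ler_pM => //; rewrite ?mulr_ge0 ?exprn_ge0 ?expR_ge0//.
by rewrite ler_wpM2l// ler_wpM2r// exprn_ge0.
Qed.

(** A germ at s only requires the condition |transfer_arg| < 1 near s; it holds
    on [s0, +oo[ since |transfer_arg| decreases. *)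
Lemma germ_transfer (s0 s : R) : 0 < s0 -> normc (transfer_arg s0) < 1 -> s0 < s ->
  germ (fun t => Re (transfer t)) s /\ germ (fun t => Im (transfer t)) s.
Proof.
move=> s00 z0 s0s; have sp := lt_trans s00 s0s.
have z1 : normc (transfer_arg s) < 1 by apply: le_lt_trans z0; apply: transfer_arg_le => //; exact: ltW.
have [r' /andP[r'0 r's] hr'] := transfer_double_series sp z1.
pose r := Num.min r' (s - s0).
have r0 : 0 < r by rewrite lt_min r'0 subr_gt0.
have rr' : `|r| <= r' by rewrite gtr0_norm// ge_min lexx.
have rs0 : r <= s - s0 by rewrite ge_min lexx orbT.
have sn0 : s != 0 by rewrite gt_eqF.
have pos_sx (x : R) : `|x| <= r -> s0 <= s + x by rewrite ler_norml => /andP[]; lra.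
pose A n j : R[i] := coef n * cpow (k * s)%:C (- lam n) * (binomial_coef (lam n) j * (- s^-1)%:C ^+ j).
have AE n j (x : R) : (x ^+ j)%:C * A n j =
    coef n * cpow (k * s)%:C (- lam n) * (binomial_coef (lam n) j * (- (x / s))%:C ^+ j).
  have -> : (- (x / s))%:C = x%:C * (- s^-1)%:C :> R[i] by rewrite -rmorphM; congr (_%:C); rewrite mulrN.
  by rewrite exprMn rmorphXn /A; ring.
have inner n (x : R) : `|x| <= r -> cseries_cvg (fun j => (x ^+ j)%:C * A n j) (coef n * cpow (k * (s + x))%:C (- lam n)).
  move=> xr; have sx := lt_le_trans s00 (pos_sx x xr).
  have zx : normc (- (x / s))%:C < 1.
    rewrite normcR normrN normrM normfV (gtr0_norm sp) ltr_pdivrMr// mul1r.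
    by apply: (le_lt_trans xr); apply: (le_lt_trans rs0); lra.
  have := cseries_cvg_scale (coef n * cpow (k * s)%:C (- lam n)) (@binomial_series R (lam n) _ zx).
  have xs0 : 0 < 1 + x / s by rewrite (_ : _ + _ = (s + x) / s) ?divr_gt0//; field.
  have -> : cpow (k * (s + x))%:C (- lam n) = cpow (k * s)%:C (- lam n) * cpow (1 + x / s)%:C (- lam n).
    by rewrite -cpowM ?mulr_gt0//; congr (cpow (_%:C) _); field.
  have -> : 1 - (- (x / s))%:C = (1 + x / s)%:C :> R[i] by rewrite rmorphN opprK rmorphD.
  by rewrite mulrA; apply: cseries_cvg_eq => j; rewrite AE.
have outer (x : R) : `|x| <= r ->
    cseries_cvg (fun n => coef n * cpow (k * (s + x))%:C (- lam n)) (transfer (s + x)).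
  move=> xr; have sx := pos_sx x xr; apply: transfer_series; first exact: lt_le_trans sx.
  by apply: le_lt_trans z0; exact: transfer_arg_le.
have abs (p : R[i] -> R) : (forall z, `|p z| <= normc z) -> (forall (x : R) z, p (x%:C * z) = x * p z) ->
    (\sum_(n <oo) \sum_(j <oo) (`|p (A n j) * r ^+ j|)%:E < +oo)%E.
  move=> hp ph; apply: le_lt_trans (hr' r rr'); apply: lee_nneseries => [n _ _|n _].
    by apply: nneseries_ge0.
  apply: lee_nneseries => // j _; rewrite lee_fin -AE mulrC -ph; exact: hp.
split.
- apply: (germ_series (A := fun n j => Re (A n j)) (p := fun n x => Re (coef n * cpow (k * (s + x))%:C (- lam n))) r0).
  + by apply: abs; [exact: Re_le_normc|exact: cReRM].
  + move=> n x xr; have [h _] := inner n x xr; apply: cvg_trans h; apply: near_eq_cvg; apply: nearW => N.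
    by apply: eq_bigr => j _; rewrite cReRM mulrC.
  + by move=> x xr; have [h _] := outer x xr.
- apply: (germ_series (A := fun n j => Im (A n j)) (p := fun n x => Im (coef n * cpow (k * (s + x))%:C (- lam n))) r0).
  + by apply: abs; [exact: Im_le_normc|exact: cImRM].
  + move=> n x xr; have [_ h] := inner n x xr; apply: cvg_trans h; apply: near_eq_cvg; apply: nearW => N.
    by apply: eq_bigr => j _; rewrite cImRM mulrC.
  + by move=> x xr; have [_ h] := outer x xr.
Qed.

Lemma germ_sub (phi psi : R -> R) (s : R) : germ phi s -> germ psi s ->
  germ (fun t => phi t - psi t) s.
Proof.
move=> h1 h2; apply: (germ_eq (e := 1) _ _ (germ_add h1 (germ_scale (-1) h2))) => // x _.
by rewrite mulN1r.
Qed.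

(** The identity holds for large s by termwise integration, and its two sides
    are real-analytic on ]s0, +oo[.  It is split into real and imaginary parts,
    for which [germ_identity] is stated. *)
Lemma prabhakar_laplace (f g : R -> R[i]) (s0 : R) :
  0 < s0 -> normc (transfer_arg s0) < 1 ->
  (forall s, s0 < s -> claplace_integrable f s) ->
  (forall s, s0 < s -> claplace_integrable g s) ->
  (forall x : R, 0 < x -> cintegrable `]0, x[ (fun t => kernel k alpha nu omega a (x - t) * f t)) ->
  (forall x : R, 0 < x -> g x = cintegral `]0, x[ (fun t => kernel k alpha nu omega a (x - t) * f t)) ->
  forall s, s0 < s -> claplace g s = transfer s * claplace f s.
Proof.
move=> s00 z0 jf jg iK gE.
have [S S0 hS] := kernel_laplace omega a k0 alpha0 nu0.
have large s : Num.max S (s0 + 1) <= s -> claplace g s = transfer s * claplace f s.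
  rewrite ge_max => /andP[Ss s1]; have s0s : s0 < s by apply: lt_le_trans s1; rewrite ltrDl.
  have sp := lt_trans s00 s0s.
  have [iKs cK] := hS s Ss.
  have [_ ->] := claplace_convolution iKs (jf s s0s) iK gE; congr (_ * _).
  apply: cseries_cvg_unique cK _; apply: transfer_series => //.
  by apply: le_lt_trans z0; apply: transfer_arg_le => //; exact: ltW.
have gf1 : forall s, s0 < s -> germ (laplace (fun t => Re (f t))) s by apply: germ_laplace => s /jf[].
have gf2 : forall s, s0 < s -> germ (laplace (fun t => Im (f t))) s by apply: germ_laplace => s /jf[].
have gg1 : forall s, s0 < s -> germ (laplace (fun t => Re (g t))) s by apply: germ_laplace => s /jg[].
have gg2 : forall s, s0 < s -> germ (laplace (fun t => Im (g t))) s by apply: germ_laplace => s /jg[].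
pose D1 s := laplace (fun t => Re (g t)) s -
  (Re (transfer s) * laplace (fun t => Re (f t)) s - Im (transfer s) * laplace (fun t => Im (f t)) s).
pose D2 s := laplace (fun t => Im (g t)) s -
  (Re (transfer s) * laplace (fun t => Im (f t)) s + Im (transfer s) * laplace (fun t => Re (f t)) s).
have D1E s : D1 s = Re (claplace g s) - Re (transfer s * claplace f s) by rewrite cReM.
have D2E s : D2 s = Im (claplace g s) - Im (transfer s * claplace f s) by rewrite cImM.
have z1 : forall s, s0 < s -> D1 s = 0.
  apply: (@germ_identity _ _ _ (Num.max S (s0 + 1))); last by move=> s /large h; rewrite D1E h subrr.
  move=> s s0s; have [h1 h2] := germ_transfer s00 z0 s0s.
  apply: germ_sub; first exact: gg1.
  by apply: germ_sub; apply: germ_mul => //; [exact: gf1|exact: gf2].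
have z2 : forall s, s0 < s -> D2 s = 0.
  apply: (@germ_identity _ _ _ (Num.max S (s0 + 1))); last by move=> s /large h; rewrite D2E h subrr.
  move=> s s0s; have [h1 h2] := germ_transfer s00 z0 s0s.
  apply: germ_sub; first exact: gg2.
  by apply: germ_add; apply: germ_mul => //; [exact: gf2|exact: gf1].
move=> s s0s; apply: complex_ext.
  by apply/eqP; rewrite -subr_eq0 -D1E z1.
by apply/eqP; rewrite -subr_eq0 -D2E z2.
Qed.

End Continuation.

(** * From the Laplace to the Sumudu transform *)

Section Assembly.
Variable R : realType.
Implicit Types z w : R[i].
Local Notation mu := (@lebesgue_measure R).
Notation pos := (`]0%R, +oo[%classic : set R).

Lemma laplace_cvg_addr_harmonic (h : R -> R) (s0 : R) : laplace_integrable h s0 ->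
  laplace h (s0 + n.+1%:R^-1) @[n --> \oo] --> laplace h s0.
Proof.
move=> ih; have s0n n : s0 <= s0 + n.+1%:R^-1 by rewrite lerDl invr_ge0.
have jh n := laplace_integrable_le (s0n n) ih.
have [|||||_ _] := @dominated_convergence _ (measurableTypeR R) R mu pos (measurable_itv _)
  (fun n t => (expR (- ((s0 + n.+1%:R^-1) * t)) * h t)%:E)
  (fun t => (expR (- (s0 * t)) * h t)%:E)
  (fun t => `|(expR (- (s0 * t)) * h t)%:E|%E).
- by move=> n; exact: measurable_int (jh n).
- exact: measurable_int ih.
- apply: aeW => t /posP t0; apply/fine_cvgP; split; first by apply: nearW.
  apply: cvgM; last exact: cvg_cst.
  suff c : - ((s0 + n.+1%:R^-1) * t) @[n --> \oo] --> - (s0 * t).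
    exact: (cvg_comp _ _ c (@continuous_expR R _)).
  apply: cvgN; apply: cvgM; last exact: cvg_cst.
  rewrite -[X in _ --> X]addr0; apply: cvgD; first exact: cvg_cst.
  exact: cvg_harmonic.
- exact: integrable_abse.
- apply: aeW => n t /posP t0 /=; rewrite lee_fin !normrM ler_wpM2r//.
  by rewrite !ger0_norm ?expR_ge0// ler_expR lerN2 ler_wpM2r// ltW.
move=> cv; rewrite /laplace /Rintegral; apply: fine_cvg.
rewrite fineK//; exact: integrable_fin_num ih.
Qed.

Lemma cvg_addr_harmonic (s0 : R) : s0 + n.+1%:R^-1 @[n --> \oo] --> s0.
Proof.
rewrite -[X in _ --> X]addr0; apply: cvgD; first exact: cvg_cst.
exact: cvg_harmonic.
Qed.

(** The base of the second power has a positive real part, where the principal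
    logarithm is smooth. *)
Lemma is_cderive_transfer (k : R) (alpha nu omega a : R[i]) (s0 : R) : 0 < k -> 0 < s0 ->
  normc (transfer_arg k alpha omega s0) < 1 ->
  exists d, is_cderive (transfer k alpha nu omega a) s0 d.
Proof.
move=> k0 s00 z1.
have ks (b : R[i]) : exists d, is_cderive (fun s => cpow (k * s)%:C b) s0 d.
  eexists; apply: is_cderive_eq (is_cderive_scale (cpow k%:C b) (is_cderive_cpow b s00)).
  have : \forall s \near s0, 0 < s by exact: lt_nbhsr.
  by apply: filterS => s sp; rewrite cpowM.
have [d1 h1] := ks (- (nu / k%:C)); have [d2 h2] := ks (- (alpha / k%:C)).
have h3 := is_cderive_add (is_cderive_cst 1 s0) (is_cderive_scale (- (omega * k%:C)) h2).
have re0 : 0 < Re (1 + - (omega * k%:C) * cpow (k * s0)%:C (- (alpha / k%:C))).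
  rewrite mulNr -/(transfer_arg k alpha omega s0) cReD cReN /=.
  by rewrite subr_gt0; apply: le_lt_trans z1; apply: le_trans (Re_le_normc _); exact: ler_norm.
have h4 := is_cderive_cexp (is_cderive_scale (- (a / k%:C)) (is_cderive_clog re0 h3)).
eexists; apply: is_cderive_eq (is_cderive_mul h1 h4).
have := (is_cderive_continuous h3).1 => cont.
have : \forall s \near s0, 0 < Re (1 + - (omega * k%:C) * cpow (k * s)%:C (- (alpha / k%:C))).
  exact: (cont _ (lt_nbhsr re0)).
apply: filterS => s; rewrite /transfer /transfer_arg mulNr => sp.
rewrite [cpow (1 - _) _](_ : _ = cexp (- (a / k%:C) * clog (1 - omega * k%:C * cpow (k * s)%:C (- (alpha / k%:C)))))//.
rewrite {1}/cpow ifF//; apply/negbTE/eqP => E; by rewrite E /= ltxx in sp.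
Qed.

Lemma sumudu_claplace (h : R -> R[i]) (u : R) : 0 < u -> sumudu_exists h u ->
  claplace_integrable h u^-1 /\ sumudu h u = (u^-1)%:C * claplace h u^-1.
Proof.
move=> u0 [h1 h2].
have eR : (fun t => u * Re (sumudu_integrand h u t)) = (fun t => expR (- (u^-1 * t)) * Re (h t)).
  apply/funext => t; rewrite /sumudu_integrand cReRM mulrA mulrA divff ?gt_eqF// mul1r.
  by congr (expR _ * _); rewrite mulNr mulrC.
have eI : (fun t => u * Im (sumudu_integrand h u t)) = (fun t => expR (- (u^-1 * t)) * Im (h t)).
  apply/funext => t; rewrite /sumudu_integrand cImRM mulrA mulrA divff ?gt_eqF// mul1r.
  by congr (expR _ * _); rewrite mulNr mulrC.
split.
  by split; rewrite /laplace_integrable -?eR -?eI; apply: integrable_scale.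
apply: complex_ext; rewrite ?cReRM ?cImRM /= /laplace -?eR -?eI RintegralZl//.
  by rewrite mulrA mulVf ?gt_eqF// mul1r.
by rewrite mulrA mulVf ?gt_eqF// mul1r.
Qed.

(** The derivatives whose limits at 0+ occur in the theorem differentiate the
    same k-Prabhakar integral, since (m - n - 1) k - (mu - (n + 1) k) = m k - mu. *)
Lemma k_prabhakar_deriv_shift (k : R) (alpha mu' omega gamma : R[i]) (f : R -> R[i]) (m n : nat) : (n < m)%N ->
  k_prabhakar_deriv_m k (m - n.+1)%N alpha (mu' - (n.+1%:R * k)%:C) omega gamma f =
  (fun t => (k ^+ (m - n.+1))%:C *
    derive1n (m - n.+1) (k_prabhakar k alpha ((m%:R * k)%:C - mu') omega (- gamma) f : R -> Rcomplex R) t).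
Proof.
move=> nm; apply/funext => t; rewrite /k_prabhakar_deriv_m.
rewrite (_ : ((m - n.+1)%:R * k)%:C - (mu' - (n.+1%:R * k)%:C) = (m%:R * k)%:C - mu')//.
by rewrite natrB// mulrBl rmorphB/=; ring.
Qed.

Lemma transfer_argE (k u : R) (alpha omega : R[i]) : 0 < k -> 0 < u ->
  transfer_arg k alpha omega u^-1 = omega * k%:C * cpow (u / k)%:C (alpha / k%:C).
Proof.
move=> k0 u0; rewrite /transfer_arg cpowN ?divr_gt0// -cpowV ?divr_gt0//.
by rewrite invf_div.
Qed.

Lemma claplace_derive1n (g : R -> Rcomplex R) (m : nat) (l : nat -> R[i]) (s0 : R) : 0 < s0 ->
  (forall j (t : R), (j < m)%N -> 0 < t -> derivable (derive1n j g) t 1) ->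
  (forall j, (j < m)%N -> (derive1n j g t @[t --> 0^'+] --> (l j : Rcomplex R))) ->
  claplace_integrable (derive1n m g) s0 ->
  forall s, s0 < s -> claplace_integrable g s /\
    claplace (derive1n m g) s = (s ^+ m)%:C * claplace g s - \sum_(j < m) (s ^+ (m - j.+1))%:C * l j.
Proof.
move=> s00 dg gl [i1 i2] s s0s.
have E := Rcomplex_derive1n dg; have D := Rcomplex_derivable1n dg.
have gl' j (jm : (j < m)%N) : Re (derive1n j g t) @[t --> 0^'+] --> Re (l j) /\
    Im (derive1n j g t) @[t --> 0^'+] --> Im (l j).
  by apply/Rcomplex_cvgP; exact: gl.
have near0 (p q : R -> R) (a : R) : (forall t : R, 0 < t -> p t = q t) ->
    p t @[t --> 0^'+] --> a -> q t @[t --> 0^'+] --> a.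
  move=> pq; apply: cvg_trans; apply: near_eq_cvg; near=> t; rewrite pq//.
have [|||j1 e1] := @laplace_derive1n R (fun t => Re (g t)) m (fun j => Re (l j)) s0 s00 _ _ _ s s0s.
- by move=> j t jm t0; have [] := D j t jm t0.
- move=> j jm; have [h _] := gl' j jm; apply: near0 h => t t0.
  by have [-> _] := E j (ltnW jm) t t0.
- apply: eq_laplace_integrable i1 => t t0; by have [-> _] := E m (leqnn m) t t0.
have [|||j2 e2] := @laplace_derive1n R (fun t => Im (g t)) m (fun j => Im (l j)) s0 s00 _ _ _ s s0s.
- by move=> j t jm t0; have [] := D j t jm t0.
- move=> j jm; have [_ h] := gl' j jm; apply: near0 h => t t0.
  by have [_ ->] := E j (ltnW jm) t t0.
- apply: eq_laplace_integrable i2 => t t0; by have [_ ->] := E m (leqnn m) t t0.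
split; first by split.
have sumRe : Re (\sum_(j < m) (s ^+ (m - j.+1))%:C * l j) = \sum_(j < m) s ^+ (m - j.+1) * Re (l j).
  rewrite -(big_mkord xpredT (fun j => (s ^+ (m - j.+1))%:C * l j)) Re_sum big_mkord.
  by apply: eq_bigr => j _; rewrite cReRM.
have sumIm : Im (\sum_(j < m) (s ^+ (m - j.+1))%:C * l j) = \sum_(j < m) s ^+ (m - j.+1) * Im (l j).
  rewrite -(big_mkord xpredT (fun j => (s ^+ (m - j.+1))%:C * l j)) Im_sum big_mkord.
  by apply: eq_bigr => j _; rewrite cImRM.
apply: complex_ext.
  rewrite cReD cReN sumRe cReRM -e1; apply: eq_laplace => t t0.
  by have [-> _] := E m (leqnn m) t t0.
rewrite cImD cImN sumIm cImRM -e2; apply: eq_laplace => t t0.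
by have [_ ->] := E m (leqnn m) t t0.
Unshelve. all: by end_near. Qed.

(** The identity on ]s0, +oo[ passes to the limit along a sequence that
    decreases to s0; dominated convergence applies because the transforms exist
    at s0. *)
Lemma claplace_boundary (h f : R -> R[i]) (H P : R -> R[i]) (s0 : R) dH dP :
  claplace_integrable h s0 -> claplace_integrable f s0 ->
  is_cderive H s0 dH -> is_cderive P s0 dP ->
  (forall s, s0 < s -> claplace h s = H s * claplace f s - P s) ->
  claplace h s0 = H s0 * claplace f s0 - P s0.
Proof.
move=> [h1 h2] [f1 f2] /is_cderive_continuous[cH1 cH2] /is_cderive_continuous[cP1 cP2] E.
have sq (q : R -> R) : {for s0, continuous q} -> q (s0 + n.+1%:R^-1) @[n --> \oo] --> q s0.
  by move=> cq; exact: (cvg_comp _ _ (@cvg_addr_harmonic s0) cq).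
have En n : claplace h (s0 + n.+1%:R^-1) = H (s0 + n.+1%:R^-1) * claplace f (s0 + n.+1%:R^-1) - P (s0 + n.+1%:R^-1).
  by apply: E; rewrite ltrDl invr_gt0.
have c1 := laplace_cvg_addr_harmonic h1; have c2 := laplace_cvg_addr_harmonic h2.
have d1 := laplace_cvg_addr_harmonic f1; have d2 := laplace_cvg_addr_harmonic f2.
have [a1 a2] := (sq _ cH1, sq _ cH2); have [b1 b2] := (sq _ cP1, sq _ cP2).
apply: complex_ext.
  apply: (cvg_unique _ c1) => //; rewrite cReD cReN cReM.
  apply: cvg_trans (cvgB (cvgB (cvgM a1 d1) (cvgM a2 d2)) b1).
  by apply: near_eq_cvg; apply: nearW => n; have := congr1 Re (En n); rewrite cReD cReN cReM.
apply: (cvg_unique _ c2) => //; rewrite cImD cImN cImM.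
apply: cvg_trans (cvgB (cvgD (cvgM a1 d2) (cvgM a2 d1)) b2).
by apply: near_eq_cvg; apply: nearW => n; have := congr1 Im (En n); rewrite cImD cImN cImM.
Qed.

Lemma realC_exprn_neq0 (x : R) : 0 < x -> forall n, (x ^+ n)%:C != 0 :> R[i].
Proof. by move=> x0 n; rewrite fmorph_eq0 expf_neq0// gt_eqF. Qed.

(** Makes the kernel integrable at 0: its lowest exponent is nu / k - 1 with
    nu = m k - mu. *)
Lemma k_order_gt (k : R) (mu' : R[i]) : 0 < k ->
  0 < Re (((k_order k mu')%:R * k)%:C - mu').
Proof. by move=> k0; rewrite cReD cReN /= subr_gt0 /k_order -ltr_pdivrMr// truncnS_gt. Qed.

Lemma is_cderive_real_exp (m : nat) (s : R) : exists d, is_cderive (fun s => (s ^+ m)%:C) s d.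
Proof.
elim: m => [|m [d IH]].
  by exists 0; rewrite (_ : (fun _ => _) = cst 1); [exact: is_cderive_cst|apply/funext => t].
have h := is_cderive_mul (is_cderive_real (is_derive_id s 1)) IH.
eexists; rewrite (_ : (fun t => (t ^+ m.+1)%:C) = (fun t => t%:C * (t ^+ m)%:C)); first exact: h.
by apply/funext => t; rewrite exprS rmorphM.
Qed.

Lemma is_cderive_sum (m : nat) (F : nat -> R -> R[i]) (s : R) :
  (forall j, exists d, is_cderive (F j) s d) ->
  exists d, is_cderive (fun s => \sum_(j < m) F j s) s d.
Proof.
move=> hF; elim: m => [|m [d IH]].
  exists 0; rewrite (_ : (fun _ => _) = cst 0); first exact: is_cderive_cst.
  by apply/funext => t; rewrite big_ord0.
have [e he] := hF m; exists (d + e).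
rewrite (_ : (fun t => \sum_(j < m.+1) F j t) = (fun t => \sum_(j < m) F j t + F m t)).
  exact: is_cderive_add IH he.
by apply/funext => t; rewrite big_ord_recr.
Qed.

Lemma has_at0p_scale (c : R[i]) (h : R -> R[i]) : c != 0 -> has_at0p (fun t => c * h t) ->
  (h t : Rcomplex R) @[t --> 0^'+] --> (c^-1 * at0p (fun t => c * h t) : Rcomplex R).
Proof.
move=> c0 /at0p_cvg[c1 c2]; apply/Rcomplex_cvgP; split.
  rewrite cReM; apply: cvg_trans (cvgB (cvgM (@cvg_cst _ (Re c^-1) _ _ _) c1) (cvgM (@cvg_cst _ (Im c^-1) _ _ _) c2)).
  by apply: near_eq_cvg; apply: nearW => t /=; rewrite -[in RHS](mulKf c0 (h t)) [in RHS]cReM.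
rewrite cImM; apply: cvg_trans (cvgD (cvgM (@cvg_cst _ (Re c^-1) _ _ _) c2) (cvgM (@cvg_cst _ (Im c^-1) _ _ _) c1)).
by apply: near_eq_cvg; apply: nearW => t /=; rewrite -[in RHS](mulKf c0 (h t)) [in RHS]cImM.
Qed.

(** k^m u^(- m) = (k / u)^m cancels the part m k of nu = m k - mu, and the other
    powers of k / u become powers of u / k. *)
Lemma transfer_sumudu (k u : R) (alpha mu' omega gamma : R[i]) (m : nat) : 0 < k -> 0 < u ->
  (k ^+ m)%:C * (u^-1 ^+ m)%:C * transfer k alpha ((m%:R * k)%:C - mu') omega (- gamma) u^-1 =
  cpow (u / k)%:C (- (mu' / k%:C)) *
  cpow (1 - omega * k%:C * cpow (u / k)%:C (alpha / k%:C)) (gamma / k%:C).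
Proof.
move=> k0 u0; rewrite /transfer transfer_argE// mulNr opprK mulrA; congr (_ * _).
have ku : 0 < k * u^-1 by rewrite mulr_gt0 ?invr_gt0.
have -> : u / k = (k * u^-1)^-1 by rewrite invf_div.
have -> : (k ^+ m)%:C * (u^-1 ^+ m)%:C = cpow (k * u^-1)%:C m%:R :> R[i].
  by rewrite cpow_natr// exprMn rmorphM.
rewrite cpowV// -cpowN// opprK -cpowD//; congr cpow.
have k1 : k%:C != 0 :> R[i] by rewrite fmorph_eq0 gt_eqF.
by rewrite rmorphM/= rmorph_nat; field.
Qed.

Lemma boundary_term (k u : R) (z : R[i]) (m n : nat) : 0 < k -> (n < m)%N ->
  (u^-1)%:C * ((k ^+ m)%:C * ((u^-1 ^+ n)%:C * ((k ^+ (m - n.+1))%:C^-1 * z))) =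
  ((k / u) ^+ n.+1)%:C * z.
Proof.
move=> k0 nm; have k1 := realC_exprn_neq0 k0 (m - n.+1).
rewrite -{1}(subnK nm) exprD exprMn [u^-1 ^+ n.+1]exprS !rmorphM/=.
move: (_ ^+ (m - n.+1))%:C k1 => p p0; set q := (_ ^+ n.+1)%:C; set v := (u^-1 ^+ n)%:C.
by set w := (u^-1)%:C; clearbody q v w; field.
Qed.

End Assembly.

Unset Implicit Arguments.

Theorem lemma3p6 (R : realType) (k : R) (alpha mu omega gamma : R[i])
    (m : nat) (f : R -> R[i]) (u : R)
    (hk : 0 < k) (halpha : 0 < complex.Re alpha) (hmu : 0 < complex.Re mu)
    (hm : m = k_order k mu)
    (hD : k_prabhakar_deriv_exists k alpha mu omega gamma f)
    (h0 : forall n : nat, (n < m)%N ->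
      has_at0p (k_prabhakar_deriv_m k (m - n.+1)%N alpha
        (mu - (n.+1%:R * k)%:C) omega gamma f))
    (hu : 0 < u)
    (hF : sumudu_exists f u)
    (hSD : sumudu_exists (k_prabhakar_deriv k alpha mu omega gamma f) u)
    (hlt : `|omega * k%:C * cpow (u / k)%:C (alpha / k%:C)| < 1) :
  sumudu (k_prabhakar_deriv k alpha mu omega gamma f) u =
    cpow (u / k)%:C (- (mu / k%:C)) *
    cpow (1 - omega * k%:C * cpow (u / k)%:C (alpha / k%:C)) (gamma / k%:C) *
    sumudu f u -
    \sum_(n < m) ((k / u) ^+ n.+1)%:C *
      at0p (k_prabhakar_deriv_m k (m - n.+1)%N alpha
        (mu - (n.+1%:R * k)%:C) omega gamma f)
  /\
  (m = 1%N ->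
    sumudu (k_prabhakar_deriv k alpha mu omega gamma f) u =
      cpow (u / k)%:C (- (mu / k%:C)) *
      cpow (1 - omega * k%:C * cpow (u / k)%:C (alpha / k%:C)) (gamma / k%:C) *
      sumudu f u -
      (k / u)%:C * at0p (k_prabhakar k alpha (k%:C - mu) omega (- gamma) f)).
Proof.
pose nu := (m%:R * k)%:C - mu; pose g := k_prabhakar k alpha nu omega (- gamma) f.
pose G := derive1n m (g : R -> Rcomplex R).
have u1 : 0 < u^-1 by rewrite invr_gt0.
have nu0 : 0 < complex.Re nu by rewrite /nu hm; exact: k_order_gt.
have z1 : Normc.normc (transfer_arg k alpha omega u^-1) < 1.
  by rewrite transfer_argE//; move: hlt; rewrite normr_complex ltcR.
have [dI dD] := hD; rewrite -hm in dI dD.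
have [iF eF] := sumudu_claplace hu hF.
have [iY eY] := sumudu_claplace hu hSD.
have YE : k_prabhakar_deriv k alpha mu omega gamma f = fun t => (k ^+ m)%:C * G t.
  by rewrite /k_prabhakar_deriv -hm.
have km0 := realC_exprn_neq0 hk.
have [iG eG] := claplace_scale ((k ^+ m)%:C^-1) iY.
have GE : (fun t => (k ^+ m)%:C^-1 * k_prabhakar_deriv k alpha mu omega gamma f t) = G.
  by apply/funext => t; rewrite YE mulKf.
rewrite GE in iG eG.
pose L n := at0p (k_prabhakar_deriv_m k (m - n.+1)%N alpha (mu - (n.+1%:R * k)%:C) omega gamma f).
(* the limit at 0+ of the j-th derivative of g, which the theorem lists under
   n = m - j - 1 *)
pose l j : R[i] := (k ^+ j)%:C^-1 * L (m - j.+1)%N.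
have gl j : (j < m)%N -> (derive1n j (g : R -> Rcomplex R) t @[t --> 0^'+] --> (l j : Rcomplex R)).
  move=> jm; have nm : (m - j.+1 < m)%N by lia.
  have mj : (m - (m - j.+1).+1)%N = j by lia.
  have := h0 _ nm; rewrite (k_prabhakar_deriv_shift _ _ _ _ _ _ nm) mj => h.
  have := has_at0p_scale (km0 j) h; rewrite /l /L (k_prabhakar_deriv_shift _ _ _ _ _ _ nm) mj.
  exact.
have main : sumudu (k_prabhakar_deriv k alpha mu omega gamma f) u =
    cpow (u / k)%:C (- (mu / k%:C)) *
    cpow (1 - omega * k%:C * cpow (u / k)%:C (alpha / k%:C)) (gamma / k%:C) *
    sumudu f u - \sum_(n < m) ((k / u) ^+ n.+1)%:C * L n.
  have dG := claplace_derive1n u1 dD gl iG.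
  have [dT hT] := is_cderive_transfer nu (- gamma) hk u1 z1.
  have eL s : u^-1 < s -> claplace g s = transfer k alpha nu omega (- gamma) s * claplace f s.
    apply: (@prabhakar_laplace R k alpha nu omega (- gamma) hk halpha nu0 f g u^-1 u1 z1 _ _ dI (fun _ _ => erefl)).
    - by move=> t ut; split; [apply: laplace_integrable_le iF.1|apply: laplace_integrable_le iF.2]; exact: ltW.
    - by move=> t /dG[].
  pose P s := \sum_(j < m) (s ^+ (m - j.+1))%:C * l j.
  have [dP hP] : exists d, is_cderive P u^-1 d.
    apply: (@is_cderive_sum R m (fun j s => (s ^+ (m - j.+1))%:C * l j)) => j.
    have [d hd] := is_cderive_real_exp (m - j.+1) u^-1.
    by eexists; exact: is_cderive_mul hd (is_cderive_cst _ _).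
  have [dM hM] := is_cderive_real_exp m u^-1.
  (* the identity is known for s > 1/u; P collects the boundary terms *)
  have eB : claplace G u^-1 = (u^-1 ^+ m)%:C * transfer k alpha nu omega (- gamma) u^-1 * claplace f u^-1 - P u^-1.
    apply: (claplace_boundary iG iF (is_cderive_mul hM hT) hP) => s us.
    by have [_ ->] := dG s us; rewrite (eL s us) mulrA.
  rewrite eG in eB.
  have {eB} : claplace (k_prabhakar_deriv k alpha mu omega gamma f) u^-1 = 
    (k ^+ m)%:C * ((u^-1 ^+ m)%:C * transfer k alpha nu omega (- gamma) u^-1 * claplace f u^-1 - P u^-1).
    by rewrite -eB mulVKf.
  move=> eB; rewrite eY eB eF mulrBr mulrBr; congr (_ - _).
    rewrite -(transfer_sumudu alpha mu omega gamma m hk hu); ring.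
  rewrite /P !mulr_sumr (reindex_inj rev_ord_inj)/=; apply: eq_bigr => n _.
  have nm := ltn_ord n.
  rewrite /l (_ : (m - (m - n.+1).+1)%N = n); last by lia.
  exact: boundary_term.
split=> [//|m1].
rewrite main; congr (_ - _); rewrite /L m1 big_ord_recl big_ord0 addr0 expr1; congr (_ * at0p _).
apply/funext => t; rewrite /k_prabhakar_deriv_m expr0 mul1r /=.
by rewrite mul0r sub0r mul1r opprB.
Qed.
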